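(* Suppose $H(\Lambda)$ is nonlattice. Fix $\Delta>0$, let $E_N\in\mathbb{R}$ (for $N\geq1$) satisfy $E_N/N\to u>0$, and set $\beta=m^{-1}(u)$. Then $G_N(E_N,\Delta)>0$ for all sufficiently large $N$, and for every fixed $k\geq1$, $$\left\|(\pi_k)_*\mu^{\mathrm{mc}}_{N,E_N,\Delta}-p_\beta^{\otimes k}\right\|_{\mathrm{TV}}\to0,\quad N\to+\infty.$$ Moreover, let $u_N=E_N/N$ and $\beta_N=m^{-1}(u_N)$ (defined for all sufficiently large $N$). Then, as $N\to+\infty$, $$G_N(E_N,\Delta)=\frac{Z(\beta_N)^Ne^{\beta_NE_N}}{\sqrt{2\pi N\sigma^2(\beta_N)}}\left(\int_0^{\Delta}e^{\beta_Nt}\,dt\right)(1+o(1)).$$ Consequently, $$\lim_{N\to+\infty}\frac{1}{N}\log G_N(E_N,\Delta)=\psi(\beta)+\beta u=s(u).$$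
   Context: $\Lambda$ is a free $\mathbb{Z}$-module of finite rank $d\geq1$, $\|\cdot\|$ is a Euclidean norm (coming from an inner product) on $\Lambda\otimes_{\mathbb{Z}}\mathbb{R}$, and $H(x)=\|x\|^2$ for $x\in\Lambda$. A subset $A\subseteq\mathbb{R}$ is called lattice if $A\subseteq a+h\mathbb{Z}$ for some $a\in\mathbb{R}$, $h>0$, and nonlattice otherwise. For $\beta>0$: $Z(\beta)=\sum_{x\in\Lambda}e^{-\beta H(x)}$, $\psi(\beta)=\log Z(\beta)$, $p_\beta(x)=Z(\beta)^{-1}e^{-\beta H(x)}$ (a probability measure on $\Lambda$), $m(\beta)=\mathbb{E}_{p_\beta}[H]$, $\sigma^2(\beta)=\operatorname{Var}_{p_\beta}[H]$. The function $m:(0,+\infty)\to(0,+\infty)$ is a decreasing bijection, with inverse $m^{-1}$. For $u>0$, $s(u)=\inf_{\theta>0}\{\psi(\theta)+\theta u\}$. For $N\geq1$ and $x=(x_1,\dots,x_N)\in\Lambda^N$, $H_N(x)=\sum_{i=1}^NH(x_i)$. For $E\in\mathbb{R}$ and $\Delta>0$, $\Omega_N(E,\Delta)=\{x\in\Lambda^N:E\leq H_N(x)<E+\Delta\}$ and $G_N(E,\Delta)=\#\Omega_N(E,\Delta)$ (finite); whenever $G_N(E,\Delta)>0$, $\mu^{\mathrm{mc}}_{N,E,\Delta}$ is the uniform probability measure on $\Omega_N(E,\Delta)$. For $N\geq k$, $\pi_k:\Lambda^N\to\Lambda^k$ is the projection onto the first $k$ coordinates, $(\pi_k)_*$ is push-forward,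 and $\|\mu-\nu\|_{\mathrm{TV}}=\sup_A|\mu(A)-\nu(A)|=\frac12\sum_x|\mu(x)-\nu(x)|$ for probability measures on a countable set. *)

(* Defs.v *)
From HB Require Import structures.
From mathcomp Require Import all_boot all_order all_algebra finmap.
From mathcomp Require Import all_classical all_reals all_analysis.

Set Implicit Arguments.
Unset Strict Implicit.
Unset Printing Implicit Defensive.

Import Order.TTheory GRing.Theory Num.Theory.
Import numFieldNormedType.Exports.

Local Open Scope fset_scope.
Local Open Scope classical_set_scope.
Local Open Scope ring_scope.

Definition free_of_rank (L : zmodType) (d : nat) : Prop :=
  exists e : 'I_d -> L,
    bijective (fun c : {ffun 'I_d -> int} => \sum_(i < d) e i *~ c i).

(* [iota : L -> V] exhibits the real vector space [V] as the tensor product of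
   [L] with [R] over the integers (universal property of extension of
   scalars). *)
Definition is_scalar_extension (R : realType) (L : zmodType) (V : lmodType R)
    (iota : {additive L -> V}) : Prop :=
  forall (W : lmodType R) (f : {additive L -> W}),
    exists g : {linear V -> W},
      (forall x, g (iota x) = f x) /\
      (forall g' : {linear V -> W}, (forall x, g' (iota x) = f x) -> g' =1 g).

(* For the identity involution of [R], [{dot V for idfun}] is the type of real
   inner products (symmetric positive definite bilinear forms) on [V]. *)
Definition euclidean_norm (R : realType) (V : lmodType R)
    (ip : {dot V for @idfun R}) (v : V) : R := Num.sqrt (ip v v).

Definition energy (R : realType) (L : zmodType) (V : lmodType R)
    (iota : {additive L -> V}) (ip : {dot V for @idfun R}) (x : L) : R :=
  euclidean_norm ip (iota x) ^+ 2.

Definition lattice_set (R : realType) (A : set R) : Prop :=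
  exists a h : R, 0 < h /\ A `<=` [set a + h * n%:~R | n in [set: int]].

(* Measures on a discrete set are given by their mass functions [mu : T -> R],
   [mu >= 0]. As [esum] is a supremum over finite subsets, the sums below are
   only meant for nonnegative summands. *)
Definition mass_of (R : realType) (T : choiceType) (mu : T -> R) (A : set T) : R :=
  fine (\esum_(x in A) (mu x)%:E).

Definition expect (R : realType) (T : choiceType) (mu f : T -> R) : R :=
  fine (\esum_(x in [set: T]) (mu x * f x)%:E).

Definition variance_of (R : realType) (T : choiceType) (mu f : T -> R) : R :=
  expect mu (fun x => (f x - expect mu f) ^+ 2).

Definition image_mass (R : realType) (S T : choiceType) (f : S -> T)
    (mu : S -> R) (y : T) : R :=
  mass_of mu (f @^-1` [set y]).

Definition power_mass (R : realType) (T : choiceType) (k : nat)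
    (mu : T -> R) (y : {ffun 'I_k -> T}) : R :=
  \prod_(i < k) mu (y i).

Definition tv_dist (R : realType) (T : choiceType) (mu nu : T -> R) : R :=
  sup [set `|mass_of mu A - mass_of nu A| | A in [set: set T]].

Section Thermodynamics.
Context {R : realType} {L : choiceType}.
Variable H : L -> R.

Definition partition_function (beta : R) : R :=
  fine (\esum_(x in [set: L]) (expR (- beta * H x))%:E).

Definition psi (beta : R) : R := ln (partition_function beta).

Definition gibbs (beta : R) (x : L) : R :=
  (partition_function beta)^-1 * expR (- beta * H x).

Definition mean_energy (beta : R) : R := expect (gibbs beta) H.

Definition var_energy (beta : R) : R := variance_of (gibbs beta) H.

(* The inverse of [mean_energy] restricted to the positive half-line; its value
   outside the image of [mean_energy] is irrelevant. *)
Definition inv_temp : R -> R :=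
  'pinv_(fun=> 1) [set beta : R | 0 < beta] mean_energy.

Definition entropy (u : R) : R :=
  inf [set psi theta + theta * u | theta in [set theta : R | 0 < theta]].

Definition total_energy (N : nat) (x : {ffun 'I_N -> L}) : R :=
  \sum_(i < N) H (x i).

Definition shell (N : nat) (E Delta : R) : set {ffun 'I_N -> L} :=
  [set x | E <= total_energy x < E + Delta].

(* [fset_set A] is the finite set with the elements of [A] if [A] is finite,
   and is empty otherwise. *)
Definition shell_card (N : nat) (E Delta : R) : nat :=
  #|` fset_set (@shell N E Delta)|.

Definition microcanonical (N : nat) (E Delta : R) (x : {ffun 'I_N -> L}) : R :=
  if x \in @shell N E Delta then (shell_card N E Delta)%:R^-1 else 0.

End Thermodynamics.

(* The projection on the first [k] coordinates, made total by padding with zeros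
   when [N < k]. *)
Definition proj_first (L : zmodType) (k N : nat) (x : {ffun 'I_N -> L}) :
    {ffun 'I_k -> L} :=
  [ffun i : 'I_k => oapp x 0 (insub (val i))].

Lemma proj_firstE (L : zmodType) (k N : nat) (kN : (k <= N)%N)
    (x : {ffun 'I_N -> L}) (i : 'I_k) :
  proj_first k x i = x (widen_ord kN i).
Proof.
rewrite ffunE insubT ?(leq_trans (ltn_ord i) kN)// => h.
by congr (x _); apply/val_inj.
Qed.

(* Main.v *)
Require Import Defs.
From HB Require Import structures.
From mathcomp Require Import all_boot all_order all_algebra.
From mathcomp Require Import all_classical all_reals all_analysis.
From mathcomp Require Import measurable_realfun gauss_integral ring lra complex.

Set Implicit Arguments.
Unset Strict Implicit.
Unset Printing Implicit Defensive.

Import Order.TTheory GRing.Theory Num.Theory.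
Import numFieldNormedType.Exports.
Import Normc.

Local Open Scope classical_set_scope.
Local Open Scope ring_scope.

(* Enumerate the lattice, h_j = H(e_j), and tilt: with
   beta_N = m^-1(E_N / N) the Gibbs weights make H_N a sum of N i.i.d. variables
   whose mean is exactly E_N, and G_N = Z(beta_N)^N times the expectation of
   e^{beta_N H_N} over the window [E_N, E_N + Delta).  So everything reduces to a
   local limit theorem of Stone type: sqrt(N) E[g(H_N - E_N)] converges to
   (2 pi sigma^2)^{-1/2} \int g for g = e^{beta t} on [0, Delta).  For g a Fejer
   kernel, whose Fourier transform is an explicit compactly supported function,
   this follows from the Gaussian behaviour of the characteristic function near 0
   and from its modulus being < 1 away from 0 (nonlattice condition), uniformly in
   beta near the limit.  Positivity upgrades the Fejer kernels to indicators of
   intervals, then to g.  To keep all sums finite, N is paired with a cutoff n(N)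
   beyond which the weights are negligible.  The marginal of the microcanonical
   measure at y is a ratio of two counts, G_{N-k}(E_N - H_k(y)) / G_N(E_N), so it
   converges pointwise to p_beta^{(x) k}, hence in total variation (Scheffe). *)

(** * Calculus on the real line *)

(** The tilt [beta_N] moves with [N], so every constant of the local limit theorem (fourth moment,
    gap of the characteristic function below 1) must be uniform near [beta]; continuity of the
    moments in [beta] supplies this. The theorem also allows the mean to miss [E N] by a bounded
    amount. The marginal compares N - k coordinates at energy E_N - H_k(y) with N coordinates at
    E_N, both under the same tilt, so that the exponential factors cancel up to Z^-k e^{- beta
    H_k(y)}. A bounded shift of the mean changes the phase of the Fourier integrand by O(t), which
    is invisible at the relevant scale t ~ N^{-1/2}. The cutoff costs nothing in the count, since a
    shell only involves finitely many points. Its errors in mass, mean and variance are kept below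
    N^-3: in an N-th power they cost N * N^-3, whereas the prefactor sqrt N tolerates o(N^{-1/2}).
    The nonlattice condition enters in the form: for each t > 0 some cos(t h_j) differs from 1. The
    zero vector has energy 0, and this level serves as the reference phase. *)

(* A plain constant rather than the class [is_derive], so that derivatives are
   computed by the rules below and not by instance resolution. *)
Definition deriv_at (R : realType) (f : R -> R) (x a : R) : Prop :=
  is_derive x 1 f a.

Section pointwise_derivatives.
Variables (R : realType) (f g : R -> R) (x a b : R).
Hypotheses (df : deriv_at f x a) (dg : deriv_at g x b).

Lemma deriv_at_eq : a = b -> deriv_at f x b.
Proof. by move=> <-. Qed.

Lemma deriv_at_derivable : derivable f x 1.
Proof. exact: (@ex_derive _ _ _ _ _ _ _ df). Qed.

Lemma deriv_at_val : derive1 f x = a.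
Proof. by rewrite derive1E (@derive_val _ _ _ _ _ _ _ df). Qed.

Lemma deriv_at_continuous : {for x, continuous f}.
Proof.
apply/differentiable_continuous/derivable1_diffP; exact: deriv_at_derivable.
Qed.

Lemma deriv_atD : deriv_at (fun y => f y + g y) x (a + b).
Proof. exact: is_deriveD. Qed.

Lemma deriv_atB : deriv_at (fun y => f y - g y) x (a - b).
Proof. exact: is_deriveB. Qed.

Lemma deriv_atN : deriv_at (fun y => - f y) x (- a).
Proof. exact: is_deriveN. Qed.

Lemma deriv_atM : deriv_at (fun y => f y * g y) x (a * g x + f x * b).
Proof. by apply: (is_derive_eq (is_deriveM df dg)); rewrite /GRing.scale/=; ring. Qed.

Lemma deriv_atV : f x != 0 -> deriv_at (fun y => (f y)^-1) x (- a / f x ^+ 2).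
Proof.
move=> fx0; apply: (DeriveDef (derivableV fx0 deriv_at_derivable)).
rewrite deriveV//; last exact: deriv_at_derivable.
by rewrite (@derive_val _ _ _ _ _ _ _ df) /GRing.scale /=; ring.
Qed.

Lemma deriv_at_expR : deriv_at (fun y => expR (f y)) x (expR (f x) * a).
Proof. exact: (@is_derive1_comp _ expR f). Qed.

Lemma deriv_at_sin : deriv_at (fun y => sin (f y)) x (cos (f x) * a).
Proof. exact: (@is_derive1_comp _ (@sin R) f). Qed.

Lemma deriv_at_cos : deriv_at (fun y => cos (f y)) x (- sin (f x) * a).
Proof. exact: (@is_derive1_comp _ (@cos R) f). Qed.

End pointwise_derivatives.

Lemma deriv_at_cst (R : realType) (x c : R) : deriv_at (fun=> c) x 0.
Proof. exact: is_derive_cst. Qed.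

Lemma deriv_at_id (R : realType) (x : R) : deriv_at (fun y => y) x 1.
Proof. exact: is_derive_id. Qed.

Lemma deriv_at_comp (R : realType) (f g : R -> R) (x a b : R) :
  deriv_at g (f x) a -> deriv_at f x b -> deriv_at (fun y => g (f y)) x (a * b).
Proof. by move=> dg df; exact: (@is_derive1_comp _ g f _ _ _ dg df). Qed.

Lemma deriv_at_sqr (R : realType) (x : R) (f : R -> R) (a : R) :
  deriv_at f x a -> deriv_at (fun y => f y ^+ 2) x (2 * f x * a).
Proof.
move=> df; under eq_fun do rewrite expr2.
by apply: (deriv_at_eq (deriv_atM df df)); ring.
Qed.

(** The derivative is an existential variable filled in by the rules; the equation left to the
    caller compares it with the expected value, and [reflexivity] closes it where only continuity is
    wanted. *)
Ltac derive_tac :=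
  eapply deriv_at_eq;
  [ repeat first [ assumption | apply: deriv_at_cst | apply: deriv_at_id
      | apply: deriv_at_sqr | apply: deriv_at_expR | apply: deriv_at_sin
      | apply: deriv_at_cos | apply: deriv_atB | apply: deriv_atD
      | apply: deriv_atN | apply: deriv_atM | apply: deriv_atV ]
  | cbv beta ].

Lemma deriv_at_is_cst (R : realType) (f : R -> R) :
  (forall x, deriv_at f x 0) -> forall x y, f x = f y.
Proof. by move=> df x y; apply: is_derive_0_is_cst. Qed.

Lemma deriv_at_mvt (R : realType) (f df : R -> R) (a b : R) : a <= b ->
  (forall x, a <= x <= b -> deriv_at f x (df x)) ->
  exists2 c, a <= c <= b & f b - f a = df c * (b - a).
Proof.
move=> ab dfE.
have [||c + ->] := @MVT_segment R f df a b ab.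
- by move=> x; rewrite in_itv/= => /andP[/ltW ax /ltW xb]; apply: dfE; rewrite ax.
- apply: continuous_in_subspaceT => x; rewrite inE/= in_itv/= => xab.
  exact: deriv_at_continuous (dfE _ xab).
by rewrite in_itv/= => cab; exists c.
Qed.

Lemma deriv_at_ge0_le (R : realType) (f df : R -> R) (a b : R) : a <= b ->
  (forall x, a <= x <= b -> deriv_at f x (df x)) ->
  (forall x, a <= x <= b -> 0 <= df x) -> f a <= f b.
Proof.
move=> ab dfE df0; have [c cab E] := deriv_at_mvt ab dfE.
by rewrite -subr_ge0 E mulr_ge0 ?df0// subr_ge0.
Qed.

Lemma deriv_at_le0_le (R : realType) (f df : R -> R) (a b : R) : a <= b ->
  (forall x, a <= x <= b -> deriv_at f x (df x)) ->
  (forall x, a <= x <= b -> df x <= 0) -> f b <= f a.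
Proof.
move=> ab dfE df0; have [c cab E] := deriv_at_mvt ab dfE.
by rewrite -subr_le0 E mulr_le0_ge0 ?df0// subr_ge0.
Qed.

Lemma continuous_integrable (R : realType) (a b : R) (f : R -> R) :
  continuous f -> (@lebesgue_measure R).-integrable `[a, b] (EFin \o f).
Proof.
move=> cf; apply: continuous_compact_integrable; first exact: segment_compact.
exact: continuous_subspaceT.
Qed.

Lemma Rintegral_derive (R : realType) (f F : R -> R) (a b : R) : a <= b ->
  continuous f -> (forall x, deriv_at F x (f x)) ->
  \int[@lebesgue_measure R]_(x in `[a, b]) f x = F b - F a.
Proof.
move=> ab cf dF; have cF x := deriv_at_continuous (dF x).
move: ab; rewrite le_eqVlt => /predU1P[<-|ab].
  by rewrite set_itv1 Rintegral_set1 subrr.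
rewrite /Rintegral (@continuous_FTC2 R f F)//.
- exact: continuous_subspaceT.
- split.
  + move=> x _; exact: deriv_at_derivable (dF x).
  + by apply: cvg_at_right_filter; exact: cF.
  + by apply: cvg_at_left_filter; exact: cF.
- by move=> x _; exact: deriv_at_val (dF x).
Qed.

Lemma Rintegral_sum (R : realType) (I : finType) (f : I -> R -> R) (a b : R) :
  (forall i, continuous (f i)) ->
  \int[@lebesgue_measure R]_(x in `[a, b]) (\sum_i f i x) =
  \sum_i \int[@lebesgue_measure R]_(x in `[a, b]) f i x.
Proof.
move=> cf.
suff H (s : seq I) : continuous (fun x => \sum_(i <- s) f i x) /\
  \int[@lebesgue_measure R]_(x in `[a, b]) (\sum_(i <- s) f i x) =
  \sum_(i <- s) \int[@lebesgue_measure R]_(x in `[a, b]) f i x by have [] := H (index_enum I).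
elim: s => [|i s [cs IH]].
  split; first by under eq_fun do rewrite big_nil; exact: cst_continuous.
  rewrite big_nil; under eq_Rintegral do rewrite big_nil.
  by rewrite Rintegral_cst// mul0r.
split.
  under eq_fun do rewrite big_cons.
  by move=> x; apply: cvgD; [exact: cf|exact: cs].
under eq_Rintegral do rewrite big_cons.
by rewrite RintegralD//; [rewrite IH big_cons|exact: continuous_integrable|exact: continuous_integrable].
Qed.

Lemma ler_Rintegral (R : realType) (f g : R -> R) (a b : R) :
  continuous f -> continuous g -> (forall x, a <= x <= b -> f x <= g x) ->
  \int[@lebesgue_measure R]_(x in `[a, b]) f x <=
  \int[@lebesgue_measure R]_(x in `[a, b]) g x.
Proof.
move=> cf cg fg; apply: le_Rintegral => //; try exact: continuous_integrable.
Qed.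

Lemma ler_norm_Rintegral (R : realType) (f g : R -> R) (a b : R) :
  continuous f -> continuous g -> (forall x, a <= x <= b -> `|f x| <= g x) ->
  `|\int[@lebesgue_measure R]_(x in `[a, b]) f x| <=
  \int[@lebesgue_measure R]_(x in `[a, b]) g x.
Proof.
move=> cf cg fg; apply: (le_trans (le_normr_Rintegral _ _)) => //.
  exact: continuous_integrable.
apply: ler_Rintegral => // x; apply: cvg_norm; exact: cf.
Qed.

(** Encodes an improper integral as the limit at infinity of an odd antiderivative on the whole
    line. The Fejer and Gauss integrals over growing segments are then handled through values of
    [F]. *)
Lemma antiderivative_even (R : realType) (f : R -> R) (l : R) :
  continuous f -> (forall x, 0 <= f x) -> (forall x, f (- x) = f x) ->
  (\int[@lebesgue_measure R]_(x in `[0%R, +oo[) (f x)%:E = l%:E)%E ->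
  exists F : R -> R, [/\ forall x, deriv_at F x (f x),
    forall x, F (- x) = - F x & F x @[x --> +oo] --> l].
Proof.
set mu := @lebesgue_measure R.
move=> cf f0 fe fl.
have mf : measurable_fun [set: R] f by exact: measurable_realfun.continuous_measurable_fun.
have iT : (\int[mu]_x (f x)%:E = 2%:E * l%:E)%E.
  rewrite ge0_symfun_integralT//; last by move=> x /=; rewrite fe.
  by rewrite -set_itvcy fl.
have intT : mu.-integrable [set: R] (EFin \o f).
  apply/integrableP; split; first exact/measurable_EFinP.
  under eq_integral do rewrite /= ger0_norm//.
  by rewrite iT -EFinM ltry.
pose F x := \int[mu]_(t in `]-oo, x]) f t.
have dF x : deriv_at F x (f x).
  have [] := @continuous_FTC1 R f -oo%O x (x + 1).
  - by rewrite ltrDl.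
  - by apply: integrableS intT.
  - by rewrite ltNyr.
  - exact: cf.
  by move=> d e; apply: DeriveDef => //; rewrite -derive1E.
have F0 : F 0 = l.
  rewrite /F /Rintegral -{1}oppr0 ge0_integration_by_substitutionNy.
  - under eq_integral do rewrite /= fe.
    by rewrite fl.
  - exact: continuous_subspaceT.
  - by move=> x _; exact: f0.
exists (fun x => F x - l); split.
- by move=> x; derive_tac; [exact: dF|ring].
- move=> x; pose h y := F y - l + (F (- y) - l).
  have dh y : deriv_at h y 0.
    rewrite /h; derive_tac; first exact: dF.
      by apply: (@deriv_at_comp _ -%R F); [exact: dF|derive_tac].
    by rewrite fe; ring.
  have := deriv_at_is_cst dh x 0.
  rewrite /h oppr0 F0 subrr addr0 => /eqP; rewrite addr_eq0 => /eqP ->.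
  by rewrite opprK.
(* Monotone convergence gives the limit along the integers; monotonicity of [F] extends it to real
   arguments. *)
- have Fn (n : nat) : F n%:R - l = \int[mu]_(x in `[0, n%:R]) f x.
    by rewrite (@Rintegral_derive _ _ F)// F0.
  have nd : nondecreasing_fun F.
    move=> x y xy; rewrite -subr_ge0 -(@Rintegral_derive _ f F)//.
    by apply: Rintegral_ge0.
  have cn : (F n%:R - l) @[n --> \oo] --> l.
    have := @ge0_cvgn_integral R mu _ f0 mf; rewrite -/mu fl.
    move=> /fine_cvgP[_].
    by under [X in _ -> X @ _ --> _]eq_fun do rewrite Fn.
  have cn' : F n%:R @[n --> \oo] --> l + l.
    under eq_fun do rewrite -(subrK l (F _)).
    by apply: cvgD cn _; exact: cvg_cst.
  rewrite -[X in _ --> X](addrK l); apply: cvgB; last exact: cvg_cst.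
  apply/cvgrPdist_le => e e0.
  have /cvgrPdist_le/(_ e e0)[M _ HM] := cn'.
  have Fle x : F x <= l + l.
    have : (\forall n \near \oo, F x <= F n%:R).
      near=> n; apply: nd; near: n; exact: nbhs_infty_ger.
    by move=> H; rewrite -(cvg_lim _ cn')//; apply: limr_ge => //; apply/cvg_ex; exists (l + l).
  near=> x.
  rewrite ger0_norm ?subr_ge0//.
  have := HM M (leqnn M); rewrite /= ger0_norm ?subr_ge0//.
  apply: le_trans; rewrite lerD2l lerN2; apply: nd.
  near: x; apply: nbhs_pinfty_ge; exact: num_real.
Unshelve. all: by end_near. Qed.

(** First rung of a ladder: each Taylor bound up to [normr_cos_taylor] comes from integrating an
    earlier one from 0, where both sides agree. Negative arguments follow by parity. *)
Lemma sin_le_id (R : realType) (x : R) : 0 <= x -> sin x <= x.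
Proof.
move=> x0; rewrite -subr_ge0.
have := @deriv_at_ge0_le R (fun x => x - sin x) (fun x => 1 - cos x) 0 x x0.
rewrite sin0 subrr; apply.
  by move=> y _; derive_tac; ring.
by move=> y _; rewrite subr_ge0 cos_le1.
Qed.

Lemma one_sub_cos_le (R : realType) (x : R) : 1 - cos x <= x ^+ 2 / 2.
Proof.
wlog x0 : x / 0 <= x.
  move=> H; case: (lerP 0 x) => [/H//|/ltW x0].
  by rewrite -(opprK x) cosN sqrrN; apply: H; rewrite oppr_ge0.
rewrite -subr_ge0.
have := @deriv_at_ge0_le R (fun x => x ^+ 2 / 2 - (1 - cos x)) (fun x => x - sin x) 0 x x0.
rewrite cos0 subrr expr0n/= mul0r subrr; apply.
  by move=> y _; derive_tac; field.
by move=> y /andP[y0 _]; rewrite subr_ge0 sin_le_id.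
Qed.

Lemma sin_ge_taylor (R : realType) (x : R) : 0 <= x -> x - x ^+ 3 / 6 <= sin x.
Proof.
move=> x0; rewrite -subr_ge0.
have := @deriv_at_ge0_le R (fun x => sin x - (x - x * x ^+ 2 / 6)) (fun x => x ^+ 2 / 2 - (1 - cos x)) 0 x x0.
rewrite sin0 !mul0r !subrr -exprS; apply.
  by move=> y _; derive_tac; field.
by move=> y _; rewrite subr_ge0 one_sub_cos_le.
Qed.

Lemma normr_sin_sub_id (R : realType) (x : R) : `|sin x - x| <= `|x| ^+ 3.
Proof.
wlog x0 : x / 0 <= x.
  move=> H; case: (lerP 0 x) => [/H//|/ltW x0].
  by have := H (- x); rewrite sinN -opprB !normrN opprK addrC oppr_ge0; apply.
rewrite ler0_norm ?subr_le0 ?sin_le_id// (ger0_norm x0) opprB.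
have := sin_ge_taylor x0.
have : 0 <= x ^+ 3 by rewrite exprn_ge0.
lra.
Qed.

Lemma normr_cos_taylor (R : realType) (x : R) : `|cos x - (1 - x ^+ 2 / 2)| <= x ^+ 4.
Proof.
wlog x0 : x / 0 <= x.
  move=> H; case: (lerP 0 x) => [/H//|/ltW x0].
  have := H (- x); rewrite cosN sqrrN oppr_ge0 => /(_ x0).
  by rewrite exprNn -signr_odd/= expr0 mul1r.
have h : 0 <= (1 - x ^+ 2 / 2 + x ^+ 2 * x ^+ 2 / 24) - cos x.
  have := @deriv_at_ge0_le R (fun x => (1 - x ^+ 2 / 2 + x ^+ 2 * x ^+ 2 / 24) - cos x)
    (fun x => sin x - (x - x ^+ 3 / 6)) 0 x x0.
  rewrite cos0 expr0n/= !mul0r subr0 addr0 subrr; apply.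
    by move=> y _; derive_tac; field.
  by move=> y /andP[y0 _]; rewrite subr_ge0 sin_ge_taylor.
have := one_sub_cos_le x.
have : 0 <= x ^+ 4 by rewrite exprn_ge0.
move: h; have -> : x ^+ 4 = x ^+ 2 * x ^+ 2 by rewrite -exprD.
by move=> *; rewrite ger0_norm; lra.
Qed.

Lemma cos_lipschitz (R : realType) (x y : R) : `|cos x - cos y| <= `|x - y|.
Proof.
wlog xy : x y / y <= x.
  move=> H; case/orP: (le_total y x) => xy; first exact: H.
  by have := H y x xy; rewrite (distrC (cos y)) (distrC y).
have [c _ ->] := @deriv_at_mvt R (@cos R) (fun x => - sin x) y x xy (fun y _ => is_derive_cos y).
by rewrite normrM; apply: ler_piMl => //; rewrite normrN sin_max.
Qed.

Lemma expRN_taylor (R : realType) (x : R) : 0 <= x -> `|expR (- x) - (1 - x)| <= x ^+ 2.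
Proof.
move=> x0.
have h : expR (- x) <= 1 - x + x ^+ 2.
  rewrite -subr_ge0.
  have := @deriv_at_ge0_le R (fun x => (1 - x + x ^+ 2) - expR (- x)) (fun x => x + (expR (- x) - (1 - x))) 0 x x0.
  rewrite oppr0 expR0 expr0n/= !addr0 subrr; apply.
    by move=> y _; derive_tac; ring.
  move=> y /andP[y0 _]; have := expR_ge1Dx (- y); lra.
have := expR_ge1Dx (- x).
by move=> *; rewrite ger0_norm; lra.
Qed.

(** * The Fejer kernel *)

Lemma cvg_expRNM (R : realType) (c : R) : 0 < c -> expR (- (c * y)) @[y --> +oo] --> (0 : R).
Proof.
move=> c0.
have := cvg_comp _ _ (gt0_cvgMry c0 (@cvg_id _ (+oo : set_system R)) ) (@cvgr_expR R).
exact.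
Qed.

Lemma cvg_idM_expRNM (R : realType) (c : R) : 0 < c -> y * expR (- (c * y)) @[y --> +oo] --> (0 : R).
Proof.
move=> c0.
have c20 : 0 < c / 2 by rewrite divr_gt0.
apply: (@squeeze_cvgr _ _ _ _ (fun=> 0) (fun y => 2 / c * expR (- (c / 2 * y)))).
- near=> y; have y0 : 0 <= y by [].
  rewrite mulr_ge0 ?expR_ge0//=.
  have -> : expR (- (c * y)) = expR (- (c / 2 * y)) * expR (- (c / 2 * y)).
    by rewrite -expRD; congr expR; field.
  rewrite mulrA ler_wpM2r ?expR_ge0//.
  have := expR_ge1Dx (c / 2 * y).
  rewrite expRN ler_pdivrMr ?expR_gt0// => h.
  have : c / 2 * y <= expR (c / 2 * y) by lra.
  by rewrite -[X in X <= _ -> _]mulrC -ler_pdivlMr// invf_div mulrC.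
- exact: cvg_cst.
- rewrite -[X in _ --> X](mulr0 (2 / c)); apply: cvgM; first exact: cvg_cst.
  exact: cvg_expRNM.
Unshelve. all: by end_near. Qed.

(** Half the Fourier transform of the triangle (1 - |t|/T)_+, that is (T/2) (sin(Tx/2) / (Tx/2))^2.
    It is kept as an integral because the exchange with a finite sum in [iid_mean_fejer] starts from
    that form. Its total mass is pi for every [T], whence the factors [lam * pi] below. *)
Definition fejer (R : realType) (T x : R) : R :=
  \int[@lebesgue_measure R]_(t in `[0, T]) ((1 - t / T) * cos (t * x)).

Section fejer_kernel.
Variable R : realType.
Implicit Types (T x y : R).

Lemma continuous_fejer_integrand T x : continuous (fun t : R => (1 - t / T) * cos (t * x)).
Proof.
move=> t; apply: deriv_at_continuous; derive_tac; reflexivity.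
Qed.

Lemma fejerN T x : fejer T (- x) = fejer T x.
Proof. by apply: eq_Rintegral => t _; rewrite mulrN cosN. Qed.

Lemma fejer0 T : 0 < T -> fejer T 0 = T / 2.
Proof.
move=> T0; rewrite /fejer (@Rintegral_derive _ _ (fun t => t - t ^+ 2 / (2 * T))).
- by rewrite expr0n/= mul0r !subr0; field; rewrite gt_eqF.
- exact: ltW.
- exact: continuous_fejer_integrand.
- by move=> t; derive_tac; rewrite [in RHS]mulr0 cos0; field; rewrite gt_eqF.
Qed.

Lemma fejerE T x : 0 < T -> x != 0 -> fejer T x = (1 - cos (T * x)) / (T * x ^+ 2).
Proof.
move=> T0 x0; have T0' := lt0r_neq0 T0.
rewrite /fejer (@Rintegral_derive _ _ (fun t => (1 - t / T) * sin (t * x) / x - cos (t * x) / (T * x ^+ 2))).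
- by rewrite !mul0r sin0 cos0; field; rewrite ?x0 ?T0'.
- exact: ltW.
- exact: continuous_fejer_integrand.
- by move=> t; derive_tac; field; rewrite ?x0 ?T0'.
Qed.

Lemma fejerM T x : 0 < T -> x ^+ 2 * fejer T x = (1 - cos (T * x)) / T.
Proof.
move=> T0; have [->|x0] := eqVneq x 0.
  by rewrite expr0n/= mul0r mulr0 cos0 subrr mul0r.
by rewrite fejerE//; field; rewrite ?x0 ?gt_eqF.
Qed.

Lemma fejer_ge0 T x : 0 < T -> 0 <= fejer T x.
Proof.
move=> T0; have [->|x0] := eqVneq x 0; first by rewrite fejer0// divr_ge0 ?ltW.
by rewrite fejerE//; apply: divr_ge0; [rewrite subr_ge0 cos_le1|rewrite mulr_ge0 ?sqr_ge0 ?ltW].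
Qed.

Lemma fejer_scale T x : 0 < T -> fejer T x = T * fejer 1 (T * x).
Proof.
move=> T0; have T0' := lt0r_neq0 T0.
have [->|x0] := eqVneq x 0; first by rewrite mulr0 !fejer0// mulrA mulr1.
rewrite !fejerE ?mulf_neq0// mul1r; field.
by rewrite x0.
Qed.

(** Read off the integral form, so that the removable singularity of the closed formula at 0 does
    not appear. *)
Lemma fejer_lipschitz T x y : 0 < T -> `|fejer T x - fejer T y| <= T ^+ 2 * `|x - y|.
Proof.
move=> T0; rewrite /fejer -RintegralB//; try by apply: continuous_integrable; exact: continuous_fejer_integrand.
apply: (le_trans (@ler_norm_Rintegral _ _ (fun=> T * `|x - y|) _ _ _ _ _)).
- move=> t; apply: cvgB; exact: continuous_fejer_integrand.
- by move=> t; exact: cvg_cst.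
- move=> t /andP[t0 tT]; rewrite -mulrBr normrM.
  have h1 : `|1 - t / T| <= 1.
    have : 0 <= t / T <= 1 by rewrite divr_ge0 ?(ltW T0)//= ler_pdivrMr// mul1r.
    by rewrite ler_norml; lra.
  apply: (le_trans (ler_wpM2r (normr_ge0 _) h1)); rewrite mul1r.
  apply: (le_trans (cos_lipschitz _ _)).
  by rewrite -mulrBr normrM ler_wpM2r// ger0_norm.
- rewrite Rintegral_cst//= lebesgue_measure_itv/= lte_fin T0 /= oppr0 addr0.
  by rewrite expr2 mulrAC.
Qed.

Lemma fejer_continuous T : 0 < T -> continuous (fejer T).
Proof.
move=> T0 x; apply/cvgrPdist_le => e e0.
near=> y; apply: (le_trans (fejer_lipschitz _ _ T0)).
rewrite -ler_pdivlMl ?exprn_gt0//; near: y.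
by apply: cvgr_dist_le; [exact: cvg_id|rewrite mulr_gt0 ?invr_gt0 ?exprn_gt0].
Unshelve. all: by end_near. Qed.

End fejer_kernel.

(** * Total mass and antiderivative of the Fejer kernel *)

Section fejer_integral.
Variable R : realType.
Let mu := @lebesgue_measure R.

Let h (z : R * R) : R := (1 - cos z.1) * (z.2 * expR (- (z.1 * z.2))).

Lemma laplace_id (x : R) : 0 < x ->
  (\int[mu]_(y in `]0%R, +oo[) (h (x, y))%:E = (fejer 1 x)%:E)%E.
Proof.
move=> x0; have x0' := lt0r_neq0 x0.
have dF y : deriv_at (fun y => - ((1 - cos x) * (y / x + (x ^+ 2)^-1) * expR (- (x * y)))) y (h (x, y)).
  by rewrite /h/=; derive_tac; field.
have ch : continuous (fun y => h (x, y)).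
  by move=> y; apply: deriv_at_continuous; rewrite /h /=; derive_tac; reflexivity.
rewrite integral_itv_obnd_cbnd; last first.
  apply/measurable_EFinP; apply: measurable_funTS.
  exact: measurable_realfun.continuous_measurable_fun.
rewrite (@ge0_continuous_FTC2y _ _ (fun y => - ((1 - cos x) * (y / x + (x ^+ 2)^-1) * expR (- (x * y)))) _ 0).
- rewrite -EFinB; congr EFin.
  by rewrite mul0r !add0r mulr0 oppr0 expR0 mulr1 opprK fejerE// !mul1r.
- by move=> y y0; rewrite /h/= !mulr_ge0 ?expR_ge0// subr_ge0 cos_le1.
- exact: continuous_subspaceT.
- have -> : (fun y => - ((1 - cos x) * (y / x + (x ^+ 2)^-1) * expR (- (x * y)))) =
    (fun y => (- (1 - cos x) / x) * (y * expR (- (x * y))) + (- (1 - cos x) / x ^+ 2) * expR (- (x * y))).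
    by apply/funext => y; field.
  rewrite -[X in _ --> X](_ : (- (1 - cos x) / x) * 0 + (- (1 - cos x) / x ^+ 2) * 0 = 0); last by rewrite !mulr0 addr0.
  by apply: cvgD; apply: cvgM; first [exact: cvg_cst|exact: cvg_idM_expRNM|exact: cvg_expRNM].
- by move=> y _; exact: deriv_at_derivable (dF y).
- by apply: cvg_at_right_filter; exact: deriv_at_continuous (dF 0).
- by move=> y _; exact: deriv_at_val (dF y).
Qed.

(** The integrals of y e^{-xy} and y e^{-xy} cos x over x > 0 are 1 and y^2 / (1 + y^2). *)
Lemma laplace_one_sub_cos (y : R) : 0 < y ->
  (\int[mu]_(x in `]0%R, +oo[) (h (x, y))%:E = ((1 + y ^+ 2)^-1)%:E)%E.
Proof.
move=> y0; have y2 : 1 + y ^+ 2 != 0 by rewrite gt_eqF// ltr_wpDr// sqr_ge0.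
pose F x := - (expR (- (y * x)) * (1 + (y * sin x - y ^+ 2 * cos x) / (1 + y ^+ 2))).
have dF x : deriv_at F x (h (x, y)).
  by rewrite /h/F/= [x * y]mulrC; derive_tac; field.
have ch : continuous (fun x => h (x, y)).
  by move=> x; apply: deriv_at_continuous; rewrite /h /=; derive_tac; reflexivity.
rewrite integral_itv_obnd_cbnd; last first.
  apply/measurable_EFinP; apply: measurable_funTS.
  exact: measurable_realfun.continuous_measurable_fun.
rewrite (@ge0_continuous_FTC2y _ _ F _ 0).
- rewrite -EFinB; congr EFin; rewrite /F sin0 cos0 mulr0 oppr0 expR0.
  by field.
- by move=> x x0; rewrite /h/= !mulr_ge0 ?expR_ge0 ?(ltW y0)// subr_ge0 cos_le1.
- exact: continuous_subspaceT.
- have bound x : `|1 + (y * sin x - y ^+ 2 * cos x) / (1 + y ^+ 2)| <= 1 + (y + y ^+ 2) / (1 + y ^+ 2).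
    apply: (le_trans (ler_normD _ _)); rewrite normr1 lerD2l normrM normfV.
    rewrite (@ger0_norm _ (1 + y ^+ 2)) ?addr_ge0 ?sqr_ge0//.
    rewrite ler_wpM2r ?invr_ge0 ?addr_ge0 ?sqr_ge0//.
    apply: (le_trans (ler_normB _ _)); rewrite (normrM y) (normrM (y ^+ 2)).
    rewrite (ger0_norm (ltW y0)) (@ger0_norm _ (y ^+ 2)) ?sqr_ge0//.
    by apply: lerD; apply: ler_piMr; rewrite ?sqr_ge0 ?(ltW y0) ?sin_max ?cos_max.
  set C := 1 + (y + _) / _ in bound.
  apply: norm_cvg0; apply: (@squeeze_cvgr _ _ _ _ (fun=> 0) (fun x => expR (- (y * x)) * C)).
  + near=> x; rewrite normr_ge0/= /F normrN normrM ger0_norm ?expR_ge0//.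
    by rewrite ler_wpM2l ?expR_ge0//.
  + exact: cvg_cst.
  + rewrite -[X in _ --> X](mul0r C); apply: cvgM; last exact: cvg_cst.
    exact: cvg_expRNM.
- by move=> x _; exact: deriv_at_derivable (dF x).
- by apply: cvg_at_right_filter; exact: deriv_at_continuous (dF 0).
- by move=> x _; exact: deriv_at_val (dF x).
Unshelve. all: by end_near. Qed.

Lemma integral_inv1Dsqr :
  (\int[mu]_(y in `]0%R, +oo[) ((1 + y ^+ 2)^-1)%:E = (pi / 2)%:E :> \bar R)%E.
Proof.
have cf : continuous (fun y : R => (1 + y ^+ 2)^-1).
  move=> y; apply: deriv_at_continuous; derive_tac; last reflexivity.
  by rewrite gt_eqF// ltr_wpDr// sqr_ge0.
rewrite integral_itv_obnd_cbnd; last first.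
  apply/measurable_EFinP; apply: measurable_funTS.
  exact: measurable_realfun.continuous_measurable_fun.
rewrite (@ge0_continuous_FTC2y _ _ (@atan R) _ (pi / 2)).
- by rewrite -EFinB atan0 subr0.
- by move=> y _; rewrite invr_ge0 addr_ge0 ?sqr_ge0.
- exact: continuous_subspaceT.
- exact: cvgy_atan.
- by move=> y _; exact: derivable_atan.
- by apply: cvg_at_right_filter; exact: continuous_atan.
- by move=> y _; rewrite derive1_atan.
Qed.

(* For [x > 0] one has 1 / x^2 = \int_0^oo y e^{-xy} dy; now exchange the two
   integrations. *)
Lemma integral_fejer1 :
  (\int[mu]_(x in `[0%R, +oo[) (fejer 1 x)%:E = (pi / 2)%:E)%E.
Proof.
have m1 : measurable_fun [set: R] (@cos R).
  by apply: measurable_realfun.continuous_measurable_fun; exact: continuous_cos.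
have mh : measurable_fun [set: R * R] h.
  rewrite /h; apply: measurable_funM.
    by apply: measurable_funB => //; apply: (measurableT_comp m1).
  apply: measurable_funM => //; apply: measurableT_comp => //.
  by apply: measurableT_comp => //; apply: measurable_funM.
pose A : set R := `]0%R, +oo[%classic.
(* Extended by 0 off the open quadrant, where [h] can be negative, so that Tonelli applies on the
   whole plane. *)
pose f : R * R -> \bar R := (EFin \o h) \_ (A `*` A).
have mf : measurable_fun [set: R * R] f.
  apply/(measurable_restrictT _ _).1; first by apply: measurableX; exact: measurable_itv.
  by apply: measurable_funTS; apply/measurable_EFinP.
have f0 z : (0 <= f z)%E.
  rewrite /f patchE; case: ifPn => //; rewrite inE => -[/= A1 A2].
  rewrite lee_fin /h; apply: mulr_ge0; first by rewrite subr_ge0 cos_le1.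
  apply: mulr_ge0; last exact: expR_ge0.
  by move: A2; rewrite /A/= in_itv/= andbT => /ltW.
have := fubini_tonelli (m1 := mu) (m2 := mu) f mf f0.
have E1 x : (\int[mu]_y f (x, y) = ((fun x => (fejer 1 x)%:E) \_ A) x)%E.
  rewrite patchE; case: ifPn => xA.
    rewrite -laplace_id; last by move: xA; rewrite inE/A/= in_itv/= andbT.
    rewrite [RHS]integral_mkcond; apply: eq_integral => y _.
    rewrite /f !patchE; case: ifPn => [/set_mem H|H].
      by case: H => /= _ H2; rewrite (mem_set H2).
    case: ifPn => // yA; move: H; rewrite mem_set//; split => /=; exact: set_mem.
  apply: integral0_eq => y _; rewrite /f patchE; case: ifPn => //.
  by rewrite inE => -[/= /mem_set H]; rewrite H in xA.
have E2 y : (\int[mu]_x f (x, y) = ((fun y => ((1 + y ^+ 2)^-1)%:E) \_ A) y)%E.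
  rewrite patchE; case: ifPn => xA.
    rewrite -laplace_one_sub_cos; last by move: xA; rewrite inE/A/= in_itv/= andbT.
    rewrite [RHS]integral_mkcond; apply: eq_integral => x _.
    rewrite /f !patchE; case: ifPn => [/set_mem H|H].
      by case: H => /= H1 _; rewrite (mem_set H1).
    case: ifPn => // yA; move: H; rewrite mem_set//; split => /=; exact: set_mem.
  apply: integral0_eq => x _; rewrite /f patchE; case: ifPn => //.
  by rewrite inE => -[/= _ /mem_set H]; rewrite H in xA.
under eq_integral do rewrite E1.
under [RHS]eq_integral do rewrite E2.
rewrite -!integral_mkcond integral_inv1Dsqr => <-.
rewrite integral_itv_obnd_cbnd//.
apply/measurable_EFinP; apply: measurable_funTS.
by apply: measurable_realfun.continuous_measurable_fun; exact: fejer_continuous.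
Qed.

Lemma fejer1_antiderivative : exists F : R -> R,
  [/\ forall x, deriv_at F x (fejer 1 x), forall x, F (- x) = - F x &
      F x @[x --> +oo] --> pi / 2].
Proof.
apply: antiderivative_even; [exact: fejer_continuous|by move=> x; exact: fejer_ge0|by move=> x; exact: fejerN|exact: integral_fejer1].
Qed.

Lemma gauss_antiderivative : exists F : R -> R,
  [/\ forall x, deriv_at F x (gauss_fun x), forall x, F (- x) = - F x &
      F x @[x --> +oo] --> Num.sqrt pi / 2].
Proof.
apply: antiderivative_even; [exact: continuous_gauss_fun|exact: gauss_fun_ge0| |exact: integral0y_gauss].
by move=> x; rewrite /gauss_fun sqrrN.
Qed.

(* The derivative of [F + 2 / x] is [fejer 1 x - 2 / x ^+ 2 <= 0]. *)
Lemma fejer1_antiderivative_tail (F : R -> R) (s : R) :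
  (forall x, deriv_at F x (fejer 1 x)) -> F x @[x --> +oo] --> pi / 2 ->
  0 < s -> pi / 2 - 2 / s <= F s <= pi / 2.
Proof.
move=> dF Fl s0; apply/andP; split; last first.
  suff : \forall x \near +oo, F s <= F x.
    by move=> H; rewrite -(cvg_lim _ Fl)//; apply: limr_ge => //; apply/cvg_ex; exists (pi / 2).
  near=> x; apply: (@deriv_at_ge0_le _ _ (fejer 1)) => //.
  by move=> y _; exact: fejer_ge0.
rewrite lerBlDr.
suff : \forall x \near +oo, F x <= F s + 2 / s.
  by move=> H; rewrite -(cvg_lim _ Fl)//; apply: limr_le => //; apply/cvg_ex; exists (pi / 2).
near=> x.
have sx : s <= x by [].
have x0 : 0 < x by apply: lt_le_trans sx.
apply: (@le_trans _ _ (F x + 2 / x)); first by rewrite lerDl divr_ge0// ltW.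
apply: (@deriv_at_le0_le _ (fun x => F x + 2 / x) (fun x => fejer 1 x - 2 / x ^+ 2)) => //.
  move=> y /andP[sy _]; have y0 : y != 0 by rewrite gt_eqF// (lt_le_trans s0).
  by derive_tac; [exact: dF|field].
move=> y /andP[sy _]; have y0 : y != 0 by rewrite gt_eqF// (lt_le_trans s0).
rewrite subr_le0 fejerE// !mul1r ler_wpM2r ?invr_ge0 ?sqr_ge0//.
by have := cos_geN1 y; lra.
Unshelve. all: by end_near. Qed.

End fejer_integral.

(** Stands for integration against a positive measure. It acts on arbitrary functions, which is
    harmless here: the functionals to come are finite weighted sums of point evaluations. *)
Definition positive_functional (R : realType) (nu : (R -> R) -> R) : Prop :=
  (forall (c : R) g h, nu (fun x => c * g x + h x) = c * nu g + nu h) /\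
  (forall g h, (forall x, g x <= h x) -> nu g <= nu h).

Section positive_functional_theory.
Variables (R : realType) (nu : (R -> R) -> R).
Hypothesis nuP : positive_functional nu.

Lemma positive_functional0 : nu (fun=> 0) = 0.
Proof.
have := nuP.1 (- 1) (fun=> 0) (fun=> 0).
under [in LHS]eq_fun do rewrite mulr0 addr0.
lra.
Qed.

Lemma positive_functionalD g h : nu (fun x => g x + h x) = nu g + nu h.
Proof. by rewrite -[nu g]mul1r -nuP.1; congr nu; apply/funext => x; rewrite mul1r. Qed.

Lemma positive_functionalZ c g : nu (fun x => c * g x) = c * nu g.
Proof.
rewrite -[RHS]addr0 -positive_functional0 -nuP.1; congr nu.
by apply/funext => x; rewrite addr0.
Qed.

Lemma positive_functional_sum (I : Type) (s : seq I) (g : I -> R -> R) :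
  nu (fun x => \sum_(i <- s) g i x) = \sum_(i <- s) nu (g i).
Proof.
elim: s => [|i s IH].
  by under eq_fun do rewrite big_nil; rewrite big_nil positive_functional0.
by under eq_fun do rewrite big_cons; rewrite big_cons positive_functionalD IH.
Qed.

End positive_functional_theory.

Lemma ler_sqr_normr (R : realDomainType) (x y : R) : `|x| <= y -> x ^+ 2 <= y ^+ 2.
Proof.
move=> xy; rewrite -(real_normK (num_real x)) ler_sqr// nnegrE.
exact: le_trans xy.
Qed.

Section fejer_riemann.
Variable R : realType.
Implicit Types (A B x a b : R).

(* A Riemann sum of [fejer n%:R (x - y)] for y in [A, B]: a finite combination of
   translated Fejer kernels, close to [pi] times the indicator of [A, B]. *)
Definition fejer_riemann A B (n : nat) x : R :=
  (B - A) / (n ^ 3)%:R *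
  \sum_(j < n ^ 3) fejer n%:R (x - (A + j%:R * ((B - A) / (n ^ 3)%:R))).

Variable F : R -> R.
Hypothesis dF : forall x, deriv_at F x (fejer 1 x).

(** The mean value theorem on each cell, with the Lipschitz bound for [fejer 1] on the rescaled cell
    of length n eta, gives an error (n eta)^2. There are n^3 cells and eta = (B - A) / n^3; a mesh
    of only n^2 cells would leave a bound that does not tend to 0. *)
Lemma fejer_riemann_approx A B (n : nat) x : A <= B -> (0 < n)%N ->
  `|fejer_riemann A B n x - (F (n%:R * (x - A)) - F (n%:R * (x - B)))| <=
  (B - A) ^+ 2 / n%:R.
Proof.
move=> AB n0; have n0R : 0 < n%:R :> R by rewrite ltr0n.
have J0 : (0 < n ^ 3)%N by rewrite expn_gt0 n0.
have J0R : 0 < (n ^ 3)%:R :> R by rewrite ltr0n.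
set eta := (B - A) / (n ^ 3)%:R.
have eta0 : 0 <= eta by rewrite divr_ge0 ?subr_ge0// ltW.
pose G (j : nat) := F (n%:R * (x - (A + j%:R * eta))).
have -> : F (n%:R * (x - A)) - F (n%:R * (x - B)) = \sum_(j < n ^ 3) (G j - G j.+1).
  rewrite -(big_mkord xpredT (fun j => G j - G j.+1)).
  under eq_bigr do rewrite -opprB.
  rewrite sumrN telescope_sumr ?leq0n// opprB /G mul0r addr0.
  congr (_ - F (_ * (_ - _))).
  by rewrite /eta mulrCA divff ?gt_eqF//; ring.
rewrite /fejer_riemann -/eta mulr_sumr -sumrB.
apply: (le_trans (ler_norm_sum _ _ _)).
have -> : (B - A) ^+ 2 / n%:R = \sum_(j < n ^ 3) (n%:R * eta) ^+ 2.
  rewrite sumr_const card_ord -mulr_natr /eta natrX; field.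
  by rewrite gt_eqF.
apply: ler_sum => j _.
set y := n%:R * (x - (A + j%:R * eta)).
set z := n%:R * (x - (A + j.+1%:R * eta)).
have yz : y - z = n%:R * eta by rewrite /y /z -[j.+1%:R]natr1; ring.
have zy : z <= y by rewrite -subr_ge0 yz mulr_ge0.
have [c /andP[zc cy] E] := @deriv_at_mvt R F (fejer 1) z y zy (fun u _ => dF u).
rewrite /G -/y -/z E yz fejer_scale// -/y.
have -> : eta * (n%:R * fejer 1 y) - fejer 1 c * (n%:R * eta) =
  (n%:R * eta) * (fejer 1 y - fejer 1 c) by ring.
have ne0 : 0 <= n%:R * eta by rewrite mulr_ge0.
rewrite normrM (ger0_norm ne0) expr2 ler_wpM2l//.
apply: (le_trans (fejer_lipschitz _ _ _)) => //.
by rewrite expr1n mul1r ger0_norm ?subr_ge0// -yz lerD2l lerN2.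
Qed.

Lemma fejer_riemann_ge0 A B (n : nat) x : A <= B -> (0 < n)%N -> 0 <= fejer_riemann A B n x.
Proof.
move=> AB n0; rewrite /fejer_riemann mulr_ge0 ?divr_ge0 ?subr_ge0//.
by apply: sumr_ge0 => j _; apply: fejer_ge0; rewrite ltr0n.
Qed.

(** A single kernel vanishes at the nonzero multiples of 2 pi; its translate by pi fills these gaps,
    since (1 - cos x) + (1 + cos x) = 2. Quadratically decaying tails are thereby dominated by two
    kernels whose [nu] is under control. *)
Lemma inv_sqr_le_fejer x : 2 <= (`|x| + pi) ^+ 2 * (fejer 1 x + fejer 1 (x - pi)).
Proof.
have e1 := fejerM x (@ltr01 R); have e2 := fejerM (x - pi) (@ltr01 R).
rewrite !mul1r !divr1 in e1 e2.
have -> : 2 = x ^+ 2 * fejer 1 x + (x - pi) ^+ 2 * fejer 1 (x - pi).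
  rewrite e1 e2 -[x - pi]opprB cosN.
  have := cosDpi (- x); rewrite cosN addrC => ->; ring.
rewrite mulrDr; have pi0 := @pi_ge0 R.
apply: lerD; (apply: ler_wpM2r; first exact: fejer_ge0); apply: ler_sqr_normr.
  by rewrite lerDl.
by have := ler_normB x pi; rewrite (ger0_norm pi0).
Qed.

Lemma fejer_riemann_far A B a b (delta : R) (n : nat) x : A <= B -> (0 < n)%N ->
  0 < delta -> a + delta <= A -> B <= b - delta -> ~~ (a <= x < b) ->
  fejer_riemann A B n x <=
  (B - A) * (1 + (`|A| + `|B| + pi) / delta) ^+ 2 / n%:R *
    (fejer 1 x + fejer 1 (x - pi)).
Proof.
move=> AB n0 d0 aA Bb xab; have n0R : 0 < n%:R :> R by rewrite ltr0n.
have J0R : 0 < (n ^ 3)%:R :> R by rewrite ltr0n expn_gt0 n0.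
set M := 1 + _ / delta; set W := _ + fejer 1 (x - pi).
have W0 : 0 <= W by rewrite addr_ge0 ?fejer_ge0.
set eta := (B - A) / (n ^ 3)%:R.
have eta0 : 0 <= eta by rewrite divr_ge0 ?subr_ge0// ltW.
have key (j : 'I_(n ^ 3)) : fejer n%:R (x - (A + j%:R * eta)) <= M ^+ 2 / n%:R * W.
  set aj := A + _.
  have aj1 : A <= aj by rewrite lerDl mulr_ge0.
  have aj2 : aj <= B.
    rewrite /aj -lerBrDl /eta mulrCA ler_piMr ?subr_ge0// ler_pdivrMr// mul1r ler_nat.
    exact: ltnW.
  have dist : delta <= `|x - aj|.
    move: xab; rewrite negb_and -ltNge -leNgt => /orP[xa|bx].
      by rewrite ler0_norm; lra.
    by rewrite ger0_norm; lra.
  have xaj0 : x - aj != 0 by rewrite -normr_gt0; lra.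
  have y2 : 0 < (x - aj) ^+ 2 by rewrite exprn_even_gt0.
  rewrite fejerE// ler_pdivrMr ?(mulr_gt0 n0R y2)//.
  have -> : M ^+ 2 / n%:R * W * (n%:R * (x - aj) ^+ 2) = M ^+ 2 * (x - aj) ^+ 2 * W.
    by field; rewrite gt_eqF.
  have H : (`|x| + pi) ^+ 2 <= M ^+ 2 * (x - aj) ^+ 2.
    rewrite -[in leRHS](real_normK (num_real (x - aj))) -exprMn.
    have pi0 := @pi_ge0 R.
    apply: ler_sqr_normr; rewrite (ger0_norm (addr_ge0 (normr_ge0 x) pi0)).
    have h1 : `|x| <= `|x - aj| + `|aj|.
      by have := ler_normD (x - aj) aj; rewrite subrK.
    have h2 : `|aj| <= `|A| + `|B|.
      rewrite ler_norml; have := ler_norm B; have := lerNnormlW (lexx `|A|).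
      have := normr_ge0 A; have := normr_ge0 B; lra.
    have h3 : `|A| + `|B| + pi <= (`|A| + `|B| + pi) / delta * `|x - aj|.
      rewrite -mulrA; apply: ler_peMr.
        exact: addr_ge0 (addr_ge0 (normr_ge0 _) (normr_ge0 _)) pi0.
      by rewrite mulrC ler_pdivlMr// mul1r.
    by rewrite /M mulrDl mul1r; lra.
  have := inv_sqr_le_fejer x; rewrite -/W.
  have := ler_wpM2r W0 H; have := cos_geN1 (n%:R * (x - aj)); lra.
rewrite /fejer_riemann -/eta.
apply: (le_trans (ler_wpM2l eta0 (ler_sum _ (fun j _ => key j)))).
rewrite sumr_const card_ord -mulr_natr /eta le_eqVlt; apply/orP; left; apply/eqP.
by field; rewrite !gt_eqF.
Qed.

End fejer_riemann.

(** * A Tauberian criterion for interval masses *)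

Lemma cvgr_sum (R : realType) (T I : Type) (F : set_system T) (r : seq I)
    (f : I -> T -> R) (l : I -> R) : Filter F ->
  (forall i, f i x @[x --> F] --> l i) ->
  \sum_(i <- r) f i x @[x --> F] --> \sum_(i <- r) l i.
Proof.
move=> FF fl; elim: r => [|i r IH].
  by rewrite big_nil; under eq_fun do rewrite big_nil; exact: cvg_cst.
by rewrite big_cons; under eq_fun do rewrite big_cons; exact: cvgD.
Qed.

Lemma near_dist_le (R : realType) (u : nat -> R) (l e : R) :
  u @ \oo --> l -> 0 < e -> \forall n \near \oo, `|l - u n| <= e.
Proof. by move=> ul e0; exact: (cvgrPdist_le _ _).1. Qed.

Section tauberian.
Variables (R : realType) (nu : nat -> (R -> R) -> R) (lam : R).
Hypothesis lam0 : 0 <= lam.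
Hypothesis nuP : forall N, positive_functional (nu N).
Hypothesis nu_fejer : forall T a : R, 0 < T ->
  (fun N => nu N (fun x => fejer T (x - a))) @ \oo --> lam * pi.

Lemma cvg_nu_fejer_riemann (A B : R) (n : nat) : (0 < n)%N ->
  (fun N => nu N (fejer_riemann A B n)) @ \oo --> (B - A) * (lam * pi).
Proof.
move=> n0; have n0R : 0 < n%:R :> R by rewrite ltr0n.
have J0R : (n ^ 3)%:R != 0 :> R by rewrite pnatr_eq0 expn_eq0 andbT -lt0n.
rewrite /fejer_riemann; set eta := (B - A) / _.
under eq_fun do rewrite positive_functionalZ// positive_functional_sum//.
have -> : (B - A) * (lam * pi) = eta * \sum_(j < n ^ 3) (lam * pi).
  rewrite sumr_const card_ord -mulr_natr /eta; move: J0R.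
  by move: (n ^ 3)%:R => J J0; field.
apply: cvgM; first exact: cvg_cst.
by apply: cvgr_sum => j; exact: nu_fejer.
Qed.

Definition indic_itv (a b x : R) : R := (a <= x < b)%R%:R.

Lemma near_natr_ge (M : R) : \forall n \near \oo, M <= n%:R.
Proof. exact: nbhs_infty_ger. Qed.

(** The Riemann sum over the window enlarged by [delta] is nonnegative everywhere and at least pi -
    rho on [a, b), so it majorises (pi - rho) times the indicator. *)
Lemma nu_itv_le (a b delta rho : R) : a <= b -> 0 < delta -> 0 < rho ->
  \forall N \near \oo, (pi - rho) * nu N (indic_itv a b) <=
    (b - a + 2 * delta) * (lam * pi) + rho.
Proof.
move=> ab d0 r0; have [F [dF FN Fl]] := @fejer1_antiderivative R.
pose A := a - delta; pose B := b + delta.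
have AB : A <= B by rewrite /A /B; lra.
near \oo => n.
have n0 : (0 < n)%N by near: n; exact: nbhs_infty_gt.
have n0R : 0 < n%:R :> R by rewrite ltr0n.
(* The loss [rho] is shared out: rho/4 for each of the two tails of [F], rho/2 for the Riemann
   error. *)
have h1 : 4 / delta <= rho / 2 * n%:R.
  by rewrite -ler_pdivrMl ?divr_gt0//; near: n; exact: near_natr_ge.
have h2 : (B - A) ^+ 2 <= rho / 2 * n%:R.
  by rewrite -ler_pdivrMl ?divr_gt0//; near: n; exact: near_natr_ge.
have low x : (pi - rho) * indic_itv a b x <= fejer_riemann A B n x.
  rewrite /indic_itv; case: (boolP (a <= x < b)) => [/andP[ax xb]|_]; last first.
    by rewrite mulr0 fejer_riemann_ge0.
  rewrite mulr1.
  have := fejer_riemann_approx dF x AB n0; rewrite ler_norml => /andP[+ _].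
  have e1 : (B - A) ^+ 2 / n%:R <= rho / 2 by rewrite ler_pdivrMr.
  have bnd s : n%:R * delta <= s -> pi / 2 - rho / 4 <= F s.
    move=> ds; have nd0 : 0 < n%:R * delta by rewrite mulr_gt0.
    have s0 : 0 < s by apply: lt_le_trans ds.
    have /andP[+ _] := fejer1_antiderivative_tail dF Fl s0.
    apply: le_trans; rewrite lerD2l lerN2.
    apply: (@le_trans _ _ (2 / (n%:R * delta))).
      by rewrite ler_wpM2l// lef_pV2// posrE.
    rewrite ler_pdivrMr//.
    have -> : rho / 4 * (n%:R * delta) = (rho / 2 * n%:R) * delta / 2 by field.
    by move: h1; rewrite ler_pdivrMr//; lra.
  have b1 : pi / 2 - rho / 4 <= F (n%:R * (x - A)).
    by apply: bnd; rewrite ler_wpM2l ?(ltW n0R)// /A; lra.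
  have b2 : pi / 2 - rho / 4 <= F (- (n%:R * (x - B))).
    by apply: bnd; rewrite -mulrN ler_wpM2l ?(ltW n0R)// /B; lra.
  rewrite FN in b2; lra.
have lim := @cvg_nu_fejer_riemann A B n n0.
near=> N.
rewrite -positive_functionalZ//.
apply: (le_trans ((nuP N).2 _ _ low)).
have -> : (b - a + 2 * delta) * (lam * pi) = (B - A) * (lam * pi) by rewrite /A/B; ring.
rewrite -lerBlDl; apply: le_trans (ler_norm _) _.
rewrite distrC; near: N.
exact: near_dist_le lim r0.
Unshelve. all: by end_near. Qed.

(** Here the window shrinks. Outside [a, b) the Riemann sum is small but positive; it is at most
    (C/n) W, and convergence of [nu N W] makes this leak negligible for large n. *)
Lemma nu_itv_ge (a b delta rho : R) : 0 < delta -> a + delta <= b - delta ->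
  0 < rho ->
  \forall N \near \oo, (b - a - 2 * delta) * (lam * pi) - rho <=
    (pi + rho) * nu N (indic_itv a b).
Proof.
move=> d0 ab r0; have [F [dF FN Fl]] := @fejer1_antiderivative R.
pose A := a + delta; pose B := b - delta.
have AB : A <= B by rewrite /A /B; lra.
pose C := (B - A) * (1 + (`|A| + `|B| + pi) / delta) ^+ 2.
have C0 : 0 <= C by rewrite /C mulr_ge0 ?sqr_ge0 ?subr_ge0.
pose W (x : R) := fejer 1 x + fejer 1 (x - pi).
have W0 x : 0 <= W x by rewrite addr_ge0 ?fejer_ge0.
have limW : (fun N => nu N W) @ \oo --> lam * pi + lam * pi.
  rewrite /W; under eq_fun do rewrite positive_functionalD//.
  apply: cvgD; last exact: nu_fejer.
  by have := nu_fejer 0 ltr01; under eq_fun do under eq_fun do rewrite subr0.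
(* [n] is fixed before [N]: the Riemann sum is then a fixed finite combination of kernels, to which
   [nu_fejer] applies. *)
near \oo => n.
have n0 : (0 < n)%N by near: n; exact: nbhs_infty_gt.
have n0R : 0 < n%:R :> R by rewrite ltr0n.
have h2 : (B - A) ^+ 2 <= rho * n%:R.
  by rewrite -ler_pdivrMl//; near: n; exact: near_natr_ge.
have h3 : C * (2 * (lam * pi) + 1) <= rho / 2 * n%:R.
  by rewrite -ler_pdivrMl ?divr_gt0//; near: n; exact: near_natr_ge.
have Fpi x : F x <= pi / 2.
  suff : \forall y \near +oo, F x <= F y.
    by move=> H; rewrite -(cvg_lim _ Fl)//; apply: limr_ge => //; apply/cvg_ex; exists (pi / 2).
  near=> y; apply: (@deriv_at_ge0_le _ _ (fejer 1)) => //.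
  by move=> z _; exact: fejer_ge0.
have up x : fejer_riemann A B n x <= (pi + rho) * indic_itv a b x + (C / n%:R) * W x.
  rewrite /indic_itv; case: (boolP (a <= x < b)) => [xab|xab]; last first.
    by rewrite mulr0 add0r; apply: (@fejer_riemann_far _ A B a b delta) => //; rewrite /A/B; lra.
  rewrite mulr1.
  have := fejer_riemann_approx dF x AB n0; rewrite ler_norml => /andP[_].
  have e1 : (B - A) ^+ 2 / n%:R <= rho by rewrite ler_pdivrMr.
  have := Fpi (n%:R * (x - A)); have := Fpi (- (n%:R * (x - B))); rewrite FN.
  have : 0 <= C / n%:R * W x by rewrite mulr_ge0// divr_ge0.
  lra.
have lim := @cvg_nu_fejer_riemann A B n n0.
near=> N.
have l1 : (B - A) * (lam * pi) - rho / 2 <= nu N (fejer_riemann A B n).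
  rewrite lerBlDr -lerBlDl; apply: le_trans (ler_norm _) _.
  by near: N; apply: near_dist_le lim _; rewrite divr_gt0.
have l2 : nu N W <= 2 * (lam * pi) + 1.
  rewrite -lerBlDl; apply: le_trans (ler_norm _) _.
  rewrite (_ : 2 * (lam * pi) = lam * pi + lam * pi); last by ring.
  by rewrite distrC; near: N; apply: near_dist_le limW _.
have l3 : C / n%:R * nu N W <= rho / 2.
  apply: (@le_trans _ _ (C / n%:R * (2 * (lam * pi) + 1))).
    by rewrite ler_wpM2l// divr_ge0.
  by rewrite mulrAC ler_pdivrMr.
have := (nuP N).2 _ _ up.
rewrite (nuP N).1 positive_functionalZ//.
have -> : (b - a - 2 * delta) * (lam * pi) = (B - A) * (lam * pi) by rewrite /A/B; ring.
lra.
Unshelve. all: by end_near. Qed.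

Lemma cvg_nu_itv (a b : R) : a < b ->
  (fun N => nu N (indic_itv a b)) @ \oo --> lam * (b - a).
Proof.
move=> ab; apply/cvgrPdist_le => e e0.
have p0 := @pi_gt0 R; have p2 := @pi_ge2 R.
(* [K] collects the coefficients of [d] when the two bounds are compared with lam (b - a) up to [e]:
   the argument closes once d K <= pi e. *)
pose K := 2 * (lam * pi) + 1 + lam * (b - a) + e.
have lb0 : 0 <= lam * (b - a) by rewrite mulr_ge0// subr_ge0 ltW.
have lp0 : 0 <= lam * pi by rewrite mulr_ge0// (ltW p0).
have K0 : 0 < K by rewrite /K; lra.
pose d := Num.min (Num.min 1 ((b - a) / 2)) (e / K).
have d0 : 0 < d by rewrite /d !lt_min ltr01 (divr_gt0 e0 K0) divr_gt0// subr_gt0.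
have [d1 d2 d3] : [/\ d <= 1, d <= (b - a) / 2 & d <= e / K].
  by split; rewrite /d !ge_min lexx ?orbT.
have dK : d * K <= pi * e.
  have : d * K <= e by rewrite -ler_pdivlMr.
  by move=> h; apply: (le_trans h); rewrite ler_peMl ?ltW//; lra.
near=> N.
have up : (pi - d) * nu N (indic_itv a b) <= (b - a + 2 * d) * (lam * pi) + d.
  by near: N; apply: nu_itv_le => //; exact: ltW.
have lo : (b - a - 2 * d) * (lam * pi) - d <= (pi + d) * nu N (indic_itv a b).
  by near: N; apply: nu_itv_ge => //; lra.
have dK2 : d * (2 * (lam * pi) + 1 + lam * (b - a) + e) <= pi * e by exact: dK.
have de : 0 <= d * e by rewrite mulr_ge0 ?ltW.
rewrite distrC ler_norml; move: up lo; move: (nu N _) => v up lo.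
apply/andP; split; rewrite -subr_ge0.
  suff : 0 <= (pi + d) * (v - lam * (b - a) - - e) by rewrite pmulr_rge0//; lra.
  nra.
suff : 0 <= (pi - d) * (e - (v - lam * (b - a))) by rewrite pmulr_rge0//; lra.
nra.
Unshelve. all: by end_near. Qed.

End tauberian.

Lemma indic_itv_cat (R : realType) (a b c x : R) : a <= b -> b <= c ->
  indic_itv a c x = indic_itv a b x + indic_itv b c x.
Proof.
move=> ab bc; rewrite /indic_itv.
have [ax|xa] := leP a x; have [xb|bx] := ltP x b => /=.
- by rewrite (lt_le_trans xb bc) addr0.
- by rewrite add0r.
- by rewrite addr0.
- by have := lt_le_trans xa (le_trans ab bx); rewrite ltxx.
Qed.

Lemma indic_itv_split (R : realType) (eta x : R) (M : nat) : 0 <= eta ->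
  indic_itv 0 (M%:R * eta) x =
  \sum_(j < M) indic_itv (j%:R * eta) (j.+1%:R * eta) x.
Proof.
move=> eta0; elim: M => [|M IH].
  by rewrite big_ord0 mul0r /indic_itv; case: (leP 0 x) => //= x0; rewrite ltNge x0.
rewrite big_ord_recr /= -IH -indic_itv_cat//; first by rewrite mulr_ge0.
by rewrite ler_wpM2r// ler_nat.
Qed.

Lemma Rintegral_expRM (R : realType) (beta Delta : R) : 0 < beta -> 0 <= Delta ->
  \int[@lebesgue_measure R]_(t in `[0, Delta]) expR (beta * t) =
  (expR (beta * Delta) - 1) / beta.
Proof.
move=> b0 D0; have b0' := lt0r_neq0 b0.
have dF t : deriv_at (fun t => expR (beta * t) / beta) t (expR (beta * t)).
  by derive_tac; field.
rewrite (Rintegral_derive D0 _ dF); first by rewrite mulr0 expR0; field.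
move=> t; apply: (@deriv_at_continuous _ _ _ (expR (beta * t) * beta)).
by derive_tac; ring.
Qed.

Lemma expR_sub1_le (R : realType) (x : R) : expR x - 1 <= x * expR x.
Proof.
have := ler_wpM2r (expR_ge0 x) (expR_ge1Dx (- x)).
by rewrite -expRD addNr expR0; lra.
Qed.

Section tauberian_exponential.
Variables (R : realType) (nu : nat -> (R -> R) -> R) (lam : R).
Hypothesis lam0 : 0 <= lam.
Hypothesis nuP : forall N, positive_functional (nu N).
Hypothesis nu_itv : forall a b : R, a < b ->
  (fun N => nu N (indic_itv a b)) @ \oo --> lam * (b - a).

(** On cells of length [eta] the exponential varies by a factor at most e^{beta_N eta}, so the lower
    sum [S N] and e^{beta_N eta} S N enclose the value. Their limits [LM] and q LM, with [LM] a
    geometric sum, also enclose lam I. *)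
Lemma cvg_nu_expR (beta_ : nat -> R) (beta Delta : R) : 0 < beta -> 0 < Delta ->
  beta_ @ \oo --> beta ->
  (fun N => nu N (fun x => expR (beta_ N * x) * indic_itv 0 Delta x)) @ \oo -->
  lam * ((expR (beta * Delta) - 1) / beta).
Proof.
move=> b0 D0 bl.
set I := (_ - 1) / beta.
have E1 : 1 <= expR (beta * Delta) by rewrite -[leLHS]expR0 ler_expR mulr_ge0 ?ltW.
have I0 : 0 <= I by rewrite /I; apply: divr_ge0; [rewrite subr_ge0|exact: ltW].
apply/cvgrPdist_le => e e0.
near \oo => M.
have M0 : (0 < M)%N by near: M; exact: nbhs_infty_gt.
have M0R : 0 < M%:R :> R by rewrite ltr0n.
(* Ensures (q - 1) lam I <= e/2, by q - 1 <= beta eta q and q <= e^{beta Delta}. *)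
have Mbig : beta * Delta * expR (beta * Delta) * (lam * I) <= e / 2 * M%:R.
  by rewrite -ler_pdivrMl ?divr_gt0//; near: M; exact: near_natr_ge.
pose eta := Delta / M%:R.
have eta0 : 0 < eta by rewrite divr_gt0.
have Meta : M%:R * eta = Delta by rewrite /eta; field; rewrite gt_eqF.
pose q := expR (beta * eta).
have q1 : 0 < q - 1 by rewrite subr_gt0 expR_gt1 mulr_gt0.
pose S N := \sum_(j < M) expR (beta_ N * (j%:R * eta)) *
  nu N (indic_itv (j%:R * eta) (j.+1%:R * eta)).
pose LM := lam * eta * ((expR (beta * Delta) - 1) / (q - 1)).
have SL : S @ \oo --> LM.
  have -> : LM = \sum_(j < M) expR (beta * (j%:R * eta)) * (lam * (j.+1%:R * eta - j%:R * eta)).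
    rewrite /LM.
    have -> : expR (beta * Delta) = q ^+ M by rewrite /q -expRM_natl -Meta; congr expR; ring.
    rewrite subrX1 [_ / (q - 1)]mulrAC divff ?gt_eqF// mul1r mulr_sumr.
    apply: eq_bigr => j _.
    have -> : expR (beta * (j%:R * eta)) = q ^+ j.
      by rewrite /q -expRM_natl; congr expR; ring.
    by rewrite -[j.+1%:R]natr1; ring.
  apply: cvgr_sum => j; apply: cvgM.
    apply: (@continuous_cvg _ _ _ _ _ _ expR); first exact: continuous_expR.
    by apply: cvgM => //; exact: cvg_cst.
  by apply: nu_itv; rewrite ltr_pM2r// ltr_nat.
have qS : (fun N => expR (beta_ N * eta) * S N) @ \oo --> q * LM.
  apply: cvgM => //; apply: (@continuous_cvg _ _ _ _ _ _ expR); first exact: continuous_expR.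
  by apply: cvgM => //; exact: cvg_cst.
have lX0 : 0 <= lam * (expR (beta * Delta) - 1) by rewrite mulr_ge0// subr_ge0.
have IE : lam * I = lam * (expR (beta * Delta) - 1) * beta^-1 by rewrite /I mulrA.
have LMle : LM <= lam * I.
  have -> : LM = lam * (expR (beta * Delta) - 1) * (eta / (q - 1)) by rewrite /LM; ring.
  rewrite IE ler_wpM2l// ler_pdivrMr// ler_pdivlMl//.
  by rewrite lerBrDl expR_ge1Dx.
have qLMge : lam * I <= q * LM.
  have -> : q * LM = lam * (expR (beta * Delta) - 1) * (q * eta / (q - 1)) by rewrite /LM; ring.
  rewrite IE ler_wpM2l// ler_pdivlMr// ler_pdivrMl//.
  by rewrite [q * eta]mulrC mulrA; exact: expR_sub1_le.
have close : (q - 1) * (lam * I) <= e / 2.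
  apply: (le_trans (ler_wpM2r _ (expR_sub1_le (beta * eta)))); first by rewrite mulr_ge0.
  rewrite -(@ler_pM2r _ M%:R)//; apply: le_trans Mbig.
  have -> : beta * eta * expR (beta * eta) * (lam * I) * M%:R =
     beta * (M%:R * eta) * expR (beta * eta) * (lam * I) by ring.
  rewrite Meta; apply: ler_wpM2r; first by rewrite mulr_ge0.
  apply: ler_wpM2l; first by rewrite mulr_ge0 ?ltW.
  rewrite ler_expR ler_wpM2l ?(ltW b0)// -Meta ler_peMl ?(ltW eta0)//.
  by rewrite ler1n.
have LM0 : 0 <= LM by rewrite /LM; apply: mulr_ge0; [rewrite mulr_ge0// ltW|apply: divr_ge0; [rewrite subr_ge0|exact: ltW]].
have close2 : q * LM - LM <= e / 2.
  apply: le_trans close; rewrite (_ : q * LM - LM = (q - 1) * LM); last by ring.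
  by apply: ler_wpM2l => //; exact: ltW.
have e20 : 0 < e / 2 by rewrite divr_gt0.
near=> N.
have bN0 : 0 < beta_ N.
  by near: N; apply: (cvgr_gt beta).
have split_ x : expR (beta_ N * x) * indic_itv 0 Delta x =
    \sum_(j < M) expR (beta_ N * x) * indic_itv (j%:R * eta) (j.+1%:R * eta) x.
  by rewrite -Meta indic_itv_split ?(ltW eta0)// mulr_sumr.
have lo : S N <= nu N (fun x => expR (beta_ N * x) * indic_itv 0 Delta x).
  rewrite /S; under eq_bigr do rewrite -positive_functionalZ//.
  rewrite -positive_functional_sum//; apply: (nuP N).2 => x.
  rewrite split_; apply: ler_sum => j _.
  rewrite /indic_itv; case: (boolP (_ <= x < _)) => [/andP[jx xj]|_]; last by rewrite !mulr0.
  by rewrite !mulr1 ler_expR ler_wpM2l// ltW.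
have hi : nu N (fun x => expR (beta_ N * x) * indic_itv 0 Delta x) <= expR (beta_ N * eta) * S N.
  rewrite /S mulr_sumr; under eq_bigr do rewrite mulrA -positive_functionalZ//.
  rewrite -positive_functional_sum//; apply: (nuP N).2 => x.
  rewrite split_; apply: ler_sum => j _.
  rewrite /indic_itv; case: (boolP (_ <= x < _)) => [/andP[jx xj]|_]; last by rewrite !mulr0.
  rewrite !mulr1 -expRD ler_expR -mulrDr ler_wpM2l// ?(ltW bN0)//.
  by move: xj; rewrite -natr1 => /ltW; lra.
have : `|LM - S N| <= e / 2 by near: N; exact: near_dist_le SL e20.
have : `|q * LM - expR (beta_ N * eta) * S N| <= e / 2 by near: N; exact: near_dist_le qS e20.
move: lo hi close2 qLMge LMle; rewrite !ler_norml.
move: (expR (beta_ N * eta) * S N) (S N) (nu N _) (q * LM) => X Y Z QL *.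
by apply/andP; split; lra.
Unshelve. all: by end_near. Qed.

End tauberian_exponential.

(** * Characteristic functions *)

Section cis.
Variable R : realType.
Implicit Types (x y : R) (z w : R[i]).

Definition cis x : R[i] := Complex (cos x) (sin x).

Lemma cisD x y : cis (x + y) = cis x * cis y.
Proof. by rewrite /cis cosD sinD; congr Complex; rewrite addrC mulrC [X in _ + X]mulrC. Qed.

Lemma cis0 : cis 0 = 1.
Proof. by rewrite /cis cos0 sin0. Qed.

Lemma cis_sum (I : Type) (s : seq I) (f : I -> R) :
  cis (\sum_(i <- s) f i) = \prod_(i <- s) cis (f i).
Proof. exact: (big_morph cis cisD cis0). Qed.

Lemma normc_cis x : normc (cis x) = 1.
Proof. by rewrite /normc/= cos2Dsin2 sqrtr1. Qed.

Lemma normcX z n : normc (z ^+ n) = normc z ^+ n.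
Proof. by elim: n => [|n IH]; rewrite ?expr0 ?normc1// !exprS normcM IH. Qed.

Lemma normc_ge0 z : 0 <= normc z.
Proof. by case: z => a b; rewrite sqrtr_ge0. Qed.

Lemma normc_real x : normc (Complex x 0) = `|x|.
Proof. by rewrite /normc expr0n/= addr0 sqrtr_sqr. Qed.

Lemma normc_sum (I : Type) (s : seq I) (f : I -> R[i]) :
  normc (\sum_(i <- s) f i) <= \sum_(i <- s) normc (f i).
Proof.
elim: s => [|i s IH]; first by rewrite !big_nil normc0.
by rewrite !big_cons; apply: le_trans (le_normcD _ _) _; rewrite lerD2l.
Qed.

Lemma ReD z w : complex.Re (z + w) = complex.Re z + complex.Re w.
Proof. by case: z; case: w. Qed.

Lemma ImD z w : complex.Im (z + w) = complex.Im z + complex.Im w.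
Proof. by case: z; case: w. Qed.

Lemma Re_sum (I : Type) (s : seq I) (f : I -> R[i]) :
  complex.Re (\sum_(i <- s) f i) = \sum_(i <- s) complex.Re (f i).
Proof. exact: (big_morph _ ReD). Qed.

Lemma Im_sum (I : Type) (s : seq I) (f : I -> R[i]) :
  complex.Im (\sum_(i <- s) f i) = \sum_(i <- s) complex.Im (f i).
Proof. exact: (big_morph _ ImD). Qed.

Lemma Re_realM x z : complex.Re (Complex x 0 * z) = x * complex.Re z.
Proof. by case: z => a b /=; rewrite mul0r subr0. Qed.

Lemma Im_realM x z : complex.Im (Complex x 0 * z) = x * complex.Im z.
Proof. by case: z => a b /=; rewrite mul0r addr0. Qed.

Lemma Re_le_normc z : `|complex.Re z| <= normc z.
Proof.
case: z => a b /=; rewrite -sqrtr_sqr ler_sqrt ?addr_ge0 ?sqr_ge0//.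
by rewrite lerDl sqr_ge0.
Qed.

Lemma normc_le_ReIm z : normc z <= `|complex.Re z| + `|complex.Im z|.
Proof.
case: z => a b /=; rewrite -(ger0_norm (addr_ge0 (normr_ge0 a) (normr_ge0 b))).
rewrite -sqrtr_sqr ler_sqrt ?sqr_ge0// sqrrD !real_normK ?num_real//.
by have := mulr_ge0 (normr_ge0 a) (normr_ge0 b); rewrite mulr2n; lra.
Qed.

Lemma prod_realc (I : Type) (s : seq I) (f : I -> R) :
  \prod_(i <- s) Complex (f i) 0 = Complex (\prod_(i <- s) f i) 0.
Proof.
elim: s => [|i s IH]; first by rewrite !big_nil.
by rewrite !big_cons IH; congr Complex; rewrite ?mulr0 ?mul0r ?subr0 ?addr0.
Qed.

Lemma realcX x n : Complex x 0 ^+ n = Complex (x ^+ n) 0 :> R[i].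
Proof.
elim: n => // n IH; rewrite !exprS IH.
by congr Complex; rewrite ?mulr0 ?mul0r ?subr0 ?addr0.
Qed.

(** Passes from one summand to the whole sum: a difference of powers is the difference of the bases
    times N + 1 terms, each of modulus at most r^N. *)
Lemma normc_subX (z w : R[i]) (r : R) (N : nat) : normc z <= r -> normc w <= r ->
  normc (z ^+ N.+1 - w ^+ N.+1) <= N.+1%:R * normc (z - w) * r ^+ N.
Proof.
move=> zr wr; have r0 : 0 <= r by apply: le_trans zr; exact: normc_ge0.
rewrite subrXX normcM mulrAC mulrC ler_wpM2r ?normc_ge0//.
apply: le_trans (normc_sum _ _) _.
apply: (@le_trans _ _ (\sum_(i < N.+1) r ^+ N)); last first.
  by rewrite sumr_const card_ord mulr_natl.
apply: ler_sum => i _; rewrite normcM !normcX.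
have -> : r ^+ N = r ^+ (N.+1.-1 - i) * r ^+ i by rewrite -exprD subnK// -ltnS.
by apply: ler_pM; rewrite ?exprn_ge0 ?normc_ge0// lerXn2r// nnegrE ?normc_ge0.
Qed.

End cis.

(** * Fourier representation of an i.i.d. sum *)

Section iid_sum.
Variables (R : realType) (n N : nat) (p h : nat -> R).

(** An expectation up to normalisation: once the levels beyond [n] are cut off, Gibbs weights have
    total mass at most 1. *)
Definition iid_mean (g : R -> R) : R :=
  \sum_(f : {ffun 'I_N -> 'I_n}) (\prod_i p (f i)) * g (\sum_i h (f i)).

Definition charf (m t : R) : R[i] :=
  \sum_(j < n) Complex (p j) 0 * cis (t * (h j - m)).

Lemma iid_mean_cos (m t c : R) :
  iid_mean (fun s => cos (t * (s - N%:R * m + c))) =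
  complex.Re (charf m t ^+ N * cis (t * c)).
Proof.
rewrite /iid_mean.
have -> : charf m t ^+ N = \sum_(f : {ffun 'I_N -> 'I_n})
    \prod_i (Complex (p (f i)) 0 * cis (t * (h (f i) - m))).
  rewrite -(bigA_distr_bigA (fun (i : 'I_N) (j : 'I_n) => Complex (p j) 0 * cis (t * (h j - m)))).
  by rewrite prodr_const card_ord.
rewrite mulr_suml Re_sum; apply: eq_bigr => f _.
rewrite big_split/= prod_realc -mulrA Re_realM -cis_sum -cisD; congr (_ * cos _).
rewrite -mulr_sumr -mulrDr; congr (_ * (_ + _)).
by rewrite sumrB sumr_const card_ord mulr_natl.
Qed.

(** Parseval in finite form: the kernel is an integral of cosines over [0, T], and it is exchanged
    with a finite sum. Centring at [m] leaves the phase t (N m - a), to be kept of order t. *)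
Lemma iid_mean_fejer (T m a : R) :
  iid_mean (fun s => fejer T (s - a)) =
  \int[@lebesgue_measure R]_(t in `[0, T])
    ((1 - t / T) * complex.Re (charf m t ^+ N * cis (t * (N%:R * m - a)))).
Proof.
under eq_Rintegral => t _.
  rewrite -iid_mean_cos /iid_mean mulr_sumr.
  over.
rewrite Rintegral_sum.
  apply: eq_bigr => f _; rewrite /fejer -RintegralZl//; last first.
    apply: continuous_integrable; exact: continuous_fejer_integrand.
  apply: eq_Rintegral => t _; rewrite mulrCA; congr (_ * (_ * cos (_ * _))); ring.
move=> f t; apply: deriv_at_continuous.
apply: deriv_atM; last first.
  by apply: deriv_atM; [exact: deriv_at_cst|derive_tac; reflexivity].
by derive_tac; reflexivity.
Qed.

Lemma continuous_charf_integrand (T m a : R) : continuous (fun t : R =>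
  (1 - t / T) * complex.Re (charf m t ^+ N * cis (t * (N%:R * m - a)))).
Proof.
under eq_fun do rewrite -iid_mean_cos /iid_mean mulr_sumr.
move=> t; apply: cvgr_sum => f.
apply: (@deriv_at_continuous R (fun t : R => (1 - t / T) * (\prod_i p (f i) *
  cos (t * (\sum_i h (f i) - N%:R * m + (N%:R * m - a)))))).
apply: deriv_atM; last first.
  by apply: deriv_atM; [exact: deriv_at_cst|derive_tac; reflexivity].
by derive_tac; reflexivity.
Qed.

End iid_sum.

Lemma mulr_expRN_le1 (R : realType) (x : R) : x * expR (- x) <= 1.
Proof.
have := expR_ge1Dx x; rewrite expRN ler_pdivrMr ?expR_gt0// mul1r; lra.
Qed.

(** One constant for both regimes of [fejer_integrand_close], where x = t e^{-u}, y = N^-2 and z =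
    rho^N. *)
Lemma error_terms_le (R : realDomainType) (x y z a k i b e : R) :
  0 <= x -> 0 <= y -> 0 <= z -> 0 <= a -> 0 <= k -> 0 <= i -> 0 <= b -> 0 <= e ->
  a * x + k * y + (b + i) * x <= (a + k + i + b + e + 1) * (x + y + z) /\
  z + e * x <= (a + k + i + b + e + 1) * (x + y + z).
Proof.
move=> x0 y0 z0 a0 k0 i0 b0 e0; rewrite -subr_ge0 -(subr_ge0 (z + _)).
have -> : (a + k + i + b + e + 1) * (x + y + z) - (a * x + k * y + (b + i) * x) =
  (k + e + 1) * x + (a + i + b + e + 1) * y + (a + k + i + b + e + 1) * z by ring.
have -> : (a + k + i + b + e + 1) * (x + y + z) - (z + e * x) =
  (a + k + i + b + 1) * x + (a + k + i + b + e + 1) * y + (a + k + i + b + e) * z by ring.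
by split; rewrite !(addr_ge0, mulr_ge0).
Qed.

(** * Pointwise comparison of the Fourier integrand with a Gaussian *)

Section pointwise_bound.
Variables (R : realType) (z : R[i]) (t T s c C delta rho b B : R) (N : nat).
Hypotheses (N0 : (0 < N)%N) (d0 : 0 < delta) (d1 : delta <= 1) (T0 : 0 < T).
Hypotheses (t0 : 0 <= t) (tT : t <= T) (c0 : 0 < c) (cs : 4 * c <= s).
Hypotheses (bB : `|b| <= B) (C0 : 0 <= C).
Hypothesis Cd : C * delta <= c * expR (- (2 * c)).

Let w := expR (- (s * t ^+ 2 / 2)).
Let u := c * N%:R * t ^+ 2 / 2.

Lemma gauss_pow_le : w ^+ N <= expR (- u).
Proof.
rewrite /w -expRM_natl ler_expR /u mulrN lerN2.
have h1 : c * N%:R * t ^+ 2 <= s * N%:R * t ^+ 2.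
  by apply: ler_wpM2r; [exact: sqr_ge0|apply: ler_wpM2r => //; move: cs c0; lra].
have h2 : 0 <= s * N%:R * t ^+ 2 by rewrite !mulr_ge0 ?sqr_ge0//; move: cs c0; lra.
lra.
Qed.

(** With y = c t^2, the condition 4c <= s gives w <= e^{-2y}. The gap between e^{-2y} and e^{-y}
    absorbs the cubic error, by [Cd], so both [z] and [w] have modulus at most r = e^{-y + kap}, and
    [normc_subX] applies. *)
Lemma charf_pow_close : t <= delta ->
  normc (z - Complex w 0) <= C * t ^+ 3 + (N%:R ^+ 3)^-1 ->
  normc (z ^+ N - Complex (w ^+ N) 0) <=
  expR (c + expR c) * (2 * C / c * (t * expR (- u)) + (N%:R ^+ 2)^-1).
Proof.
move=> td zw; set tau := (N%:R ^+ 3)^-1 in zw *.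
have N0R : 0 < N%:R :> R by rewrite ltr0n.
have tau0 : 0 <= tau by rewrite invr_ge0 exprn_ge0.
pose y := c * t ^+ 2.
have t2 : 0 <= t ^+ 2 := sqr_ge0 t.
have t21 : t ^+ 2 <= 1 by rewrite expr_le1//; exact: le_trans td d1.
have y0 : 0 <= y by rewrite mulr_ge0 ?(ltW c0).
have yc : y <= c by rewrite /y ler_piMr ?(ltW c0).
have wy : w <= expR (- (2 * y)).
  rewrite /w ler_expR lerN2 /y.
  have : 4 * c * t ^+ 2 <= s * t ^+ 2 by rewrite ler_wpM2r.
  lra.
(* As y <= c, e^{-y} kap >= tau: [kap] moves the truncation error into the exponent, and (N - 1) kap
   <= e^c. *)
pose kap := tau * expR c.
have kap0 : 0 <= kap by rewrite mulr_ge0 ?expR_ge0.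
pose r := expR (- y + kap).
have er : expR (- y) <= r by rewrite ler_expR lerDl.
have wr : normc (Complex w 0) <= r.
  rewrite normc_real ger0_norm ?expR_ge0//; apply: le_trans er; apply: (le_trans wy).
  by rewrite ler_expR; lra.
have zr : normc z <= r.
  have -> : z = Complex w 0 + (z - Complex w 0) by rewrite addrC subrK.
  apply: le_trans (le_normcD _ _) _.
  rewrite normc_real ger0_norm ?expR_ge0//.
  have key : w + C * t ^+ 3 <= expR (- y).
    have -> : expR (- y) = expR (- (2 * y)) * expR y by rewrite -expRD; congr expR; ring.
    have h1 : expR (- (2 * y)) * (1 + y) <= expR (- (2 * y)) * expR y.
      by rewrite ler_wpM2l ?expR_ge0 ?expR_ge1Dx.
    have h2 : C * t ^+ 3 <= expR (- (2 * y)) * y.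
      apply: (@le_trans _ _ (c * expR (- (2 * c)) * t ^+ 2)).
        rewrite exprS mulrA ler_wpM2r//; apply: le_trans Cd.
        by rewrite ler_wpM2l.
      rewrite /y [leLHS]mulrAC [leRHS]mulrC ler_wpM2l ?mulr_ge0 ?(ltW c0)//.
      by rewrite ler_expR lerN2 -/y; lra.
    lra.
  have e2 : tau <= expR (- y) * kap.
    rewrite /kap mulrCA -expRD ler_peMr// -expR0 ler_expR; lra.
  have e3 : expR (- y) * (1 + kap) <= r.
    by rewrite /r expRD ler_wpM2l ?expR_ge0 ?expR_ge1Dx.
  lra.
rewrite -realcX; have := @normc_subX _ _ _ _ N.-1 zr wr; rewrite prednK// => h.
apply: (le_trans h) => {h}.
have NE : N.-1%:R = N%:R - 1 :> R by rewrite -[in RHS](prednK N0) -natr1 addrK.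
have rk : r ^+ N.-1 <= expR (c + expR c) * expR (- (N%:R * y)).
  rewrite /r -expRM_natl -expRD ler_expR.
  have : N.-1%:R * kap <= expR c.
    rewrite /kap mulrA ler_piMl ?expR_ge0// /tau ler_pdivrMr ?exprn_gt0// mul1r.
    apply: (@le_trans _ _ N%:R); first by rewrite ler_nat leq_pred.
    by rewrite exprS ler_peMr// exprn_ege1// ler1n.
  by rewrite NE; lra.
have K0 : 0 <= expR (c + expR c) := expR_ge0 _.
have nz : 0 <= N%:R * normc (z - Complex w 0) by rewrite mulr_ge0 ?normc_ge0.
apply: (le_trans (ler_wpM2l nz rk)).
rewrite mulrCA ler_wpM2l//.
apply: (@le_trans _ _ (N%:R * (C * t ^+ 3 + tau) * expR (- (N%:R * y)))).
  by rewrite ler_wpM2r ?expR_ge0// ler_wpM2l.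
rewrite mulrDr mulrDl; apply: lerD; last first.
  have -> : N%:R * tau = (N%:R ^+ 2)^-1 by rewrite /tau; field; rewrite gt_eqF.
  rewrite ler_piMr ?invr_ge0 ?exprn_ge0// -expR0 ler_expR oppr_le0 mulr_ge0//.
(* One factor e^{-u} pays for N t^2, through u e^{-u} <= 1; the other remains, to be integrated
   against t. *)
have uE : N%:R * y = u + u by rewrite /u /y; field.
rewrite uE opprD expRD.
have -> : N%:R * (C * t ^+ 3) * (expR (- u) * expR (- u)) =
  (2 * C / c * (t * expR (- u))) * (u * expR (- u)) by rewrite /u; field; rewrite gt_eqF.
rewrite ler_piMr ?mulr_expRN_le1//.
by rewrite !mulr_ge0 ?expR_ge0 ?invr_ge0 ?(ltW c0).
Qed.

(** Below [delta], the phase costs t B and the triangle t / T, both multiplied by e^{-u}. Above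
    [delta], both terms are small separately; there 1 <= t / delta puts the Gaussian into the form t
    e^{-u}, whose integral is O(1/N). *)
Lemma fejer_integrand_close :
  (t <= delta -> normc (z - Complex w 0) <= C * t ^+ 3 + (N%:R ^+ 3)^-1) ->
  (delta <= t -> normc z <= rho) -> 0 <= rho ->
  `|(1 - t / T) * complex.Re (z ^+ N * cis (t * b)) - w ^+ N| <=
  (expR (c + expR c) * (2 * C / c) + expR (c + expR c) + T^-1 + B + delta^-1 + 1) *
  (t * expR (- u) + (N%:R ^+ 2)^-1 + rho ^+ N).
Proof.
move=> H1 H2 rho0; set K := expR (c + _).
have K0 : 0 <= K := expR_ge0 _.
have N2 : 0 <= (N%:R ^+ 2)^-1 :> R by rewrite invr_ge0 exprn_ge0.
have rN : 0 <= rho ^+ N by rewrite exprn_ge0.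
have eu := expR_ge0 (- u).
have te : 0 <= t * expR (- u) by rewrite mulr_ge0.
have B0 : 0 <= B by apply: le_trans bB.
have Ti : 0 <= T^-1 by rewrite invr_ge0 ltW.
have di : 0 <= delta^-1 by rewrite invr_ge0 ltW.
have KC : 0 <= K * (2 * C / c) by rewrite !mulr_ge0 ?invr_ge0 ?(ltW c0).
have tT1 : 0 <= t / T <= 1 by rewrite divr_ge0 ?(ltW T0)//= ler_pdivrMr// mul1r.
have w0 : 0 <= w ^+ N by rewrite exprn_ge0 ?expR_ge0.
have T1 : `|1 - t / T| <= 1 by rewrite ler_norml; lra.
case/orP: (le_total t delta) => [td|dt].
  have cl := charf_pow_close td (H1 td).
  set Z := z ^+ N in cl *.
  have -> : (1 - t / T) * complex.Re (Z * cis (t * b)) - w ^+ N =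
     (1 - t / T) * complex.Re ((Z - Complex (w ^+ N) 0) * cis (t * b)) +
     w ^+ N * ((cos (t * b) - 1) - t / T * cos (t * b)).
    by case: (Z) => p q /=; ring.
  apply: (le_trans (ler_normD _ _)).
  have h1 : `|(1 - t / T) * complex.Re ((Z - Complex (w ^+ N) 0) * cis (t * b))| <=
     K * (2 * C / c * (t * expR (- u)) + (N%:R ^+ 2)^-1).
    rewrite normrM; apply: (@le_trans _ _ (1 * normc (Z - Complex (w ^+ N) 0))).
      apply: ler_pM => //; apply: le_trans (Re_le_normc _) _.
      by rewrite normcM normc_cis mulr1.
    by rewrite mul1r.
  have h2 : `|w ^+ N * (cos (t * b) - 1 - t / T * cos (t * b))| <=
      expR (- u) * (t * B + t / T).
    rewrite normrM ger0_norm//; apply: ler_pM => //; first exact: gauss_pow_le.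
    apply: (le_trans (ler_normB _ _)); apply: lerD.
      have := cos_lipschitz (t * b) 0; rewrite cos0 subr0 => h; apply: (le_trans h).
      by rewrite normrM (ger0_norm t0) ler_wpM2l.
    rewrite normrM ger0_norm; last by case/andP: tT1.
    by rewrite ler_piMr ?cos_max//; case/andP: tT1.
  apply: (le_trans (lerD h1 h2)).
  have -> : expR (- u) * (t * B + t / T) = (B + T^-1) * (t * expR (- u)) by ring.
  have -> : K * (2 * C / c * (t * expR (- u)) + (N%:R ^+ 2)^-1) =
    K * (2 * C / c) * (t * expR (- u)) + K * (N%:R ^+ 2)^-1 by ring.
  by apply: (error_terms_le te N2 rN KC K0 Ti B0 di).1.
apply: (le_trans (ler_normB _ _)).
have h1 : `|(1 - t / T) * complex.Re (z ^+ N * cis (t * b))| <= rho ^+ N.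
  rewrite normrM; apply: (@le_trans _ _ (1 * normc (z ^+ N))).
    apply: ler_pM => //; apply: le_trans (Re_le_normc _) _.
    by rewrite normcM normc_cis mulr1.
  by rewrite mul1r normcX lerXn2r ?nnegrE ?normc_ge0// H2.
have h2 : `|w ^+ N| <= delta^-1 * (t * expR (- u)).
  rewrite ger0_norm//; apply: (le_trans gauss_pow_le).
  by rewrite mulrA ler_peMl// mulrC ler_pdivlMr// mul1r.
apply: (le_trans (lerD h1 h2)).
by apply: (error_terms_le te N2 rN KC K0 Ti B0 di).2.
Qed.

End pointwise_bound.

Lemma cvg_of_close (R : realType) (x y e : nat -> R) (l : R) :
  (\forall n \near \oo, `|x n - y n| <= e n) -> e @ \oo --> (0 : R) ->
  y @ \oo --> l -> x @ \oo --> l.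
Proof.
move=> xy e0 yl.
have xy0 : (fun n => x n - y n) @ \oo --> (0 : R).
  apply: norm_cvg0; apply: (@squeeze_cvgr _ _ _ _ (fun=> 0) e) => //; last exact: cvg_cst.
  by near=> n; rewrite normr_ge0/=; near: n.
suff : (fun n => x n - y n + y n) @ \oo --> l by under eq_fun do rewrite subrK.
by rewrite -[l]add0r; exact: cvgD.
Unshelve. all: by end_near. Qed.

Lemma cvg_invn (R : realType) : (fun n : nat => n%:R^-1) @ \oo --> (0 : R).
Proof.
apply/(gtr0_cvgV0 (f := fun n : nat => n%:R)); last exact: cvgr_idn.
by near=> n; rewrite ltr0n; near: n; exact: nbhs_infty_gt.
Unshelve. all: by end_near. Qed.

Lemma cvg_natM_expr (R : realType) (rho : R) : 0 <= rho < 1 ->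
  (fun n : nat => n%:R * rho ^+ n) @ \oo --> (0 : R).
Proof.
move=> /andP[r0 r1].
have r10 : 0 < 1 - rho by rewrite subr_gt0.
apply: (@squeeze_cvgr _ _ _ _ (fun=> 0) (fun n => n%:R * expR (- ((1 - rho) * n%:R)))).
- near=> n; rewrite mulr_ge0 ?exprn_ge0//= ler_wpM2l//.
  rewrite -mulNr expRM_natr lerXn2r ?nnegrE ?expR_ge0//.
  by have := expR_ge1Dx (- (1 - rho)); lra.
- exact: cvg_cst.
- exact: (cvg_comp _ _ (@cvgr_idn R) (cvg_idM_expRNM r10)).
Unshelve. all: by end_near. Qed.

Lemma Rintegral_id_gauss_le (R : realType) (c T : R) : 0 < c -> 0 <= T ->
  \int[@lebesgue_measure R]_(t in `[0, T]) (t * expR (- (c * t ^+ 2 / 2))) <= c^-1.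
Proof.
move=> c0 T0.
have dF t : deriv_at (fun t => - (expR (- (c * t ^+ 2 / 2)) / c)) t (t * expR (- (c * t ^+ 2 / 2))).
  by derive_tac; field; rewrite gt_eqF.
rewrite (Rintegral_derive T0 _ dF).
  rewrite expr0n/= mulr0 mul0r oppr0 expR0 opprK mul1r gerDr oppr_le0.
  by rewrite divr_ge0 ?expR_ge0// ltW.
move=> t; apply: deriv_at_continuous; derive_tac; reflexivity.
Qed.

Lemma Rintegral_gauss_scale (R : realType) (G : R -> R) (b T : R) :
  (forall x, deriv_at G x (gauss_fun x)) -> G 0 = 0 -> 0 < b -> 0 <= T ->
  \int[@lebesgue_measure R]_(t in `[0, T]) expR (- ((b * t) ^+ 2)) = G (b * T) / b.
Proof.
move=> dG G0 b0 T0.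
have dF t : deriv_at (fun t => G (b * t) / b) t (expR (- ((b * t) ^+ 2))).
  have dGb : deriv_at (fun t => G (b * t)) t (gauss_fun (b * t) * b).
    by apply: (@deriv_at_comp _ (fun t => b * t) G); [exact: dG|derive_tac; ring].
  apply: (deriv_at_eq (deriv_atM dGb (deriv_at_cst t b^-1))).
  by rewrite /gauss_fun mulr0 addr0 mulfK// gt_eqF.
rewrite (Rintegral_derive T0 _ dF); first by rewrite mulr0 G0 mul0r subr0.
move=> t; apply: deriv_at_continuous; derive_tac; reflexivity.
Qed.

(** * Local limit theorem against Fejer kernels *)

Section local_limit_fejer.
Variables (R : realType) (n : nat -> nat) (p : nat -> nat -> R) (h : nat -> R).
Variables (m s E : nat -> R) (sig C B : R).
Hypotheses (sig0 : 0 < sig) (s_sig : s @ \oo --> sig).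
Hypothesis mE : \forall N \near \oo, `|N%:R * m N - E N| <= B.
Hypothesis C0 : 0 <= C.
Hypothesis charf_near0 : \forall N \near \oo, forall t, 0 <= t <= 1 ->
  normc (charf (n N) (p N) h (m N) t - Complex (expR (- (s N * t ^+ 2 / 2))) 0) <=
  C * t ^+ 3 + (N%:R ^+ 3)^-1.
Hypothesis charf_away0 : forall delta T : R, 0 < delta ->
  exists2 rho : R, 0 <= rho < 1 & \forall N \near \oo, forall t, delta <= t <= T ->
    normc (charf (n N) (p N) h (m N) t) <= rho.

(** The limit depends on neither [T] nor [a]: only t ~ N^{-1/2} contributes, where the triangle
    factor and the phase are close to 1. *)
Lemma cvg_iid_mean_fejer (T a : R) : 0 < T ->
  (fun N => Num.sqrt N%:R *
     iid_mean (n N) N (p N) h (fun x => fejer T (x - E N - a))) @ \oo -->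
  pi / Num.sqrt (2 * pi * sig).
Proof.
move=> T0.
have [G [dG GN Gl]] := @gauss_antiderivative R.
have G0 : G 0 = 0 by have := GN 0; rewrite oppr0; lra.
(* 4c = sig / 2 is eventually below [s N]. [delta] is then the largest value up to 1 for which (C +
   1) delta <= c e^{-2c}; the 1 added to [C] avoids a division by 0. *)
pose c := sig / 8; have c0 : 0 < c by rewrite divr_gt0.
pose delta := Num.min 1 (c * expR (- (2 * c)) / (C + 1)).
have sig2 : sig / 2 < sig by move: sig0; lra.
have C10 : 0 < C + 1 by rewrite ltr_wpDl.
have d0 : 0 < delta by rewrite lt_min ltr01/= divr_gt0// mulr_gt0// expR_gt0.
have d1 : delta <= 1 by rewrite ge_min lexx.
have Cd : C * delta <= c * expR (- (2 * c)).
  apply: (@le_trans _ _ ((C + 1) * delta)); first by rewrite ler_wpM2r ?(ltW d0)// lerDl.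
  by rewrite -ler_pdivlMl// mulrC ge_min lexx orbT.
have [rho /andP[rho0 rho1] away] := charf_away0 T d0.
pose B' := B + `|a|.
pose D := expR (c + expR c) * (2 * C / c) + expR (c + expR c) + T^-1 + B' + delta^-1 + 1.
pose bb N := Num.sqrt (N%:R * s N / 2).
(* The comparison sequence is sqrt N times the Gaussian integral over [0, T]; the error is sqrt N
   times the integrated pointwise bound, of order N^{-1/2}. *)
apply: (@cvg_of_close _ _ (fun N => Num.sqrt (2 / s N) * G (bb N * T))
  (fun N => D * (c^-1 * Num.sqrt N%:R^-1 + T * N%:R^-1 + T * (N%:R * rho ^+ N)))).
- near=> N.
  have N0 : (0 < N)%N by near: N; exact: nbhs_infty_gt.
  have N0R : 0 < N%:R :> R by rewrite ltr0n.
  have sN : sig / 2 <= s N.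
    near: N; exact: (cvgr_ge sig).
  have cs : 4 * c <= s N by rewrite /c; lra.
  have s0 : 0 < s N by apply: lt_le_trans sN; rewrite divr_gt0.
  have bB : `|N%:R * m N - E N - a| <= B'.
    apply: (le_trans (ler_normB _ _)); rewrite lerD2r.
    by near: N; exact: mE.
  have H1 t : 0 <= t <= 1 ->
    normc (charf (n N) (p N) h (m N) t - Complex (expR (- (s N * t ^+ 2 / 2))) 0) <=
    C * t ^+ 3 + (N%:R ^+ 3)^-1 by move: t; near: N; exact: charf_near0.
  have H2 t : delta <= t <= T -> normc (charf (n N) (p N) h (m N) t) <= rho.
    by move: t; near: N; exact: away.
  have bb0 : 0 < bb N by rewrite sqrtr_gt0 divr_gt0// mulr_gt0.
  have -> : Num.sqrt (2 / s N) * G (bb N * T) = Num.sqrt N%:R *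
      \int[@lebesgue_measure R]_(t in `[0, T]) expR (- ((bb N * t) ^+ 2)).
    rewrite (Rintegral_gauss_scale dG)// ?ltW//.
    rewrite mulrCA mulrC; congr (_ * _).
    have -> : Num.sqrt N%:R = Num.sqrt (2 / s N) * bb N.
      rewrite /bb -sqrtrM; last by rewrite divr_ge0// ltW.
      by congr Num.sqrt; field; rewrite gt_eqF.
    by rewrite mulfK// gt_eqF.
  under [X in iid_mean _ _ _ _ X]eq_fun do rewrite -addrA -opprD.
  rewrite (@iid_mean_fejer _ _ _ _ _ _ (m N)) -mulrBr normrM.
  rewrite (ger0_norm (sqrtr_ge0 _)).
  have cw : continuous (fun t : R => expR (- ((bb N * t) ^+ 2))).
    by move=> t; apply: deriv_at_continuous; derive_tac; reflexivity.
  rewrite -RintegralB//; last 2 first.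
  - by apply: continuous_integrable; exact: continuous_charf_integrand.
  - exact: continuous_integrable.
  pose g t := D * (t * expR (- (c * N%:R * t ^+ 2 / 2)) + (N%:R ^+ 2)^-1 + rho ^+ N).
  have cg1 : continuous (fun t : R => t * expR (- (c * N%:R * t ^+ 2 / 2))).
    by move=> t; apply: deriv_at_continuous; derive_tac; reflexivity.
  have cg : continuous g.
    by move=> t; apply: cvgM; [exact: cvg_cst|apply: cvgD; [apply: cvgD; [exact: cg1|exact: cvg_cst]|exact: cvg_cst]].
  have D0 : 0 <= D.
    have B'0 : 0 <= B' := le_trans (normr_ge0 _) bB.
    have k1 : 0 <= expR (c + expR c) * (2 * C / c).
      exact: mulr_ge0 (expR_ge0 _) (divr_ge0 (mulr_ge0 (ler0n R 2) C0) (ltW c0)).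
    have Ti : 0 <= T^-1 by rewrite invr_ge0 ltW.
    have di : 0 <= delta^-1 by rewrite invr_ge0 ltW.
    exact: (addr_ge0 (addr_ge0 (addr_ge0 (addr_ge0 (addr_ge0 k1 (expR_ge0 _)) Ti) B'0) di) ler01).
  have ub : `|\int[@lebesgue_measure R]_(t in `[0, T])
      ((1 - t / T) * complex.Re (charf (n N) (p N) h (m N) t ^+ N *
        cis (t * (N%:R * m N - (E N + a)))) - expR (- (bb N * t) ^+ 2))| <=
     \int[@lebesgue_measure R]_(t in `[0, T]) g t.
    apply: ler_norm_Rintegral => //.
      by move=> t; apply: cvgB; [exact: continuous_charf_integrand|exact: cw].
    move=> t /andP[t0 tT].
    have -> : expR (- (bb N * t) ^+ 2) = expR (- (s N * t ^+ 2 / 2)) ^+ N.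
      rewrite -expRM_natl exprMn sqr_sqrtr; last by rewrite divr_ge0// mulr_ge0// ltW.
      by congr expR; field.
    rewrite opprD addrA.
    apply: fejer_integrand_close => //.
      by move=> td; apply: H1; rewrite t0 (le_trans td).
    by move=> dt; apply: H2; rewrite dt.
  apply: (le_trans (ler_wpM2l (sqrtr_ge0 _) ub)).
  have -> : \int[@lebesgue_measure R]_(t in `[0, T]) g t =
     D * (\int[@lebesgue_measure R]_(t in `[0, T]) (t * expR (- (c * N%:R * t ^+ 2 / 2))) +
       ((N%:R ^+ 2)^-1 + rho ^+ N) * T).
    rewrite /g RintegralZl//; last first.
      by apply: continuous_integrable => t; apply: cvgD; [apply: cvgD; [exact: cg1|exact: cvg_cst]|exact: cvg_cst].
    congr (_ * _); under eq_Rintegral do rewrite -addrA.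
    rewrite RintegralD//; [|exact: continuous_integrable|by apply: continuous_integrable => t; exact: cvg_cst].
    congr (_ + _); rewrite Rintegral_cst//=; congr (_ * _).
    by rewrite lebesgue_measure_itv/= lte_fin T0/= subr0.
  rewrite mulrCA; apply: ler_wpM2l => //.
  have cN0 : 0 < c * N%:R by rewrite mulr_gt0.
  have i1 := Rintegral_id_gauss_le cN0 (ltW T0).
  have sq1 : Num.sqrt N%:R <= N%:R :> R.
    rewrite -[leRHS]sqr_sqrtr// expr2 ler_peMl ?sqrtr_ge0//.
    by rewrite -[leLHS]sqrtr1 ler_sqrt// ler1n.
  rewrite mulrDr -addrA; apply: lerD.
    apply: (le_trans (ler_wpM2l (sqrtr_ge0 _) i1)).
    rewrite le_eqVlt; apply/orP; left; apply/eqP.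
    rewrite sqrtrV ?ler0n// invfM mulrCA; congr (_ * _).
    rewrite -[X in _ / X]sqr_sqrtr// expr2 invfM mulrA mulfV ?mul1r//.
    by rewrite gt_eqF// sqrtr_gt0.
  rewrite mulrDl mulrDr; apply: lerD.
    apply: (@le_trans _ _ (N%:R * ((N%:R ^+ 2)^-1 * T))).
      by rewrite ler_wpM2r// mulr_ge0 ?(ltW T0)// invr_ge0 exprn_ge0.
    by rewrite le_eqVlt; apply/orP; left; apply/eqP; field; rewrite gt_eqF.
  have -> : T * (N%:R * rho ^+ N) = N%:R * (rho ^+ N * T) by ring.
  by rewrite ler_wpM2r// mulr_ge0 ?exprn_ge0// ltW.
- rewrite -[X in _ --> X](mulr0 D); apply: cvgM; first exact: cvg_cst.
  have -> : 0 = c^-1 * Num.sqrt 0 + T * 0 + T * 0 :> R by rewrite sqrtr0 !mulr0 !addr0.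
  apply: cvgD; first apply: cvgD; (apply: cvgM; first exact: cvg_cst).
  + apply: (@continuous_cvg _ _ _ _ _ _ Num.sqrt); first exact: sqrt_continuous.
    exact: cvg_invn.
  + exact: cvg_invn.
  + by apply: cvg_natM_expr; rewrite rho0.
- have -> : pi / Num.sqrt (2 * pi * sig) = Num.sqrt (2 / sig) * (Num.sqrt pi / 2).
    have pi0 := @pi_gt0 R.
    have pE : pi = Num.sqrt pi ^+ 2 :> R by rewrite sqr_sqrtr// ltW.
    rewrite [2 * pi]mulrC -mulrA sqrtrM ?(ltW pi0)//.
    have -> : Num.sqrt (2 * sig) = sig * Num.sqrt (2 / sig).
      have -> : sig * Num.sqrt (2 / sig) = Num.sqrt (sig ^+ 2) * Num.sqrt (2 / sig).
        by rewrite sqrtr_sqr ger0_norm ?ltW.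
      rewrite -sqrtrM ?sqr_ge0//.
      by congr Num.sqrt; field; rewrite gt_eqF.
    have sp : Num.sqrt pi != 0 :> R by rewrite gt_eqF// sqrtr_gt0.
    have ss : Num.sqrt (2 / sig) != 0 :> R by rewrite gt_eqF// sqrtr_gt0 divr_gt0.
    have e : Num.sqrt (2 / sig) ^+ 2 = 2 / sig by rewrite sqr_sqrtr// divr_ge0// ltW.
    apply: (mulIf ss).
    have -> : Num.sqrt (2 / sig) * (Num.sqrt pi / 2) * Num.sqrt (2 / sig) =
      Num.sqrt (2 / sig) ^+ 2 * (Num.sqrt pi / 2) by ring.
    rewrite e; move: pE sp ss {e}; move: (Num.sqrt pi) (Num.sqrt (2 / sig)) => x y -> x0 y0.
    by field; rewrite x0 y0 gt_eqF.
  apply: cvgM.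
    apply: (@continuous_cvg _ _ _ _ _ _ Num.sqrt); first exact: sqrt_continuous.
    apply: cvgM; first exact: cvg_cst.
    by apply: cvgV => //; rewrite gt_eqF.
  apply: (cvg_comp (fun N => bb N * T) G _ Gl).
  apply/cvgryPge => M.
  near=> N.
  have sN : sig / 2 <= s N by near: N; exact: (cvgr_ge sig).
  have NM : (`|M| / T) ^+ 2 * 4 / sig <= N%:R by near: N; exact: near_natr_ge.
  apply: (le_trans (ler_norm M)); rewrite -ler_pdivrMr// /bb.
  rewrite -[leLHS]ger0_norm ?divr_ge0 ?(ltW T0)// -sqrtr_sqr ler_wsqrtr//.
  move: NM; rewrite ler_pdivrMr// => NM.
  have : N%:R * (sig / 2) <= N%:R * s N by rewrite ler_wpM2l.
  lra.
Unshelve. all: by end_near. Qed.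

End local_limit_fejer.

(** * Boltzmann weights *)

Section nonneg_series.
Variable R : realType.
Implicit Types u v : nat -> R.

Lemma psum_le_lim u n : (forall j, 0 <= u j) -> cvgn (series u) ->
  \sum_(j < n) u j <= limn (series u).
Proof.
move=> u0 cu; rewrite -(big_mkord xpredT u).
apply: (@nondecreasing_cvgn_le _ (series u)) => //.
by apply: nondecreasing_series.
Qed.

Lemma term_le_lim u j : (forall j, 0 <= u j) -> cvgn (series u) -> u j <= limn (series u).
Proof.
move=> u0 cu; apply: le_trans (psum_le_lim j.+1 u0 cu).
by rewrite big_ord_recr/= lerDr sumr_ge0.
Qed.

Lemma lim_series_ge0 u : (forall j, 0 <= u j) -> cvgn (series u) -> 0 <= limn (series u).
Proof. by move=> u0 cu; apply: le_trans (term_le_lim 0 u0 cu). Qed.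

Lemma lim_series_ler u v : (forall j, u j <= v j) -> cvgn (series u) -> cvgn (series v) ->
  limn (series u) <= limn (series v).
Proof. by move=> uv cu cv; exact: lim_series_le. Qed.

Lemma seriesZ_cvg (c : R) u (l : R) : series u @ \oo --> l ->
  series (fun j => c * u j) @ \oo --> c * l.
Proof.
move=> ul; have -> : series (fun j => c * u j) = (fun n => c * series u n).
  by apply/funext => n; rewrite /series/= mulr_sumr.
by apply: cvgM => //; exact: cvg_cst.
Qed.

Lemma seriesD_cvg u v (l l' : R) : series u @ \oo --> l -> series v @ \oo --> l' ->
  series (fun j => u j + v j) @ \oo --> l + l'.
Proof.
move=> ul vl; have -> : series (fun j => u j + v j) = (fun n => series u n + series v n).
  by apply/funext => n; rewrite /series/= big_split.
exact: cvgD.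
Qed.

Lemma series_domination u v : (forall j, 0 <= u j) -> (forall j, u j <= v j) ->
  cvgn (series v) -> cvgn (series u).
Proof. move=> u0 uv cv; apply: (series_le_cvg u0 _ uv cv) => j; exact: le_trans (uv j). Qed.

End nonneg_series.

Lemma exprn_le_expR (R : realType) (x : R) k : 0 <= x -> x ^+ k <= k`!%:R * expR x.
Proof.
case: k => [|k] x0.
  by rewrite expr0 mul1r -expR0 ler_expR.
have := expR_ge1Dxn k x0 => h.
rewrite -ler_pdivrMl ?ltr0n ?fact_gt0// mulrC; apply: le_trans h.
by rewrite lerDr.
Qed.

Section moments.
Variables (R : realType) (h : nat -> R) (j0 : nat).
Hypothesis h0 : forall j, 0 <= h j.
Hypothesis hj0 : h j0 = 0.
Hypothesis summable_h : forall beta, 0 < beta -> cvgn (series (fun j => expR (- beta * h j))).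
Hypothesis h_nonconst : forall m : R, exists j, h j != m.

Definition boltz (beta : R) (k j : nat) : R := h j ^+ k * expR (- beta * h j).
Definition moment (k : nat) (beta : R) : R := limn (series (boltz beta k)).

Lemma boltz_ge0 beta k j : 0 <= boltz beta k j.
Proof. by rewrite mulr_ge0 ?exprn_ge0 ?expR_ge0. Qed.

(** Half of the exponential absorbs the power of [h j]; the other half is summable. *)
Lemma cvg_boltz beta k : 0 < beta -> cvgn (series (boltz beta k)).
Proof.
move=> b0; have b20 : 0 < beta / 2 by rewrite divr_gt0.
pose c := (beta / 2) ^- k * k`!%:R.
apply: (@series_domination _ _ (fun j => c * expR (- (beta / 2) * h j))).
- exact: boltz_ge0.
- move=> j; rewrite /boltz.
  have -> : - beta * h j = - (beta / 2) * h j + - (beta / 2) * h j by field.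
  rewrite expRD mulrA ler_wpM2r ?expR_ge0//.
  rewrite mulNr expRN ler_pdivrMr ?expR_gt0// /c -mulrA.
  rewrite ler_pdivlMl ?exprn_gt0// -exprMn.
  by apply: exprn_le_expR; rewrite mulr_ge0 ?(ltW b20).
- by apply/cvg_ex; eexists; apply: seriesZ_cvg; exact: summable_h.
Qed.

Lemma moment_cvg beta k : 0 < beta -> series (boltz beta k) @ \oo --> moment k beta.
Proof. by move=> b0; exact: cvg_boltz. Qed.

Lemma moment_ge0 beta k : 0 < beta -> 0 <= moment k beta.
Proof. by move=> b0; apply: lim_series_ge0; [exact: boltz_ge0|exact: cvg_boltz]. Qed.

Lemma moment0_ge1 beta : 0 < beta -> 1 <= moment 0 beta.
Proof.
move=> b0; apply: (le_trans _ (term_le_lim j0 (boltz_ge0 beta 0) (cvg_boltz (k := 0) b0))).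
by rewrite /boltz hj0 mulr0 expR0 expr0 mul1r.
Qed.

Lemma moment0_gt0 beta : 0 < beta -> 0 < moment 0 beta.
Proof. by move=> b0; apply: lt_le_trans (moment0_ge1 b0). Qed.

(** Differentiating a weight in [beta] raises the power of the energy by one, and weights decrease
    in [beta]. This mean value bound replaces differentiation under the sum. *)
Lemma boltz_lipschitz b x y k j : 0 < b -> b <= x -> b <= y ->
  `|boltz x k j - boltz y k j| <= `|x - y| * boltz b k.+1 j.
Proof.
move=> b0.
wlog xy : x y / x <= y.
  move=> H bx by_; case/orP: (le_total x y) => xy; first exact: H.
  by rewrite distrC [`|x - y|]distrC; exact: H.
move=> bx _; rewrite /boltz -mulrBr normrM (ger0_norm (exprn_ge0 _ (h0 j))).
have -> : expR (- x * h j) - expR (- y * h j) = expR (- x * h j) * (1 - expR (- ((y - x) * h j))).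
  by rewrite mulrBr mulr1 -expRD; congr (_ - expR _); ring.
have yxh : 0 <= (y - x) * h j by rewrite mulr_ge0 ?subr_ge0.
have e1 : expR (- ((y - x) * h j)) <= 1 by rewrite -expR0 ler_expR oppr_le0.
rewrite ger0_norm ?mulr_ge0 ?expR_ge0 ?subr_ge0// distrC ger0_norm ?subr_ge0//.
have -> : (y - x) * (h j ^+ k.+1 * expR (- b * h j)) =
  h j ^+ k * (expR (- b * h j) * ((y - x) * h j)) by rewrite exprS; ring.
rewrite ler_wpM2l ?exprn_ge0//.
apply: ler_pM; rewrite ?expR_ge0 ?subr_ge0//.
  by rewrite ler_expR ler_wpM2r// lerN2.
by have := expR_ge1Dx (- ((y - x) * h j)); lra.
Qed.

Lemma moment_lipschitz b x y k : 0 < b -> b <= x -> b <= y ->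
  `|moment k x - moment k y| <= `|x - y| * moment k.+1 b.
Proof.
move=> b0 bx by_.
have x0 : 0 < x by exact: lt_le_trans bx.
have y0 : 0 < y by exact: lt_le_trans by_.
have H := fun j => boltz_lipschitz k j b0 bx by_.
have c1 : series (fun j => boltz x k j + - 1 * boltz y k j) @ \oo --> moment k x + - 1 * moment k y.
  by apply: seriesD_cvg; [exact: moment_cvg|apply: seriesZ_cvg; exact: moment_cvg].
have c2 : series (fun j => `|x - y| * boltz b k.+1 j) @ \oo --> `|x - y| * moment k.+1 b.
  by apply: seriesZ_cvg; exact: moment_cvg.
rewrite ler_norml; apply/andP; split.
  have c3 : series (fun j => - 1 * (`|x - y| * boltz b k.+1 j)) @ \oo --> - 1 * (`|x - y| * moment k.+1 b).
    exact: seriesZ_cvg.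
  rewrite -mulN1r -[moment k x - _](_ : moment k x + - 1 * moment k y = _); last by rewrite mulN1r.
  rewrite -(cvg_lim _ c1)// -(cvg_lim _ c3)//; apply: lim_series_ler.
  - by move=> j; have := H j; rewrite ler_norml !mulN1r => /andP[].
  - by apply/cvg_ex; eexists; exact: c3.
  - by apply/cvg_ex; eexists; exact: c1.
rewrite -[moment k x - _](_ : moment k x + - 1 * moment k y = _); last by rewrite mulN1r.
rewrite -(cvg_lim _ c1)// -(cvg_lim _ c2)//; apply: lim_series_ler.
- by move=> j; have := H j; rewrite ler_norml !mulN1r => /andP[].
- by apply/cvg_ex; eexists; exact: c1.
- by apply/cvg_ex; eexists; exact: c2.
Qed.

Lemma moment_continuous k x : 0 < x -> {for x, continuous (moment k)}.
Proof.
move=> x0; have x20 : 0 < x / 2 by rewrite divr_gt0.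
have M1 : 0 < moment k.+1 (x / 2) + 1 by rewrite ltr_wpDl// moment_ge0.
apply/cvgrPdist_le => e e0; near=> y.
have xy : `|x - y| <= x / 2 by near: y; apply: cvgr_dist_le.
have xy2 : `|x - y| <= e / (moment k.+1 (x / 2) + 1).
  by near: y; apply: cvgr_dist_le => //; rewrite divr_gt0.
apply: (le_trans (@moment_lipschitz (x / 2) x y k _ _ _)) => //.
- by move: x0; lra.
- by move: xy; rewrite ler_norml => /andP[]; lra.
apply: (@le_trans _ _ (`|x - y| * (moment k.+1 (x / 2) + 1))).
  by rewrite ler_wpM2l// lerDl.
by rewrite -ler_pdivlMr.
Unshelve. all: by end_near. Qed.

Definition emean (beta : R) : R := moment 1 beta / moment 0 beta.
Definition evar (beta : R) : R := moment 2 beta / moment 0 beta - emean beta ^+ 2.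

Lemma emean_continuous x : 0 < x -> {for x, continuous emean}.
Proof.
move=> x0; apply: cvgM; first exact: moment_continuous.
apply: cvgV; last exact: moment_continuous.
by rewrite gt_eqF// moment0_gt0.
Qed.

Lemma evar_continuous x : 0 < x -> {for x, continuous evar}.
Proof.
move=> x0; apply: cvgB.
  apply: cvgM; first exact: moment_continuous.
  apply: cvgV; last exact: moment_continuous.
  by rewrite gt_eqF// moment0_gt0.
rewrite expr2; under eq_fun do rewrite expr2.
by apply: cvgM; exact: emean_continuous.
Qed.

Lemma emean_ge0 x : 0 < x -> 0 <= emean x.
Proof. by move=> x0; rewrite divr_ge0 ?moment_ge0. Qed.

Lemma sqr_dev_cvg x : 0 < x ->
  series (fun j => expR (- x * h j) * (h j - emean x) ^+ 2) @ \oo --> moment 0 x * evar x.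
Proof.
move=> x0; set m := emean x.
have -> : (fun j => expR (- x * h j) * (h j - m) ^+ 2) =
  (fun j => boltz x 2 j + (- (2 * m) * boltz x 1 j + m ^+ 2 * boltz x 0 j)).
  by apply/funext => j; rewrite /boltz expr0 expr1; ring.
have -> : moment 0 x * evar x = moment 2 x + (- (2 * m) * moment 1 x + m ^+ 2 * moment 0 x).
  by rewrite /evar /m /emean; field; rewrite gt_eqF// moment0_gt0.
apply: seriesD_cvg; first exact: moment_cvg.
by apply: seriesD_cvg; apply: seriesZ_cvg; exact: moment_cvg.
Qed.

Lemma evar_gt0 x : 0 < x -> 0 < evar x.
Proof.
move=> x0; rewrite -(pmulr_rgt0 _ (moment0_gt0 x0)).
have c := sqr_dev_cvg x0.
have [j hj] := h_nonconst (emean x).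
apply: (@lt_le_trans _ _ (expR (- x * h j) * (h j - emean x) ^+ 2)).
  by rewrite mulr_gt0 ?expR_gt0// exprn_even_gt0//= subr_eq0.
rewrite -(cvg_lim _ c)//.
apply: (@term_le_lim _ (fun j => expR (- x * h j) * (h j - emean x) ^+ 2)).
  by move=> i; rewrite mulr_ge0 ?expR_ge0 ?sqr_ge0.
by apply/cvg_ex; eexists; exact: c.
Qed.

(* e^x > 1 + x for x <> 0, applied to x = - (theta - beta) (h - m). *)
Lemma moment0_tangent theta beta : 0 < theta -> 0 < beta -> theta != beta ->
  moment 0 beta * expR (- ((theta - beta) * emean beta)) < moment 0 theta.
Proof.
move=> t0 b0 tb; set m := emean beta; set D := theta - beta.
pose v j := expR (- (D * m)) * ((1 + D * m) * boltz beta 0 j + - D * boltz beta 1 j).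
have cv : series v @ \oo --> moment 0 beta * expR (- (D * m)).
  have -> : moment 0 beta * expR (- (D * m)) =
    expR (- (D * m)) * ((1 + D * m) * moment 0 beta + - D * moment 1 beta).
    rewrite (_ : moment 1 beta = m * moment 0 beta); last first.
      by rewrite /m /emean divfK// gt_eqF// moment0_gt0.
    by ring.
  by apply: seriesZ_cvg; apply: seriesD_cvg; apply: seriesZ_cvg; exact: moment_cvg.
pose w j := boltz theta 0 j + - 1 * v j.
have cw : series w @ \oo --> moment 0 theta + - 1 * (moment 0 beta * expR (- (D * m))).
  by apply: seriesD_cvg; [exact: moment_cvg|apply: seriesZ_cvg].
have wE j : w j = expR (- beta * h j - D * m) * (expR (- (D * (h j - m))) - (1 + - (D * (h j - m)))).
  rewrite /w /v /boltz !expr0 expr1 !mul1r mulrBr -expRD.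
  have -> : - beta * h j - D * m + - (D * (h j - m)) = - theta * h j by rewrite /D; ring.
  by rewrite expRD; ring.
have w0 j : 0 <= w j by rewrite wE mulr_ge0 ?expR_ge0// subr_ge0 expR_ge1Dx.
have [j hj] := h_nonconst m.
have : 0 < limn (series w).
  apply: (@lt_le_trans _ _ (w j)); last first.
    by apply: term_le_lim => //; apply/cvg_ex; eexists; exact: cw.
  rewrite wE mulr_gt0 ?expR_gt0// subr_gt0 expR_gt1Dx//.
  by rewrite oppr_eq0 mulf_neq0 ?subr_eq0.
by rewrite (cvg_lim _ cw)// mulN1r subr_gt0.
Qed.

Definition epsi (beta : R) : R := ln (moment 0 beta).

(** Strict convexity of log Z in tangent-line form, with slope [- emean beta]. Monotonicity and
    surjectivity of the mean energy and the variational formula for the entropy all rest on it. *)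
Lemma epsi_tangent theta beta : 0 < theta -> 0 < beta -> theta != beta ->
  epsi beta - (theta - beta) * emean beta < epsi theta.
Proof.
move=> t0 b0 tb; have := moment0_tangent t0 b0 tb.
have Zb := moment0_gt0 b0; have Zt := moment0_gt0 t0.
rewrite -ltr_ln ?posrE ?mulr_gt0 ?expR_gt0//.
by rewrite lnM ?posrE ?expR_gt0// expRK.
Qed.

Lemma epsi_ge0 beta : 0 < beta -> 0 <= epsi beta.
Proof. by move=> b0; rewrite /epsi ln_ge0// moment0_ge1. Qed.

Lemma emean_decr x y : 0 < x -> x < y -> emean y < emean x.
Proof.
move=> x0 xy; have y0 : 0 < y by exact: lt_trans xy.
have yx : y != x by rewrite gt_eqF. have xy' : x != y by rewrite lt_eqF.
have := epsi_tangent y0 x0 yx; have := epsi_tangent x0 y0 xy'.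
have yx0 : 0 < y - x by rewrite subr_gt0.
move=> h1 h2; rewrite -(ltr_pM2l yx0); lra.
Qed.

Lemma emean_surj u : 0 < u -> exists2 beta, 0 < beta & emean beta = u.
Proof.
move=> u0.
have psi1 := epsi_ge0 (@ltr01 R).
(* The tangent at [theta], evaluated at 1, gives (theta - 1) emean theta <= epsi 1, while (theta -
   1) u = u + epsi 1. *)
pose theta := 2 + epsi 1 / u.
have q0 : 0 <= epsi 1 / u by rewrite divr_ge0// ltW.
have t0 : 0 < theta by rewrite /theta; lra.
have lo : emean theta <= u.
  have t1 : (1 : R) != theta by rewrite lt_eqF// /theta; lra.
  have := epsi_tangent (@ltr01 R) t0 t1; have := epsi_ge0 t0 => h1 h2.
  have h3 : (theta - 1) * emean theta <= epsi 1 by lra.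
  have t10 : 0 < theta - 1 by rewrite /theta; lra.
  rewrite -(ler_pM2l t10); apply: (le_trans h3).
  rewrite /theta (_ : (2 + epsi 1 / u - 1) * u = u + epsi 1); last by field; rewrite gt_eqF.
  by rewrite lerDr ltW.
near \oo => n.
have nbig : 2 * (moment 0 1 * expR u) <= n%:R by near: n; exact: nbhs_infty_ger.
pose S := \sum_(j < n) h j.
have S0 : 0 <= S by rewrite sumr_ge0.
(* So small that each of the first [n] weights is at least 1/2, hence Z(b) >= n/2. The tangent at
   [b], evaluated at 1, then forces (1 - b) emean b >= epsi b - epsi 1 >= u. *)
pose b := (2 * (1 + S))^-1.
have S1 : 0 < 2 * (1 + S) by lra.
have b0 : 0 < b by rewrite invr_gt0.
have b2 : b <= 2^-1 by rewrite lef_pV2 ?posrE//; lra.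
have hi : u <= emean b.
  have Zb : n%:R / 2 <= moment 0 b.
    apply: (le_trans _ (psum_le_lim n (boltz_ge0 b 0) (cvg_boltz (k := 0) b0))).
    have -> : n%:R / 2 = \sum_(j < n) (2^-1 : R) by rewrite sumr_const card_ord mulr_natl.
    apply: ler_sum => j _; rewrite /boltz expr0 mul1r.
    have hS : h j <= S by rewrite /S (bigD1 j)//= lerDl sumr_ge0.
    have bS : b * (1 + S) = 2^-1 by rewrite /b; field; rewrite gt_eqF//; lra.
    have bh : b * h j <= b * (1 + S) by rewrite ler_wpM2l ?(ltW b0)//; lra.
    have := expR_ge1Dx (- b * h j); rewrite mulNr; lra.
  have b1 : (1 : R) != b by rewrite gt_eqF//; lra.
  have := epsi_tangent (@ltr01 R) b0 b1.
  have : u + epsi 1 <= epsi b.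
    have -> : u + epsi 1 = ln (moment 0 1 * expR u).
      by rewrite lnM ?posrE ?expR_gt0 ?moment0_gt0// expRK addrC.
    rewrite ler_ln ?posrE ?mulr_gt0 ?expR_gt0 ?moment0_gt0//.
    by apply: le_trans Zb; lra.
  have := emean_ge0 b0; nra.
have bt : b <= theta by rewrite /theta; lra.
have [||c + <-] := @IVT R emean b theta u bt.
- apply: continuous_in_subspaceT => x; rewrite inE/= in_itv/= => /andP[bx _].
  by apply: emean_continuous; exact: lt_le_trans bx.
- by rewrite ge_min lo orbT le_max hi.
by rewrite in_itv/= => /andP[bc _]; exists c => //; exact: lt_le_trans bc.
Unshelve. all: by end_near. Qed.

End moments.

(** * The tilted local limit theorem *)

Section charf_near_zero.
Variables (R : realType) (n : nat) (p h : nat -> R) (m s M tau : R).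
Hypothesis p0 : forall j, 0 <= p j.
Hypothesis tail0 : `|\sum_(j < n) p j - 1| <= tau.
Hypothesis tail1 : `|\sum_(j < n) p j * (h j - m)| <= tau.
Hypothesis tail2 : `|\sum_(j < n) p j * (h j - m) ^+ 2 - s| <= tau.
Hypothesis fourth : \sum_(j < n) p j * (h j - m) ^+ 4 <= M.
Hypothesis mass1 : \sum_(j < n) p j <= 1.
Hypothesis s0 : 0 <= s.

(** Real part: cosine to second order, with errors [tau] from mass and variance. Imaginary part:
    sine to first order, with error [tau] from the mean; its cubic remainder is reduced to the
    fourth moment by |y|^3 <= 1 + y^4. Finally t^4 <= t^3. *)
Lemma charf_near_zero t : 0 <= t <= 1 ->
  normc (charf n p h m t - Complex (expR (- (s * t ^+ 2 / 2))) 0) <=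
  (1 + 2 * M + s ^+ 2) * t ^+ 3 + 3 * tau.
Proof.
move=> /andP[t0 t1].
have tau0 : 0 <= tau by apply: le_trans tail0.
have M0 : 0 <= M.
  apply: le_trans fourth; apply: sumr_ge0 => j _; rewrite mulr_ge0//.
  by rewrite exprn_even_ge0.
have t3 : 0 <= t ^+ 3 by rewrite exprn_ge0.
have t43 : t ^+ 4 <= t ^+ 3 by rewrite exprS ler_piMl.
have t2 : 0 <= t ^+ 2 by rewrite exprn_ge0.
have t21 : t ^+ 2 <= 1 by rewrite expr_le1.
set w := expR _.
apply: (le_trans (normc_le_ReIm _)).
have -> : complex.Re (charf n p h m t - Complex w 0) = \sum_(j < n) p j * cos (t * (h j - m)) - w.
  rewrite ReD /charf Re_sum; congr (_ - _).
  by apply: eq_bigr => j _; rewrite Re_realM.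
have -> : complex.Im (charf n p h m t - Complex w 0) = \sum_(j < n) p j * sin (t * (h j - m)).
  rewrite ImD /charf Im_sum [complex.Im (- _)](_ : _ = 0) ?addr0; last by rewrite /= oppr0.
  by apply: eq_bigr => j _; rewrite Im_realM.
have wE : `|w - (1 - s * t ^+ 2 / 2)| <= s ^+ 2 * t ^+ 3.
  have st0 : 0 <= s * t ^+ 2 / 2 by rewrite divr_ge0 ?mulr_ge0.
  apply: (le_trans (expRN_taylor st0)).
  have -> : (s * t ^+ 2 / 2) ^+ 2 = s ^+ 2 * t ^+ 4 / 4 by field.
  have := ler_wpM2l (sqr_ge0 s) t43.
  have := mulr_ge0 (sqr_ge0 s) t3; lra.
have hre : `|\sum_(j < n) p j * cos (t * (h j - m)) - w| <= (M + s ^+ 2) * t ^+ 3 + 2 * tau.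
  have -> : \sum_(j < n) p j * cos (t * (h j - m)) - w =
     \sum_(j < n) p j * (cos (t * (h j - m)) - (1 - (t * (h j - m)) ^+ 2 / 2)) +
     (\sum_(j < n) p j - 1) - t ^+ 2 / 2 * (\sum_(j < n) p j * (h j - m) ^+ 2 - s)
      - (w - (1 - s * t ^+ 2 / 2)).
    have -> : \sum_(j < n) p j * (cos (t * (h j - m)) - (1 - (t * (h j - m)) ^+ 2 / 2)) =
      \sum_(j < n) p j * cos (t * (h j - m)) - \sum_(j < n) p j + t ^+ 2 / 2 * \sum_(j < n) p j * (h j - m) ^+ 2.
      rewrite mulr_sumr -sumrB -big_split/=; by apply: eq_bigr => j _; field.
    by field.
  have a1 : `|\sum_(j < n) p j * (cos (t * (h j - m)) - (1 - (t * (h j - m)) ^+ 2 / 2))| <= M * t ^+ 3.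
    apply: (le_trans (ler_norm_sum _ _ _)).
    apply: (@le_trans _ _ (t ^+ 4 * \sum_(j < n) p j * (h j - m) ^+ 4)).
      rewrite mulr_sumr; apply: ler_sum => j _; rewrite normrM ger0_norm//.
      rewrite mulrCA -exprMn ler_wpM2l//; exact: normr_cos_taylor.
    rewrite mulrC; apply: ler_pM => //.
      by apply: sumr_ge0 => j _; rewrite mulr_ge0// exprn_even_ge0.
    by rewrite exprn_ge0.
  have a2 : `|t ^+ 2 / 2 * (\sum_(j < n) p j * (h j - m) ^+ 2 - s)| <= tau.
    rewrite normrM ger0_norm ?divr_ge0//.
    apply: (le_trans (ler_wpM2l _ tail2)); first by rewrite divr_ge0.
    by rewrite ler_piMl//; lra.
  apply: (@le_trans _ _ (M * t ^+ 3 + tau + tau + s ^+ 2 * t ^+ 3)); last first.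
    by rewrite le_eqVlt; apply/orP; left; apply/eqP; ring.
  apply: (le_trans (ler_normB _ _)); apply: lerD; last exact: wE.
  apply: (le_trans (ler_normB _ _)); apply: lerD; last exact: a2.
  by apply: (le_trans (ler_normD _ _)); apply: lerD; [exact: a1|exact: tail0].
have him : `|\sum_(j < n) p j * sin (t * (h j - m))| <= (1 + M) * t ^+ 3 + tau.
  have -> : \sum_(j < n) p j * sin (t * (h j - m)) =
     \sum_(j < n) p j * (sin (t * (h j - m)) - t * (h j - m)) + t * \sum_(j < n) p j * (h j - m).
    by rewrite mulr_sumr -big_split/=; apply: eq_bigr => j _; ring.
  apply: (le_trans (ler_normD _ _)); apply: lerD; last first.
    by rewrite normrM ger0_norm//; apply: (le_trans _ tail1); rewrite ler_piMl.
  apply: (le_trans (ler_norm_sum _ _ _)).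
  apply: (@le_trans _ _ (t ^+ 3 * \sum_(j < n) (p j + p j * (h j - m) ^+ 4))).
    rewrite mulr_sumr; apply: ler_sum => j _; rewrite normrM ger0_norm//.
    apply: (le_trans (ler_wpM2l (p0 j) (normr_sin_sub_id _))).
    rewrite normrM (ger0_norm t0) exprMn mulrCA ler_wpM2l//.
    have -> : p j + p j * (h j - m) ^+ 4 = p j * (1 + (h j - m) ^+ 4) by ring.
    rewrite ler_wpM2l//.
    have -> : (h j - m) ^+ 4 = `|h j - m| ^+ 4.
      by rewrite -normrX ger0_norm// exprn_even_ge0.
    have y0 := normr_ge0 (h j - m); move: y0; move: `|_| => y y0.
    case/orP: (le_total y 1) => y1.
      have := exprn_ge0 4 y0; have : y ^+ 3 <= 1 by rewrite expr_le1.
      lra.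
    have : y ^+ 3 <= y ^+ 4 by rewrite [leRHS]exprS ler_peMl ?exprn_ge0.
    lra.
  rewrite mulrC big_split/= ler_wpM2r//; apply: lerD; [exact: mass1|exact: fourth].
apply: (le_trans (lerD hre him)).
rewrite le_eqVlt; apply/orP; left; apply/eqP; ring.
Qed.

End charf_near_zero.

(** The squared modulus is a^2 + b^2 + 2ab cos(y - x). Taking [b] as the smaller weight makes the
    loss linear in [b], with no square root left. *)
Lemma normc_two_phases (R : realType) (a b x y : R) : 0 <= b -> b <= a ->
  normc (Complex a 0 * cis x + Complex b 0 * cis y) <= a + b - b * (1 - cos (y - x)) / 2.
Proof.
move=> b0 ba; have a0 : 0 <= a by exact: le_trans ba.
have q1 := cos_le1 (y - x); have q2 := cos_geN1 (y - x).
have r0 : 0 <= a + b - b * (1 - cos (y - x)) / 2 by nra.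
rewrite /= !mul0r !subr0 !addr0 -(ger0_norm r0) -sqrtr_sqr ler_sqrt ?sqr_ge0//.
have -> : (a * cos x + b * cos y) ^+ 2 + (a * sin x + b * sin y) ^+ 2 =
  a ^+ 2 * (cos x ^+ 2 + sin x ^+ 2) + b ^+ 2 * (cos y ^+ 2 + sin y ^+ 2) +
  2 * a * b * (cos y * cos x + sin y * sin x) by ring.
rewrite !cos2Dsin2 -cosB; move: q1 q2; move: (cos (y - x)) => c q1 q2.
rewrite -subr_ge0.
have -> : (a + b - b * (1 - c) / 2) ^+ 2 - (a ^+ 2 * 1 + b ^+ 2 * 1 + 2 * a * b * c) =
  (1 - c) * b * (a - b + b * (1 - c) / 4) by field.
apply: mulr_ge0; first by rewrite mulr_ge0// subr_ge0.
by rewrite addr_ge0 ?subr_ge0// divr_ge0// mulr_ge0// subr_ge0.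
Qed.

(** Only the phases of level [k] and of the zero-energy level [i] are compared; every other term is
    bounded by its weight. *)
Lemma normc_charf_le (R : realType) (n : nat) (p h : nat -> R) (m t : R) (i k : 'I_n) :
  (forall j, 0 <= p j) -> \sum_(j < n) p j <= 1 -> h i = 0 -> p k <= p i ->
  normc (charf n p h m t) <= 1 - p k * (1 - cos (t * h k)) / 2.
Proof.
move=> p0 p1 hi pki.
have nt (j : 'I_n) : normc (Complex (p j) 0 * cis (t * (h j - m))) = p j.
  by rewrite normcM normc_cis mulr1 normc_real ger0_norm.
have [ik|ik] := eqVneq k i.
  rewrite ik hi mulr0 cos0 subrr mulr0 mul0r subr0.
  apply: (le_trans (normc_sum _ _)); apply: le_trans p1.
  by apply: ler_sum => j _; rewrite nt.
rewrite /charf (bigD1 i)//= (bigD1 k)//= addrA.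
apply: (le_trans (le_normcD _ _)).
have h1 := normc_two_phases (t * (h i - m)) (t * (h k - m)) (p0 k) pki.
have -> : t * h k = t * (h k - m) - t * (h i - m) by rewrite hi; ring.
have h2 : normc (\sum_(j < n | (j != i) && (j != k)) Complex (p j) 0 * cis (t * (h j - m))) <=
  \sum_(j < n | (j != i) && (j != k)) p j.
  rewrite -big_filter -[X in _ <= X]big_filter.
  by apply: (le_trans (normc_sum _ _)); apply: ler_sum => j _; rewrite nt.
apply: (le_trans (lerD h1 h2)).
move: p1; rewrite (bigD1 i)//= (bigD1 k)//=; lra.
Qed.

(** After removal of whole periods the remainder r lies in [0, 2 pi) and sin(r/2) = 0 with r/2 in
    [0, pi), so r = 0. *)
Lemma cos_eq1_nat (R : realType) (x : R) : 0 <= x -> cos x = 1 ->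
  exists k : nat, x = k%:R * (pi *+ 2).
Proof.
move=> x0 cx; have pi2 : 0 < pi *+ 2 :> R by rewrite mulrn_wgt0// pi_gt0.
pose k := Num.truncn (x / (pi *+ 2)); exists k.
have xp0 : 0 <= x / (pi *+ 2) by rewrite divr_ge0// ltW.
have /andP[k1 k2] := Num.Theory.truncn_itv xp0.
rewrite -/k ler_pdivlMr// ltr_pdivrMr// in k1 k2.
have r0 : 0 <= x - k%:R * (pi *+ 2) by rewrite subr_ge0.
set r := x - _ in r0.
have rp : r / 2 < pi.
  by rewrite /r; move: k2; rewrite -natr1 mulrDl mul1r mulr2n; lra.
have cr : cos r = 1.
  have := periodicn (@cosD2pi R) k r.
  rewrite -cx => <-; congr cos.
  by rewrite -[pi *+ 2 *+ k]mulr_natl /r subrK.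
have : sin (r / 2) = 0.
  have : cos (r / 2 *+ 2) = 1 by rewrite -mulr_natr divfK.
  rewrite cos_mulr2n => h; have := cos2Dsin2 (r / 2).
  have -> : cos (r / 2) ^+ 2 = 1 by move: h; rewrite mulr2n; lra.
  move=> h2; have /eqP : sin (r / 2) ^+ 2 = 0 by lra.
  by rewrite sqrf_eq0 => /eqP.
move=> sr; apply/eqP; rewrite -subr_eq0 -/r; apply: contraT => rn0.
have rpos : 0 < r by rewrite lt_neqAle eq_sym rn0.
by have := @sin_gt0_pi R (r / 2); rewrite sr ltxx => H; apply: H; rewrite divr_gt0.
Qed.

Lemma continuous_cvgn (R : realType) (f : R -> R) (u : nat -> R) (l : R) :
  {for l, continuous f} -> u @ \oo --> l -> (fun n => f (u n)) @ \oo --> f l.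
Proof. by move=> cf ul; apply: continuous_cvg. Qed.

Lemma near_le_of_cvg_lt (R : realType) (u : nat -> R) (l M : R) :
  u @ \oo --> l -> l < M -> \forall n \near \oo, u n <= M.
Proof. by move=> ul lM; near=> n; apply: ltW; near: n; exact: (cvgr_lt l).
Unshelve. all: by end_near. Qed.

Lemma near_ge_of_cvg_gt (R : realType) (u : nat -> R) (l M : R) :
  u @ \oo --> l -> M < l -> \forall n \near \oo, M <= u n.
Proof. by move=> ul lM; near=> n; apply: ltW; near: n; exact: (cvgr_gt l).
Unshelve. all: by end_near. Qed.

Lemma series_ord (R : realType) (u : nat -> R) n : series u n = \sum_(j < n) u j.
Proof. by rewrite /series/= big_mkord. Qed.

Lemma ler_lim_norm (R : realType) (u v : nat -> R) (l l' : R) :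
  (forall j, `|u j| <= v j) -> series u @ \oo --> l -> series v @ \oo --> l' ->
  `|l| <= l'.
Proof.
move=> uv ul vl; have cu : cvgn (series u) by apply/cvg_ex; exists l.
have cv : cvgn (series v) by apply/cvg_ex; exists l'.
rewrite ler_norml -(cvg_lim _ ul)// -(cvg_lim _ vl)//; apply/andP; split.
  have c := seriesZ_cvg (c := - 1) vl.
  rewrite (cvg_lim _ vl)// -mulN1r -(cvg_lim _ c)//; apply: lim_series_ler => //.
    by move=> j; have := uv j; rewrite ler_norml mulN1r => /andP[].
  by apply/cvg_ex; eexists; exact: c.
by apply: lim_series_ler => // j; have := uv j; rewrite ler_norml => /andP[].
Qed.

Section local_limit_theorem.
Variables (R : realType) (h : nat -> R) (j0 : nat).
Hypothesis h0 : forall j, 0 <= h j.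
Hypothesis hj0 : h j0 = 0.
Hypothesis summable_h : forall beta, 0 < beta -> cvgn (series (fun j => expR (- beta * h j))).
Hypothesis h_spread : forall t : R, 0 < t -> exists j, cos (t * h j) != 1.

Notation moment := (moment h).
Notation emean := (emean h).
Notation evar := (evar h).

Lemma spread_nonconst (m : R) : exists j, h j != m.
Proof.
have [->|m0] := eqVneq m 0.
  have [j hj] := h_spread (@ltr01 R); exists j.
  by apply: contraNneq hj => ->; rewrite mulr0 cos0.
by exists j0; rewrite hj0 eq_sym.
Qed.

Definition gweight (beta : R) (j : nat) : R := expR (- beta * h j) / moment 0 beta.

Lemma gweight_ge0 beta j : 0 < beta -> 0 <= gweight beta j.
Proof. by move=> b0; rewrite divr_ge0 ?expR_ge0// moment_ge0. Qed.

Lemma gweight_le1 beta n : 0 < beta -> \sum_(j < n) gweight beta j <= 1.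
Proof.
move=> b0; have Z0 := moment0_gt0 h0 hj0 summable_h b0.
rewrite -mulr_suml ler_pdivrMr// mul1r.
have := psum_le_lim n (boltz_ge0 h0 beta 0) (cvg_boltz h0 summable_h (k := 0) b0).
by apply: le_trans; apply: ler_sum => j _; rewrite /boltz expr0 mul1r.
Qed.

Lemma gweight_moment_cvg beta k : 0 < beta ->
  series (fun j => gweight beta j * h j ^+ k) @ \oo --> moment k beta / moment 0 beta.
Proof.
move=> b0; have -> : (fun j => gweight beta j * h j ^+ k) =
    (fun j => (moment 0 beta)^-1 * boltz h beta k j).
  by apply/funext => j; rewrite /gweight /boltz; ring.
by rewrite mulrC; apply: seriesZ_cvg; exact: moment_cvg.
Qed.

Lemma gweight_tails beta tau : 0 < beta -> 0 < tau -> \forall n \near \oo,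
  [/\ `|\sum_(j < n) gweight beta j - 1| <= tau,
      `|\sum_(j < n) gweight beta j * (h j - emean beta)| <= tau &
      `|\sum_(j < n) gweight beta j * (h j - emean beta) ^+ 2 - evar beta| <= tau].
Proof.
move=> b0 tau0; have Z0 := moment0_gt0 h0 hj0 summable_h b0.
have m0 := gweight_moment_cvg (k := 0) b0; have m1 := gweight_moment_cvg (k := 1) b0.
have m2 := gweight_moment_cvg (k := 2) b0.
set m := emean beta.
have c0 : series (gweight beta) @ \oo --> (1 : R).
  rewrite -[X in _ --> X](divff (lt0r_neq0 Z0)).
  have -> : gweight beta = (fun j => gweight beta j * h j ^+ 0) by apply/funext => j; rewrite expr0 mulr1.
  exact: m0.
have c1 : series (fun j => gweight beta j * (h j - m)) @ \oo --> (0 : R).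
  have -> : (fun j => gweight beta j * (h j - m)) =
     (fun j => gweight beta j * h j ^+ 1 + - m * gweight beta j).
    by apply/funext => j; rewrite expr1; ring.
  have -> : 0 = moment 1 beta / moment 0 beta + - m * 1 by rewrite /m /emean; ring.
  by apply: seriesD_cvg => //; exact: seriesZ_cvg.
have c2 : series (fun j => gweight beta j * (h j - m) ^+ 2) @ \oo --> evar beta.
  have -> : (fun j => gweight beta j * (h j - m) ^+ 2) =
     (fun j => gweight beta j * h j ^+ 2 + (- (2 * m) * (gweight beta j * h j ^+ 1) + m ^+ 2 * gweight beta j)).
    by apply/funext => j; rewrite expr1; ring.
  have -> : evar beta = moment 2 beta / moment 0 beta +
      (- (2 * m) * (moment 1 beta / moment 0 beta) + m ^+ 2 * 1).
    by rewrite /evar -/m -[_ 1%N _ / _]/m; ring.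
  by apply: seriesD_cvg => //; apply: seriesD_cvg; exact: seriesZ_cvg.
near=> n; rewrite -(series_ord (gweight beta)).
rewrite -(series_ord (fun j => gweight beta j * (h j - m))).
rewrite -(series_ord (fun j => gweight beta j * (h j - m) ^+ 2)); split.
- by rewrite distrC; near: n; exact: near_dist_le c0 tau0.
- rewrite -[X in `|X|]subr0 distrC; near: n; exact: near_dist_le c1 tau0.
- by rewrite distrC; near: n; exact: near_dist_le c2 tau0.
Unshelve. all: by end_near. Qed.

(** From (x - y)^4 <= 8 (x^4 + y^4). Unlike the truncated central moment it does not depend on the
    cutoff, and it is continuous in [beta]. *)
Definition fourth_bound (beta : R) : R :=
  8 * (moment 4 beta / moment 0 beta + emean beta ^+ 4).

Lemma fourth_bound_continuous beta : 0 < beta -> {for beta, continuous fourth_bound}.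
Proof.
move=> b0; apply: cvgM; first exact: cvg_cst.
apply: cvgD.
  apply: cvgM; first exact: moment_continuous.
  apply: cvgV; last exact: moment_continuous.
  by rewrite gt_eqF// (moment0_gt0 h0 hj0).
have c : {for beta, continuous emean} by apply: (emean_continuous h0 hj0).
have -> : (fun x => emean x ^+ 4) = (fun x => emean x * emean x * (emean x * emean x)).
  by apply/funext => x; ring.
have -> : emean beta ^+ 4 = emean beta * emean beta * (emean beta * emean beta) by ring.
by apply: cvgM; apply: cvgM.
Qed.

Lemma gweight_fourth beta n : 0 < beta ->
  \sum_(j < n) gweight beta j * (h j - emean beta) ^+ 4 <= fourth_bound beta.
Proof.
move=> b0; have Z0 := moment0_gt0 h0 hj0 summable_h b0.
set m := emean beta.
have m4 := gweight_moment_cvg (k := 4) b0.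
have e1 : \sum_(j < n) gweight beta j * h j ^+ 4 <= moment 4 beta / moment 0 beta.
  rewrite -[leRHS](cvg_lim _ m4)//.
  apply: (@psum_le_lim _ (fun j => gweight beta j * h j ^+ 4)).
    by move=> j; rewrite mulr_ge0 ?gweight_ge0 ?exprn_ge0.
  by apply/cvg_ex; eexists; exact: m4.
have e2 := gweight_le1 n b0.
apply: (@le_trans _ _ (8 * (\sum_(j < n) gweight beta j * h j ^+ 4 + m ^+ 4 * \sum_(j < n) gweight beta j))).
  rewrite mulr_sumr -big_split/= mulr_sumr; apply: ler_sum => j _.
  have -> : 8 * (gweight beta j * h j ^+ 4 + m ^+ 4 * gweight beta j) =
    gweight beta j * (8 * (h j ^+ 4 + m ^+ 4)) by ring.
  rewrite ler_wpM2l ?gweight_ge0//.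
  move: (h j) m => x y; rewrite -subr_ge0.
  have -> : 8 * (x ^+ 4 + y ^+ 4) - (x - y) ^+ 4 =
    4 * (x ^+ 2 - y ^+ 2) ^+ 2 + (x + y) ^+ 2 * (2 * (x ^+ 2 + y ^+ 2) + (x - y) ^+ 2) by ring.
  exact: (addr_ge0 (mulr_ge0 (ler0n R 4) (sqr_ge0 _)) (mulr_ge0 (sqr_ge0 _)
    (addr_ge0 (mulr_ge0 (ler0n R 2) (addr_ge0 (sqr_ge0 _) (sqr_ge0 _))) (sqr_ge0 _)))).
rewrite /fourth_bound ler_wpM2l//; apply: lerD => //.
by rewrite ler_piMr// exprn_even_ge0.
Qed.

(* The nonlattice condition makes [D t = \sum_j e^{- beta h_j} (1 - cos (t h_j))]
   positive for [t > 0]; it is Lipschitz, hence bounded below on [[delta, T]],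
   and the tail of the series is uniformly small. *)
Lemma spread_uniform (beta delta T : R) : 0 < beta -> 0 < delta ->
  exists2 kap : R, 0 < kap & exists n1 : nat, forall t, delta <= t <= T ->
    kap <= \sum_(j < n1) expR (- beta * h j) * (1 - cos (t * h j)).
Proof.
move=> b0 d0.
case: (leP delta T) => [dT|Td]; last first.
  exists 1 => //; exists 0%N => t /andP[dt tT].
  by have := lt_le_trans Td (le_trans dt tT); rewrite ltxx.
pose term t j := expR (- beta * h j) * (1 - cos (t * h j)).
have term0 t j : 0 <= term t j by rewrite mulr_ge0 ?expR_ge0// subr_ge0 cos_le1.
have term2 t j : term t j <= 2 * boltz h beta 0 j.
  rewrite /term /boltz expr0 mul1r [leLHS]mulrC ler_wpM2r ?expR_ge0//.
  by have := cos_geN1 (t * h j); lra.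
have cb := @moment_cvg R h h0 summable_h beta 0 b0.
have c2b := seriesZ_cvg (c := 2) cb.
have ct t : cvgn (series (term t)).
  by apply: (series_domination (term0 t) (term2 t)); apply/cvg_ex; eexists; exact: c2b.
pose D t := limn (series (term t)).
have lip x y : `|D x - D y| <= `|x - y| * moment 1 beta.
  have c1 : series (fun j => term x j + - 1 * term y j) @ \oo --> D x + - 1 * D y.
    by apply: seriesD_cvg; [exact: ct|apply: seriesZ_cvg; exact: ct].
  have c3 := seriesZ_cvg (c := `|x - y|) (@moment_cvg R h h0 summable_h beta 1 b0).
  rewrite -[D x - D y](_ : D x + - 1 * D y = _); last by rewrite mulN1r.
  apply: (ler_lim_norm _ c1 c3) => j.
  rewrite /term mulN1r -mulrBr normrM (ger0_norm (expR_ge0 _)) /boltz expr1.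
  have -> : 1 - cos (x * h j) - (1 - cos (y * h j)) = cos (y * h j) - cos (x * h j) by ring.
  rewrite mulrA mulrC ler_wpM2r ?expR_ge0//.
  apply: (le_trans (cos_lipschitz _ _)).
  by rewrite -mulrBl normrM distrC (ger0_norm (h0 j)).
have cD : continuous D.
  have M1 : 0 < moment 1 beta + 1 by rewrite ltr_wpDl// moment_ge0.
  move=> x; apply/cvgrPdist_le => e e0; near=> y.
  apply: (le_trans (lip x y)).
  apply: (@le_trans _ _ (`|x - y| * (moment 1 beta + 1))); first by rewrite ler_wpM2l// lerDl.
  rewrite -ler_pdivlMr//; near: y; apply: cvgr_dist_le => //.
  by rewrite divr_gt0.
have [t1 + Dmin] := EVT_min dT (continuous_subspaceT cD).
rewrite in_itv/= => /andP[dt1 _].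
have Dpos : 0 < D t1.
  have [j hj] := h_spread (lt_le_trans d0 dt1).
  apply: (lt_le_trans _ (term_le_lim j (term0 t1) (ct t1))).
  by rewrite mulr_gt0 ?expR_gt0// subr_gt0 lt_neqAle hj cos_le1.
exists (D t1 / 2); first by rewrite divr_gt0.
near \oo => n1.
have tail : 2 * moment 0 beta - series (fun j => 2 * boltz h beta 0 j) n1 <= D t1 / 2.
  apply: (le_trans (ler_norm _)); near: n1; apply: near_dist_le c2b _.
  by rewrite divr_gt0.
exists n1 => t tT.
have Dt : D t1 <= D t by apply: Dmin; rewrite in_itv.
have : D t + 1 * (- 1 * \sum_(j < n1) term t j) <= 2 * moment 0 beta + - 1 * \sum_(j < n1) 2 * boltz h beta 0 j.
  pose v j := 2 * boltz h beta 0 j + - 1 * term t j.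
  have cv : series v @ \oo --> 2 * moment 0 beta + - 1 * D t.
    by apply: seriesD_cvg => //; apply: seriesZ_cvg; exact: ct.
  have : \sum_(j < n1) v j <= 2 * moment 0 beta + - 1 * D t.
    rewrite -[leRHS](cvg_lim _ cv)//; apply: psum_le_lim.
      by move=> j; rewrite /v mulN1r subr_ge0.
    by apply/cvg_ex; eexists; exact: cv.
  rewrite /v big_split/= -[X in _ + X]mulr_sumr; lra.
move: tail; rewrite series_ord /term; lra.
Unshelve. all: by end_near. Qed.

End local_limit_theorem.

Lemma positive_functional_iid (R : realType) (n N : nat) (p h : nat -> R) (c e : R) :
  0 <= c -> (forall j, 0 <= p j) ->
  positive_functional (fun g => c * iid_mean n N p h (fun x => g (x - e))).
Proof.
move=> c0 p0; split.
  move=> a g k; rewrite mulrCA -mulrDr; congr (_ * _).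
  by rewrite /iid_mean mulr_sumr -big_split/=; apply: eq_bigr => f _; ring.
move=> g k gk; rewrite ler_wpM2l//; apply: ler_sum => f _.
by rewrite ler_wpM2l// prodr_ge0.
Qed.

Section local_limit_theorem_tilted.
Variables (R : realType) (h : nat -> R) (j0 : nat).
Hypothesis h0 : forall j, 0 <= h j.
Hypothesis hj0 : h j0 = 0.
Hypothesis summable_h : forall beta, 0 < beta -> cvgn (series (fun j => expR (- beta * h j))).
Hypothesis h_spread : forall t : R, 0 < t -> exists j, cos (t * h j) != 1.
Variables (beta_ E : nat -> R) (beta B : R).
Hypothesis beta0 : 0 < beta.
Hypothesis beta_lim : beta_ @ \oo --> beta.
Hypothesis E_close : \forall N \near \oo, `|N%:R * emean h (beta_ N) - E N| <= B.

Lemma near_beta_gt0 : \forall N \near \oo, 0 < beta_ N.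
Proof. exact: (cvgr_gt beta). Qed.

Section cutoff.
Variable n : nat -> nat.
Hypothesis n_ge : forall N, (N <= n N)%N.
Hypothesis n_j0 : forall N, (j0 < n N)%N.
Hypothesis n_tail : forall N, (0 < N)%N -> 0 < beta_ N ->
  [/\ `|\sum_(j < n N) gweight h (beta_ N) j - 1| <= (N%:R ^+ 3)^-1 / 3,
      `|\sum_(j < n N) gweight h (beta_ N) j * (h j - emean h (beta_ N))| <= (N%:R ^+ 3)^-1 / 3 &
      `|\sum_(j < n N) gweight h (beta_ N) j * (h j - emean h (beta_ N)) ^+ 2 - evar h (beta_ N)| <= (N%:R ^+ 3)^-1 / 3].

Let C := 1 + 2 * (fourth_bound h beta + 1) + (evar h beta + 1) ^+ 2.

Let nonconst := spread_nonconst hj0 h_spread.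

Lemma evar_lim : (fun N => evar h (beta_ N)) @ \oo --> evar h beta.
Proof. by apply: continuous_cvgn => //; exact: (evar_continuous h0 hj0). Qed.

(** The three cutoff errors, each a third of N^-3, add up to the last term. [C] is built from the
    values at [beta] increased by 1, which eventually dominate those at [beta_ N]. *)
Lemma tilted_charf_near0 : \forall N \near \oo, forall t, 0 <= t <= 1 ->
  normc (charf (n N) (gweight h (beta_ N)) h (emean h (beta_ N)) t -
    Complex (expR (- (evar h (beta_ N) * t ^+ 2 / 2))) 0) <=
  C * t ^+ 3 + (N%:R ^+ 3)^-1.
Proof.
have fb : (fun N => fourth_bound h (beta_ N)) @ \oo --> fourth_bound h beta.
  by apply: continuous_cvgn => //; exact: (fourth_bound_continuous h0 hj0).
near=> N => t t01.
have N0 : (0 < N)%N by near: N; exact: nbhs_infty_gt.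
have b0 : 0 < beta_ N by near: N; exact: near_beta_gt0.
have f1 : fourth_bound h (beta_ N) <= fourth_bound h beta + 1.
  by near: N; apply: near_le_of_cvg_lt fb _; rewrite ltrDl.
have v1 : evar h (beta_ N) <= evar h beta + 1.
  by near: N; apply: near_le_of_cvg_lt evar_lim _; rewrite ltrDl.
have [T0 T1 T2] := n_tail N0 b0.
have v0 := ltW (evar_gt0 h0 hj0 summable_h nonconst b0).
apply: (le_trans (charf_near_zero (fun j => gweight_ge0 h0 summable_h j b0) T0 T1 T2
  (gweight_fourth h0 hj0 summable_h (n N) b0) (gweight_le1 h0 hj0 summable_h (n N) b0) v0 t01)).
rewrite [3 * _]mulrC divfK// lerD2r; apply: ler_wpM2r.
  by rewrite exprn_ge0//; case/andP: t01.
rewrite /C; have := ler_sqr_normr (_ : `|evar h (beta_ N)| <= evar h beta + 1).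
by rewrite ger0_norm// => /(_ v1); lra.
Unshelve. all: by end_near. Qed.

(** Since beta_N <= 2 beta eventually, each moving weight dominates e^{- 2 beta h_k} / Z with fixed
    [Z]. Summing over k < n1 the bounds on 1 - |charf| given by the single levels brings in the
    lower bound of [spread_uniform]. *)
Lemma tilted_charf_away0 (delta T : R) : 0 < delta ->
  exists2 rho : R, 0 <= rho < 1 & \forall N \near \oo, forall t, delta <= t <= T ->
    normc (charf (n N) (gweight h (beta_ N)) h (emean h (beta_ N)) t) <= rho.
Proof.
move=> d0; have b20 : 0 < 2 * beta by rewrite mulr_gt0.
have [kap kap0 [n1 spread]] := spread_uniform h0 summable_h h_spread T b20 d0.
pose Z := moment h 0 beta + 1.
have Z0 : 0 < Z by rewrite ltr_wpDl// moment_ge0.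
(* The successor keeps the quotient positive when n1 = 0. *)
pose q := kap / (2 * Z * n1.+1%:R).
have q0 : 0 < q by rewrite divr_gt0// !mulr_gt0// ltr0n.
exists (Num.max 0 (1 - q)).
  by rewrite le_max lexx/= gt_max ltr01/= gtrBl.
have Zlim : (fun N => moment h 0 (beta_ N)) @ \oo --> moment h 0 beta.
  by apply: continuous_cvgn => //; exact: (moment_continuous h0).
near=> N => t tT.
have b0 : 0 < beta_ N by near: N; exact: near_beta_gt0.
have b2 : beta_ N <= 2 * beta.
  by near: N; apply: near_le_of_cvg_lt beta_lim _; rewrite mulr_natl mulr2n ltrDl.
have ZN : moment h 0 (beta_ N) <= Z.
  by near: N; apply: near_le_of_cvg_lt Zlim _; rewrite ltrDl.
have nN : (n1 <= n N)%N.
  by apply: leq_trans (n_ge N); near: N; exact: nbhs_infty_ge.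
set z := normc _.
rewrite le_max; apply/orP; right.
pose i := Ordinal (n_j0 N).
have Zb := moment0_gt0 h0 hj0 summable_h b0.
have zle (k : 'I_(n N)) : z <= 1 - gweight h (beta_ N) k * (1 - cos (t * h k)) / 2.
  apply: (normc_charf_le _ _ (i := i)).
  - by move=> j; exact: gweight_ge0.
  - exact: (gweight_le1 h0 hj0).
  - exact: hj0.
  - rewrite /gweight/= ler_wpM2r ?invr_ge0 ?(ltW Zb)// ler_expR hj0 mulr0 mulNr oppr_le0.
    by rewrite mulr_ge0// ltW.
have z1 : z <= 1.
  by have := zle i; rewrite /= hj0 mulr0 cos0 subrr mulr0 mul0r subr0.
have zk (k : 'I_n1) : expR (- (2 * beta) * h k) * (1 - cos (t * h k)) / (2 * Z) <= 1 - z.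
  have := zle (widen_ord nN k); rewrite /= => hz.
  rewrite lerBrDl -lerBrDr; apply: (le_trans hz); rewrite lerD2l lerN2.
  have c0 : 0 <= 1 - cos (t * h k) by rewrite subr_ge0 cos_le1.
  have -> : expR (- (2 * beta) * h k) * (1 - cos (t * h k)) / (2 * Z) =
    expR (- (2 * beta) * h k) / Z * (1 - cos (t * h k)) / 2 by field; rewrite gt_eqF.
  rewrite !ler_wpM2r// /gweight; apply: ler_pM; rewrite ?expR_ge0 ?invr_ge0 ?(ltW Z0)//.
    by rewrite ler_expR ler_wpM2r// lerN2.
  by rewrite lef_pV2 ?posrE.
have : \sum_(k < n1) expR (- (2 * beta) * h k) * (1 - cos (t * h k)) / (2 * Z) <= \sum_(k < n1) (1 - z).
  by apply: ler_sum => k _; exact: zk.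
rewrite -mulr_suml sumr_const card_ord -[leRHS]mulr_natr => hs.
have hs2 : kap / (2 * Z) <= (1 - z) * n1.+1%:R.
  apply: (@le_trans _ _ ((1 - z) * n1%:R)); last first.
    by rewrite ler_wpM2l ?subr_ge0// ler_nat.
  apply: le_trans hs; rewrite ler_wpM2r ?invr_ge0 ?mulr_ge0 ?(ltW Z0)//.
  exact: spread.
have : q <= 1 - z.
  by rewrite /q invfM mulrA ler_pdivrMr ?ltr0n.
lra.
Unshelve. all: by end_near. Qed.

Lemma tilted_local_limit (Delta : R) : 0 < Delta ->
  (fun N => Num.sqrt N%:R * iid_mean (n N) N (gweight h (beta_ N)) h
     (fun x => expR (beta_ N * (x - E N)) * indic_itv 0 Delta (x - E N))) @ \oo -->
  (Num.sqrt (2 * pi * evar h beta))^-1 * ((expR (beta * Delta) - 1) / beta).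
Proof.
move=> D0.
have v0 := evar_gt0 h0 hj0 summable_h nonconst beta0.
have f0 : 0 <= fourth_bound h beta.
  by apply: le_trans (gweight_fourth h0 hj0 summable_h 0 beta0); rewrite big_ord0.
have C0 : 0 <= C.
  by rewrite /C addr_ge0 ?sqr_ge0// addr_ge0// mulr_ge0// addr_ge0.
(* The functional must be positive for every N, hence the truncated weights. *)
pose p N j := if 0 < beta_ N then gweight h (beta_ N) j else 0.
pose nu N (g : R -> R) := Num.sqrt N%:R * iid_mean (n N) N (p N) h (fun x => g (x - E N)).
have nuP N : positive_functional (nu N).
  apply: positive_functional_iid; first exact: sqrtr_ge0.
  by move=> j; rewrite /p; case: ifP => // b0; exact: gweight_ge0.
have pE : \forall N \near \oo, p N = gweight h (beta_ N).
  near=> N; apply/funext => j; rewrite /p ifT//; near: N; exact: near_beta_gt0.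
pose lam := (Num.sqrt (2 * pi * evar h beta))^-1.
have lam0 : 0 <= lam by rewrite invr_ge0 sqrtr_ge0.
have nu_fejer (T a : R) : 0 < T -> (fun N => nu N (fun x => fejer T (x - a))) @ \oo --> lam * pi.
  move=> T0; rewrite mulrC.
  have := @cvg_iid_mean_fejer R n (fun N => gweight h (beta_ N)) h
    (fun N => emean h (beta_ N)) (fun N => evar h (beta_ N)) E (evar h beta) C B v0
    evar_lim E_close C0 tilted_charf_near0 tilted_charf_away0 T a T0.
  apply: cvg_trans; apply: near_eq_cvg; near=> N; rewrite /nu; congr (_ * iid_mean _ _ _ _ _).
  by apply/esym; near: N.
have := cvg_nu_expR lam0 nuP (fun a b => cvg_nu_itv lam0 nuP nu_fejer (a := a) (b := b)) beta0 D0 beta_lim.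
apply: cvg_trans; apply: near_eq_cvg; near=> N; rewrite /nu; congr (_ * iid_mean _ _ _ _ _).
by near: N.
Unshelve. all: by end_near. Qed.

End cutoff.
End local_limit_theorem_tilted.

(** Finite stand-in for the shell: coordinates are restricted to the first [n] enumerated points.
    For fixed [N] and window it is constant once [n] is large. *)
Definition boxcount (R : realType) (h : nat -> R) (n N : nat) (E Delta : R) : nat :=
  #|[pred f : {ffun 'I_N -> 'I_n} | E <= \sum_i h (f i) < E + Delta]|.

(** * From the local limit theorem to counting *)

Section local_limit_count.
Variables (R : realType) (h : nat -> R) (j0 : nat).
Hypothesis h0 : forall j, 0 <= h j.
Hypothesis hj0 : h j0 = 0.
Hypothesis summable_h : forall beta, 0 < beta -> cvgn (series (fun j => expR (- beta * h j))).
Hypothesis h_spread : forall t : R, 0 < t -> exists j, cos (t * h j) != 1.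

(** The factor e^{beta (x - E)} undoes the tilt: every configuration in the window gets the same
    weight e^{- beta E} / Z^N. *)
Lemma boxcount_iid_mean (beta : R) n N E Delta : 0 < beta ->
  (moment h 0 beta ^+ N)^-1 * expR (- (beta * E)) * (boxcount h n N E Delta)%:R =
  iid_mean n N (gweight h beta) h
    (fun x => expR (beta * (x - E)) * indic_itv 0 Delta (x - E)).
Proof.
move=> b0; rewrite /boxcount -sum1_card natr_sum mulr_sumr /iid_mean.
rewrite big_mkcond/=; apply: eq_bigr => f _; rewrite inE.
rewrite /indic_itv subr_ge0 ltrBlDl.
case: ifPn => _; last by rewrite !mulr0.
rewrite !mulr1 /gweight big_split/= prodr_const card_ord -expR_sum exprVn.
rewrite mulrAC mulrC -expRD; congr (expR _ * _).
by rewrite -mulr_sumr; ring.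
Qed.

Lemma cvg_boxcount (beta_ E : nat -> R) (beta B Delta : R) (G : nat -> nat) :
  0 < beta -> beta_ @ \oo --> beta ->
  (\forall N \near \oo, `|N%:R * emean h (beta_ N) - E N| <= B) -> 0 < Delta ->
  (forall N, exists k, forall n, (k <= n)%N -> boxcount h n N (E N) Delta = G N) ->
  (fun N => Num.sqrt N%:R * ((moment h 0 (beta_ N) ^+ N)^-1 *
     expR (- (beta_ N * E N)) * (G N)%:R)) @ \oo -->
  (Num.sqrt (2 * pi * evar h beta))^-1 * ((expR (beta * Delta) - 1) / beta).
Proof.
move=> b0 bl El D0 GE.
pose P N n := [/\ (N <= n)%N, (j0 < n)%N,
  (0 < N)%N -> 0 < beta_ N ->
  [/\ `|\sum_(j < n) gweight h (beta_ N) j - 1| <= (N%:R ^+ 3)^-1 / 3,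
      `|\sum_(j < n) gweight h (beta_ N) j * (h j - emean h (beta_ N))| <= (N%:R ^+ 3)^-1 / 3 &
      `|\sum_(j < n) gweight h (beta_ N) j * (h j - emean h (beta_ N)) ^+ 2 - evar h (beta_ N)| <= (N%:R ^+ 3)^-1 / 3] &
  boxcount h n N (E N) Delta = G N].
have ex N : exists n, P N n.
  have [k kG] := GE N.
  (* At N = 0 the tolerance is 0, the inverse of 0 being 0, and for beta_N <= 0 the series are not
     under control: the tail conditions are guarded, and any large [n] does. *)
  have [[N0 bN]|nN] := pselect ((0 < N)%N /\ 0 < beta_ N).
    have tau0 : 0 < (N%:R ^+ 3)^-1 / 3 :> R by rewrite divr_gt0// invr_gt0 exprn_gt0// ltr0n.
    near \oo => n; exists n; split.
    - by near: n; exact: nbhs_infty_ge.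
    - by near: n; exact: nbhs_infty_gt.
    - by move=> _ _; near: n; exact: (gweight_tails h0 hj0 summable_h).
    - by apply: kG; near: n; exact: nbhs_infty_ge.
  exists (maxn N (maxn j0.+1 k)); split; rewrite ?leq_maxl//.
  - by rewrite !leq_max leqnn orbT.
  - by move=> N0 bN; exfalso; apply: nN.
  - by apply: kG; rewrite !leq_max leqnn !orbT.
have [n nP] := choice ex.
have := @tilted_local_limit R h j0 h0 hj0 summable_h h_spread beta_ E beta B b0 bl El
  n _ _ _ Delta D0.
move=> /(_ (fun N => (let: And4 a _ _ _ := nP N in a)) (fun N => (let: And4 _ a _ _ := nP N in a))
   (fun N => (let: And4 _ _ a _ := nP N in a))).
apply: cvg_trans; apply: near_eq_cvg; near=> N; congr (_ * _).
have bN : 0 < beta_ N by near: N; exact: (cvgr_gt beta).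
have [_ _ _ <-] := nP N.
by rewrite boxcount_iid_mean.
Unshelve. all: by end_near. Qed.

End local_limit_count.

(** * Thermodynamic functions of an enumerated energy *)

From mathcomp Require Import finmap.

(** An unordered sum of nonnegative terms can be computed along any enumeration; partition function,
    mean and variance thereby become series over [nat]. *)
Lemma esum_series (R : realType) (L : choiceType) (e : nat -> L) (g : L -> R) (l : R) :
  bijective e -> (forall x, 0 <= g x) -> series (fun j => g (e j)) @ \oo --> l ->
  (\esum_(x in [set: L]) (g x)%:E)%E = l%:E.
Proof.
move=> be g0 gl.
have be' : set_bij [set: nat] [set: L] e by rewrite setTT_bijective.
rewrite (reindex_esum _ _ _ _ be').
rewrite -nneseries_esumT; last by move=> j; rewrite lee_fin.
apply/cvg_lim => //.
have -> : (fun n => \sum_(0 <= i < n) (g (e i))%:E)%E = EFin \o series (fun j => g (e j)).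
  by apply/funext => n; rewrite /= sumEFin.
by apply: cvg_EFin; [near=> n|exact: gl].
Unshelve. all: by end_near. Qed.

Lemma card_fset_set_image (T U : choiceType) (f : T -> U) (A : set T) :
  injective f -> finite_set A -> #|` fset_set (f @` A)| = #|` fset_set A|.
Proof.
move=> fi fA; rewrite fset_set_image//; apply: card_imfset => //.
Qed.

Lemma card_fset_set_pred (T : finType) (P : pred T) : #|` fset_set [set x | P x]| = #|P|.
Proof.
have -> : fset_set [set x | P x] = [fset x | x in P]%fset.
  apply/fsetP => x; rewrite in_fset_set; last exact: finite_finset.
  apply/idP/idP => [/set_mem Px|/imfsetP[y /= Py ->]]; last exact/mem_set.
  by apply/imfsetP; exists x.
rewrite card_imfset//= cardE; congr size; exact: eq_enum.
Qed.

Lemma bijective_nat (L : choiceType) : infinite_set [set: L] -> countable [set: L] ->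
  exists e : nat -> L, bijective e.
Proof.
move=> /infiniteP iL cL.
have : ([set: nat] #= [set: L])%card by apply/card_eqPle.
move=> /card_bijP[f [g fg gf]].
have toK (T : choiceType) (y : [set: T]) : to_setT (val y) = y by exact: val_inj.
exists (fun n => val (f (to_setT n))) => /=.
by exists (fun x => val (g (to_setT x))) => x; rewrite toK ?fg ?gf.
Qed.

Section energy_enumeration.
Variables (R : realType) (L : choiceType) (H : L -> R) (e : nat -> L) (j0 : nat).
Let h j := H (e j).
Hypothesis e_bij : bijective e.
Hypothesis H0 : forall x, 0 <= H x.
Hypothesis hj0 : h j0 = 0.
Hypothesis summable_h : forall beta, 0 < beta -> cvgn (series (fun j => expR (- beta * h j))).
Hypothesis h_nonconst : forall m : R, exists j, h j != m.

Let h0 j : 0 <= h j. Proof. exact: H0. Qed.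

Lemma partition_functionE beta : 0 < beta -> partition_function H beta = moment h 0 beta.
Proof.
move=> b0; rewrite /partition_function.
rewrite (@esum_series _ _ e (fun x => expR (- beta * H x)) (moment h 0 beta))//.
rewrite (_ : (fun j => _) = boltz h beta 0); first exact: moment_cvg.
by apply/funext => j; rewrite /boltz expr0 mul1r.
Qed.

Lemma mean_energyE beta : 0 < beta -> mean_energy H beta = emean h beta.
Proof.
move=> b0; rewrite /mean_energy /expect /gibbs partition_functionE//.
have Z0 := moment0_gt0 h0 hj0 summable_h b0.
rewrite (@esum_series _ _ e _ (emean h beta))//.
  by move=> x; rewrite !mulr_ge0 ?expR_ge0 ?invr_ge0 ?(ltW Z0).
rewrite /emean mulrC.
rewrite (_ : (fun j => _) = (fun j => (moment h 0 beta)^-1 * boltz h beta 1 j)).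
  by apply: seriesZ_cvg; exact: moment_cvg.
by apply/funext => j; rewrite /boltz expr1 /h; ring.
Qed.

Lemma var_energyE beta : 0 < beta -> var_energy H beta = evar h beta.
Proof.
move=> b0; rewrite /var_energy /variance_of -/(mean_energy H beta) mean_energyE//.
rewrite /expect /gibbs partition_functionE//.
have Z0 := moment0_gt0 h0 hj0 summable_h b0.
rewrite (@esum_series _ _ e _ (evar h beta))//.
  by move=> x; apply: mulr_ge0; [rewrite mulr_ge0 ?expR_ge0 ?invr_ge0 ?(ltW Z0)|exact: sqr_ge0].
rewrite -[evar h beta](mulKf (lt0r_neq0 Z0)).
rewrite (_ : (fun j => _) = (fun j => (moment h 0 beta)^-1 *
    (expR (- beta * h j) * (h j - emean h beta) ^+ 2))).
  by apply: seriesZ_cvg; exact: (sqr_dev_cvg h0 hj0).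
by apply/funext => j; rewrite -mulrA.
Qed.

Lemma psiE beta : 0 < beta -> psi H beta = epsi h beta.
Proof. by move=> b0; rewrite /psi partition_functionE. Qed.

Lemma inv_tempK beta : 0 < beta -> inv_temp H (emean h beta) = beta.
Proof.
move=> b0.
have inj : {in [set beta : R | 0 < beta] &, injective (mean_energy H)}.
  move=> x y /set_mem/= x0 /set_mem/= y0; rewrite !mean_energyE// => xy.
  apply/eqP; apply: contraT; rewrite neq_lt => /orP[] lxy.
    by have := emean_decr h0 hj0 summable_h h_nonconst x0 lxy; rewrite xy ltxx.
  by have := emean_decr h0 hj0 summable_h h_nonconst y0 lxy; rewrite xy ltxx.
have := @pinvKV _ _ (fun=> 1) _ _ inj; rewrite /prop_in1 => /(_ beta (mem_set b0)).
by rewrite mean_energyE.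
Qed.

Lemma inv_temp_spec u : 0 < u -> 0 < inv_temp H u /\ emean h (inv_temp H u) = u.
Proof.
move=> u0; have [beta b0 <-] := emean_surj h0 hj0 summable_h h_nonconst u0.
by rewrite inv_tempK.
Qed.

(** Strict monotonicity traps the inverse: once u_N lies between emean (b + d) and emean (b - d),
    its preimage lies between b - d and b + d. *)
Lemma inv_temp_cvg (u_ : nat -> R) (u : R) : 0 < u -> u_ @ \oo --> u ->
  (fun N => inv_temp H (u_ N)) @ \oo --> inv_temp H u.
Proof.
move=> u0 ul; have [b0 bu] := inv_temp_spec u0.
set b := inv_temp H u in b0 bu *.
apply/cvgrPdist_le => eps eps0.
pose d := Num.min eps (b / 2).
have d0 : 0 < d by rewrite lt_min eps0 divr_gt0.
have d1 : d <= eps by rewrite ge_min lexx.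
have d2 : d <= b / 2 by rewrite ge_min lexx orbT.
have bd0 : 0 < b - d by lra.
have lo : emean h (b + d) < u by rewrite -bu; apply: (emean_decr h0 hj0) => //; rewrite ltrDl.
have hi : u < emean h (b - d) by rewrite -bu; apply: (emean_decr h0 hj0) => //; rewrite gtrBl.
near=> N.
have uN0 : 0 < u_ N by near: N; exact: (cvgr_gt u).
have uNlo : emean h (b + d) < u_ N by near: N; exact: (cvgr_gt u).
have uNhi : u_ N < emean h (b - d) by near: N; exact: (cvgr_lt u).
have [bN0 bNu] := inv_temp_spec uN0.
set bN := inv_temp H (u_ N) in bN0 bNu *.
have l1 : bN <= b + d.
  rewrite leNgt; apply/negP => lt1.
  have bd : 0 < b + d by rewrite addr_gt0.
  have := emean_decr h0 hj0 summable_h h_nonconst bd lt1.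
  by rewrite bNu => /(lt_trans uNlo); rewrite ltxx.
have l2 : b - d <= bN.
  rewrite leNgt; apply/negP => lt1.
  have := emean_decr h0 hj0 summable_h h_nonconst bN0 lt1.
  by rewrite bNu => /(lt_trans uNhi); rewrite ltxx.
by rewrite ler_norml; apply/andP; split; lra.
Unshelve. all: by end_near. Qed.

(** The infimum is attained at m^-1(u): by [epsi_tangent], psi theta + theta u lies above its value
    where the mean energy is [u]. *)
Lemma entropyE u : 0 < u ->
  psi H (inv_temp H u) + inv_temp H u * u = entropy H u.
Proof.
move=> u0; have [b0 bu] := inv_temp_spec u0.
set b := inv_temp H u in b0 bu *.
set A := [set psi H theta + theta * u | theta in [set theta : R | 0 < theta]].
have Ab : A (psi H b + b * u) by exists b.
have lb : lbound A (psi H b + b * u).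
  move=> _ [theta /= t0 <-]; rewrite !psiE//.
  have [->//|tb] := eqVneq theta b.
  have := epsi_tangent h0 hj0 summable_h h_nonconst t0 b0 tb; rewrite bu; lra.
apply/eqP; rewrite eq_le; apply/andP; split.
  by apply: lb_le_inf => //; exists (psi H b + b * u).
by apply: ge_inf => //; exists (psi H b + b * u).
Qed.

Lemma near_energy_ge (M : R) : \forall j \near \oo, M <= h j.
Proof.
have c0 := cvg_series_cvg_0 (summable_h (@ltr01 R)).
have eM := expR_gt0 (- M).
near=> j.
have : expR (- 1 * h j) <= expR (- M).
  by near: j; apply: near_le_of_cvg_lt c0 eM.
by rewrite ler_expR mulN1r lerN2.
Unshelve. all: by end_near. Qed.

Definition box_map N n (f : {ffun 'I_N -> 'I_n}) : {ffun 'I_N -> L} := [ffun i => e (f i)].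

Lemma box_map_inj N n : injective (@box_map N n).
Proof.
move=> f g /ffunP fg; apply/ffunP => i; have := fg i; rewrite !ffunE.
by move/(bij_inj e_bij)/val_inj.
Qed.

(** Energies are nonnegative and tend to infinity along the enumeration, so no coordinate of a shell
    configuration can have a large index. *)
Lemma shell_box N E Delta : exists k, forall n, (k <= n)%N ->
  @shell R L H N E Delta = @box_map N n @` [set f : {ffun 'I_N -> 'I_n} | E <= \sum_i h (f i) < E + Delta].
Proof.
have [k _ kP] := near_energy_ge (E + Delta).
exists k => n kn; apply/seteqP; split => [x /= Hx|_ [f /= Hf <-]]; last first.
  by rewrite /shell/= /total_energy (eq_bigr (fun i => h (f i)))// => i _; rewrite ffunE.
have [g ge eg] := e_bij.
have small i : (g (x i) < n)%N.
  rewrite ltnNge; apply/negP => nk; have := kP (g (x i)) (leq_trans kn nk).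
  rewrite /h eg => h1; case/andP: Hx => _.
  rewrite ltNge => /negP; apply; apply: (le_trans h1).
  by rewrite /total_energy (bigD1 i)//= lerDl sumr_ge0.
exists [ffun i => Ordinal (small i)].
  rewrite /= (eq_bigr (fun i => H (x i))) => [|i _]; first exact: Hx.
  by rewrite ffunE /h/= eg.
by apply/ffunP => i; rewrite !ffunE/= eg.
Qed.

Lemma finite_shell N E Delta : finite_set (@shell R L H N E Delta).
Proof.
have [k /(_ k (leqnn k)) ->] := shell_box N E Delta.
by apply: finite_image; exact: finite_finset.
Qed.

Lemma shell_card_box N E Delta : exists k, forall n, (k <= n)%N ->
  boxcount h n N E Delta = shell_card H N E Delta.
Proof.
have [k kP] := shell_box N E Delta; exists k => n kn.
rewrite /shell_card (kP n kn) card_fset_set_image; last 2 first.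
- exact: box_map_inj.
- exact: finite_finset.
by rewrite card_fset_set_pred.
Qed.

End energy_enumeration.

(** * Mass functions and total variation *)

Section mass_of_theory.
Variables (R : realType) (T : choiceType) (mu : T -> R).
Hypothesis mu0 : forall x, 0 <= mu x.
Hypothesis mu1 : (\esum_(x in [set: T]) (mu x)%:E <= 1)%E.

Let esum_sub_le1 (A : set T) : (\esum_(x in A) (mu x)%:E <= 1)%E.
Proof.
apply: le_trans mu1.
rewrite [leRHS](esumID A)//; last by move=> x _; rewrite lee_fin.
rewrite setTI leeDl// esum_ge0// => x _; by rewrite lee_fin.
Qed.

Let esum_fin (A : set T) : (\esum_(x in A) (mu x)%:E)%E \is a fin_num.
Proof.
rewrite ge0_fin_numE; first exact: le_lt_trans (esum_sub_le1 A) (ltry _).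
by apply: esum_ge0 => x _; rewrite lee_fin.
Qed.

Lemma mass_of_fset (F : {fset T}) : mass_of mu [set` F] = \sum_(x <- F) mu x.
Proof.
rewrite /mass_of esum_fset//; last by move=> x _; rewrite lee_fin.
by rewrite fsbig_finite//= set_fsetK sumEFin.
Qed.

Lemma mass_ofD (A B : set T) : [disjoint A & B] ->
  mass_of mu (A `|` B) = mass_of mu A + mass_of mu B.
Proof.
move=> AB; rewrite /mass_of -fineD//; congr fine.
have /disj_setPS AB' := AB.
have e1 : (A `|` B) `&` A = A by rewrite setIC; apply/setIidPl => x; left.
have e2 : (A `|` B) `&` ~` A = B.
  apply/seteqP; split => x /=; first by case=> -[].
  by move=> Bx; split; [right|move=> Ax; exact: (AB' x)].
by rewrite (esumID A)/= ?e1 ?e2// => x _; rewrite lee_fin.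
Qed.

Lemma mass_of_ge0 A : 0 <= mass_of mu A.
Proof. by rewrite fine_ge0// esum_ge0// => x _; rewrite lee_fin. Qed.

Lemma mass_of_le1 A : mass_of mu A <= 1.
Proof. by rewrite -lee_fin /mass_of fineK. Qed.

Lemma mass_of_approx (A : set T) (F : {fset T}) :
  0 <= mass_of mu A - \sum_(x <- F | x \in A) mu x <= 1 - \sum_(x <- F) mu x.
Proof.
pose FA := [fset x in F | x \in A]%fset.
have FAE : \sum_(x <- F | x \in A) mu x = mass_of mu [set` FA].
  rewrite mass_of_fset big_fset/=.
  by apply: eq_bigl => x; rewrite ?inE.
have AE : A = [set` FA] `|` (A `\` [set` F]).
  apply/seteqP; split => [x Ax|x [|[]//]].
    have [xF|xF] := boolP (x \in F); [left|right] => /=.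
      by rewrite !inE xF/=; exact/mem_set.
    by split => //; apply/negP.
  by rewrite /= !inE => /andP[_] /set_mem.
have d1 : [disjoint [set` FA] & A `\` [set` F]].
  by apply/disj_setPS => x [] /=; rewrite !inE => /andP[xF _] [].
have d2 : [disjoint [set` F] & A `\` [set` F]].
  by apply/disj_setPS => x [] /= xF [].
have mA : mass_of mu A = mass_of mu [set` FA] + mass_of mu (A `\` [set` F]).
  by rewrite {1}AE mass_ofD.
rewrite FAE mA addrAC subrr add0r mass_of_ge0/=.
rewrite lerBrDr -mass_of_fset addrC -mass_ofD//; exact: mass_of_le1.
Qed.

End mass_of_theory.

(** Quantitative Scheffe lemma: as [mu] has mass at most 1, what it puts outside [F] is at most 1 -
    nu(F) plus the discrepancy on [F]. Tightness of the limit thus controls both tails. *)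
Lemma tv_dist_fset_le (R : realType) (T : choiceType) (mu nu : T -> R) (F : {fset T}) :
  (forall x, 0 <= mu x) -> (\esum_(x in [set: T]) (mu x)%:E <= 1)%E ->
  (forall x, 0 <= nu x) -> (\esum_(x in [set: T]) (nu x)%:E <= 1)%E ->
  0 <= tv_dist mu nu <= 2 * \sum_(x <- F) `|mu x - nu x| + 2 * (1 - \sum_(x <- F) nu x).
Proof.
move=> mu0 mu1 nu0 nu1.
set S := [set `|mass_of mu A - mass_of nu A| | A in [set: set T]].
set b := _ + 2 * _.
have ubS : ubound S b.
  move=> _ [A _ <-].
  have /andP[a1 a2] := mass_of_approx mu0 mu1 A F.
  have /andP[c1 c2] := mass_of_approx nu0 nu1 A F.
  have d1 : `|\sum_(x <- F | x \in A) mu x - \sum_(x <- F | x \in A) nu x| <= \sum_(x <- F) `|mu x - nu x|.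
    rewrite -sumrB; apply: (le_trans (ler_norm_sum _ _ _)).
    by rewrite [leRHS](bigID (fun x => x \in A))/= lerDl sumr_ge0.
  have d2 : `|\sum_(x <- F) mu x - \sum_(x <- F) nu x| <= \sum_(x <- F) `|mu x - nu x|.
    by rewrite -sumrB; exact: ler_norm_sum.
  move: a1 a2 c1 c2 d1 d2; rewrite /b.
  move: (mass_of mu A) (mass_of nu A) (\sum_(x <- F | _) mu x) (\sum_(x <- F | _) nu x).
  move: (\sum_(x <- F) mu x) (\sum_(x <- F) nu x) (\sum_(x <- F) `|_|) => x y z a b' c d.
  rewrite !ler_norml => *; apply/andP; split; lra.
have S0 : S 0.
  by exists set0 => //; rewrite /mass_of !esum_set0 subrr normr0.
have supS : has_sup S by split; [exists 0|exists b].
apply/andP; split; first by apply: sup_ubound => //; case: supS.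
by apply: sup_le_ub => //; exists 0.
Qed.

Lemma cvg_tv_dist (R : realType) (T : choiceType) (mu_ : nat -> T -> R) (nu : T -> R) :
  (\forall N \near \oo, forall x, 0 <= mu_ N x) ->
  (\forall N \near \oo, (\esum_(x in [set: T]) (mu_ N x)%:E <= 1)%E) ->
  (forall x, 0 <= nu x) -> (\esum_(x in [set: T]) (nu x)%:E <= 1)%E ->
  (forall eps : R, 0 < eps -> exists F : {fset T}, 1 - eps <= \sum_(x <- F) nu x) ->
  (forall x, (fun N => mu_ N x) @ \oo --> nu x) ->
  (fun N => tv_dist (mu_ N) nu) @ \oo --> (0 : R).
Proof.
move=> mu0 mu1 nu0 nu1 nuF mul; apply/cvgrPdist_le => eps eps0.
have e4 : 0 < eps / 4 by rewrite divr_gt0.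
have [F FE] := nuF _ e4.
have sl : (fun N => \sum_(x <- F) `|mu_ N x - nu x|) @ \oo --> (0 : R).
  rewrite -[X in _ --> X](_ : \sum_(x <- F) `|nu x - nu x| = 0); last first.
    by apply: big1 => x _; rewrite subrr normr0.
  apply: cvgr_sum => x; apply: cvg_norm; apply: cvgB => //; exact: cvg_cst.
near=> N.
have m0 : forall x, 0 <= mu_ N x by near: N.
have m1 : (\esum_(x in [set: T]) (mu_ N x)%:E <= 1)%E by near: N.
have /andP[t0 t1] := tv_dist_fset_le F m0 m1 nu0 nu1.
rewrite distrC subr0 ger0_norm//; apply: (le_trans t1).
have : \sum_(x <- F) `|mu_ N x - nu x| <= eps / 4 by near: N; exact: near_le_of_cvg_lt sl e4.
lra.
Unshelve. all: by end_near. Qed.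

Lemma esum_le_fset (R : realType) (T : choiceType) (g : T -> R) (c : R) :
  (forall F : {fset T}, \sum_(x <- F) g x <= c) ->
  (\esum_(x in [set: T]) (g x)%:E <= c%:E)%E.
Proof.
move=> gc; apply: ge_ereal_sup => _ [A [fA _] <-].
by rewrite fsbig_finite//= sumEFin lee_fin.
Qed.

Section image_mass_theory.
Variables (R : realType) (S T : choiceType) (f : S -> T) (mu : S -> R).
Hypothesis mu0 : forall x, 0 <= mu x.
Hypothesis mu1 : (\esum_(x in [set: S]) (mu x)%:E <= 1)%E.

Lemma image_mass_ge0 y : 0 <= image_mass f mu y.
Proof. exact: mass_of_ge0. Qed.

Lemma image_mass_sum (F : {fset T}) :
  \sum_(y <- F) image_mass f mu y = mass_of mu (f @^-1` [set` F]).
Proof.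
elim/(@finSet_rect T): F => F IH.
have [->|[y yF]] := fset_0Vmem F.
  rewrite big_seq_fset0 (_ : _ @^-1` _ = set0) ?/mass_of ?esum_set0//.
  by apply/seteqP; split => x //=; rewrite inE.
rewrite (big_fsetD1 y)//= IH; last first.
  by rewrite fproperD1.
rewrite /image_mass -mass_ofD//.
  congr mass_of; apply/seteqP; split => x /=.
    by case=> [->//|]; rewrite !inE => /andP[].
  by move=> xF; have [->|xy] := eqVneq (f x) y; [left|right; rewrite !inE xy].
by apply/disj_setPS => x [/= ->]; rewrite !inE eqxx.
Qed.

Lemma image_mass_le1 : (\esum_(y in [set: T]) (image_mass f mu y)%:E <= 1)%E.
Proof. by apply: esum_le_fset => F; rewrite image_mass_sum mass_of_le1. Qed.

End image_mass_theory.

Section microcanonical_theory.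
Variables (R : realType) (L : choiceType) (H : L -> R) (N : nat) (E Delta : R).
Hypothesis finS : finite_set (@shell R L H N E Delta).

Let S := @shell R L H N E Delta.

Lemma microcanonical_ge0 (x : {ffun 'I_N -> L}) : 0 <= microcanonical H E Delta x.
Proof. by rewrite /microcanonical; case: ifP => // _; rewrite invr_ge0. Qed.

Lemma mass_of_microcanonical (A : set {ffun 'I_N -> L}) :
  mass_of (microcanonical H E Delta) A =
  #|` fset_set (A `&` S)|%:R / (shell_card H N E Delta)%:R.
Proof.
rewrite /mass_of.
have -> : (\esum_(x in A) (microcanonical H E Delta x)%:E =
    \esum_(x in A `&` S) ((shell_card H N E Delta)%:R^-1)%:E)%E.
  rewrite esum_mkcondr; apply: eq_esum => x _; rewrite /microcanonical -/S.
  by case: ifP.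
have fAS : finite_set (A `&` S) by exact: finite_setIr.
rewrite esum_fset//.
rewrite fsbig_finite//= sumEFin /= big_const_seq count_predT iter_addr_0.
by rewrite mulr_natl.
Qed.

Lemma microcanonical_le1 :
  (\esum_(x in [set: {ffun 'I_N -> L}]) (microcanonical H E Delta x)%:E <= 1)%E.
Proof.
apply: esum_le_fset => F.
rewrite (eq_bigr (fun x => if x \in S then (shell_card H N E Delta)%:R^-1 else 0)); last first.
  by move=> x _; rewrite /microcanonical.
rewrite -big_mkcond/= -big_filter big_const_seq count_predT iter_addr_0.
rewrite -[leLHS]mulr_natl.
(* For an empty shell the inverse of 0 is 0 and all masses vanish; hence a bound by 1 rather than an
   equality. *)
have [G0|G0] := posnP (shell_card H N E Delta).
  have -> : (shell_card H N E Delta)%:R^-1 = 0 :> R by rewrite G0 mulr0n invr0.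
  by rewrite mulr0.
rewrite ler_pdivrMr ?ltr0n// mul1r ler_nat /shell_card.
apply: uniq_leq_size; first by rewrite filter_uniq// fset_uniq.
by move=> x; rewrite mem_filter => /andP[xS _]; rewrite in_fset_set.
Qed.

End microcanonical_theory.

(** * Fibres of the projection onto the first coordinates *)

Section fibre.
Variables (R : realType) (L : zmodType) (H : L -> R) (k M : nat).
Variable y : {ffun 'I_k -> L}.

Definition glue (z : {ffun 'I_M -> L}) : {ffun 'I_(k + M) -> L} :=
  [ffun i => match fintype.split i with inl a => y a | inr b => z b end].

Lemma glue_lshift z a : glue z (lshift M a) = y a.
Proof. by rewrite ffunE (unsplitK (inl a)). Qed.

Lemma glue_rshift z b : glue z (rshift k b) = z b.
Proof. by rewrite ffunE (unsplitK (inr b)). Qed.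

Lemma glue_inj : injective glue.
Proof.
by move=> z z' /ffunP zz; apply/ffunP => b; rewrite -!glue_rshift zz.
Qed.

Lemma proj_first_lshift (x : {ffun 'I_(k + M) -> L}) a :
  proj_first k x a = x (lshift M a).
Proof.
by rewrite (proj_firstE (leq_addr M k)); congr (x _); exact: val_inj.
Qed.

Lemma total_energy_glue z :
  total_energy H (glue z) = total_energy H y + total_energy H z.
Proof.
rewrite /total_energy big_split_ord/=; congr (_ + _); apply: eq_bigr => i _.
  by rewrite glue_lshift.
by rewrite glue_rshift.
Qed.

Lemma fibre_shell (E Delta : R) :
  @proj_first L k (k + M) @^-1` [set y] `&` @shell R L H (k + M) E Delta =
  glue @` @shell R L H M (E - total_energy H y) Delta.
Proof.
apply/seteqP; split => [x [/= xy xS]|_ [z /= zS <-]].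
  exists [ffun b => x (rshift k b)]; last first.
    apply/ffunP => i; case: (fintype.splitP i) => [a|b] ia.
      have -> : i = lshift M a by exact: val_inj.
      by rewrite glue_lshift -xy proj_first_lshift.
    have -> : i = rshift k b by exact: val_inj.
    by rewrite glue_rshift ffunE.
  have e : x = glue [ffun b => x (rshift k b)].
    apply/ffunP => i; case: (fintype.splitP i) => [a|b] ia.
      have -> : i = lshift M a by exact: val_inj.
      by rewrite glue_lshift -xy proj_first_lshift.
    have -> : i = rshift k b by exact: val_inj.
    by rewrite glue_rshift ffunE.
  have eE : total_energy H x =
      total_energy H y + total_energy H [ffun b => x (rshift k b)].
    by rewrite {1}e total_energy_glue.
  by move: xS; rewrite /shell/= eE; lra.
split; last by rewrite /shell/= total_energy_glue; move: zS; rewrite /shell/=; lra.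
by apply/ffunP => a; rewrite proj_first_lshift glue_lshift.
Qed.

Hypothesis fin_shell : forall N E Delta, finite_set (@shell R L H N E Delta).

Lemma image_mass_proj_first (E Delta : R) :
  image_mass (@proj_first L k (k + M)) (microcanonical H E Delta) y =
  (shell_card H M (E - total_energy H y) Delta)%:R / (shell_card H (k + M) E Delta)%:R.
Proof.
rewrite /image_mass (mass_of_microcanonical (fin_shell _ _ _)) fibre_shell.
by rewrite (card_fset_set_image glue_inj (fin_shell _ _ _)).
Qed.

End fibre.

Section power_mass_theory.
Variables (R : realType) (L : choiceType) (p : L -> R) (e : nat -> L) (k : nat).
Hypothesis e_bij : bijective e.
Hypothesis p0 : forall x, 0 <= p x.
Hypothesis p1 : series (fun j => p (e j)) @ \oo --> (1 : R).

Let boxes n : {fset {ffun 'I_k -> L}} := [fset box_map e f | f in {ffun 'I_k -> 'I_n}]%fset.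

Lemma power_mass_ge0 y : 0 <= power_mass (k := k) p y.
Proof. exact: prodr_ge0. Qed.

Lemma power_mass_box n :
  \sum_(y <- boxes n) power_mass p y = (\sum_(j < n) p (e j)) ^+ k.
Proof.
rewrite big_imfset/=; last by move=> f g _ _; exact: box_map_inj.
rewrite -[in RHS](card_ord k) -prodr_const.
rewrite (bigA_distr_bigA (fun (i : 'I_k) (j : 'I_n) => p (e j))).
rewrite -[RHS]big_enum/=; apply: eq_bigr => f _.
by apply: eq_bigr => i _; rewrite ffunE.
Qed.

(** Any finite set of configurations lies in a box, whose mass is the k-th power of a partial sum.
    The lemma serves the Gibbs product and also, with one-dimensional theta weights on the integers,
    the summability of the Boltzmann weights. *)
Lemma power_mass_le1 : (\esum_(y in [set: {ffun 'I_k -> L}]) (power_mass p y)%:E <= 1)%E.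
Proof.
apply: esum_le_fset => F.
have [g ge eg] := e_bij.
pose n := \max_(y <- F) \max_(i < k) (g (y i)).+1.
have Fn : {subset F <= boxes n}.
  move=> y yF; have sm i : (g (y i) < n)%N.
    apply: (@leq_trans (\max_(i < k) (g (y i)).+1)%N).
      exact: (leq_bigmax i).
    exact: (leq_bigmax_seq (F := fun y : {ffun 'I_k -> L} => (\max_(i < k) (g (y i)).+1)%N)).
  apply/imfsetP; exists [ffun i => Ordinal (sm i)] => //=.
  by apply/ffunP => i; rewrite !ffunE/= eg.
apply: (@le_trans _ _ (\sum_(y <- boxes n) power_mass p y)).
  rewrite [leRHS](big_fsetID _ (fun y => y \in F))/=.
  rewrite (_ : [fset x in boxes n | x \in F]%fset = F); last first.
    apply/fsetP => y; rewrite !inE/=; apply/andP/idP => [[]//|yF].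
    by split => //; exact: Fn.
  by rewrite lerDl sumr_ge0// => y _; exact: power_mass_ge0.
rewrite power_mass_box; apply: exprn_ile1; first exact: sumr_ge0.
rewrite -(cvg_lim _ p1)//; apply: (@psum_le_lim _ (fun j => p (e j))) => //.
by apply/cvg_ex; exists 1.
Qed.

Lemma power_mass_tight (eps : R) : 0 < eps ->
  exists F : {fset {ffun 'I_k -> L}}, 1 - eps <= \sum_(y <- F) power_mass p y.
Proof.
move=> eps0.
have : (fun n => (\sum_(j < n) p (e j)) ^+ k) @ \oo --> (1 : R).
  rewrite -[X in _ --> X](expr1n R k).
  apply: (@continuous_cvgn _ (fun x => x ^+ k)); first exact: exprn_continuous.
  by under eq_fun do rewrite -(series_ord (fun j => p (e j))).
move=> pl; have e1 : 1 - eps < 1 by rewrite gtrBl.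
have [n _ /(_ n (leqnn n)) nP] := near_ge_of_cvg_gt pl e1.
by exists (boxes n); rewrite power_mass_box.
Qed.

End power_mass_theory.

(** * Lattices in Euclidean spaces *)

Section inner_product.
Variables (R : realType) (V : lmodType R) (ip : {dot V for @idfun R}).

Lemma ip_sym u v : ip u v = ip v u.
Proof. by rewrite (@hermC _ false idfun V ip) expr0 mul1r. Qed.

Lemma ipBl u v w : ip (u - v) w = ip u w - ip v w.
Proof. exact: linearBl. Qed.

Lemma ipZl a u v : ip (a *: u) v = a * ip u v.
Proof. exact: linearZl_LR. Qed.

Lemma ip_self_ge0 v : 0 <= ip v v.
Proof.
have [->|v0] := eqVneq v 0; first by rewrite linear0r.
exact/ltW/neq0_dnorm_gt0.
Qed.

Lemma ip_self_eq0 v : ip v v = 0 -> v = 0.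
Proof.
move=> vv; apply/eqP; apply: contraT => /(@neq0_dnorm_gt0 _ _ idfun ip).
by rewrite vv ltxx.
Qed.

(* The discriminant of t |-> ip (v - t w) (v - t w) is nonpositive. *)
Lemma ip_cauchy_schwarz v w : ip v w ^+ 2 <= ip v v * ip w w.
Proof.
have ip0 u : ip u 0 = 0 by exact: linear0r.
have [->|w0] := eqVneq w 0; first by rewrite !ip0 mulr0 expr0n.
have ww : 0 < ip w w := @neq0_dnorm_gt0 _ _ idfun ip _ w0.
pose t := ip v w / ip w w.
have := ip_self_ge0 (v - t *: w).
rewrite ipBl ipZl ip_sym (ip_sym w) !ipBl !ipZl (ip_sym w v).
have -> : ip v v - t * ip v w - t * (ip v w - t * ip w w) = (ip v v * ip w w - ip v w ^+ 2) / ip w w.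
  by rewrite /t; field; rewrite gt_eqF.
by rewrite pmulr_lge0 ?invr_gt0// subr_ge0.
Qed.

End inner_product.

Section lattice_coordinates.
Variables (R : realType) (d : nat) (L : zmodType) (V : lmodType R).
Variables (iota : {additive L -> V}) (ip : {dot V for @idfun R}).
Variable b : 'I_d -> L.
Variable c : L -> {ffun 'I_d -> int}.
Hypothesis bc : forall x, \sum_(i < d) b i *~ c x i = x.
Hypothesis cb : forall f : {ffun 'I_d -> int}, c (\sum_(i < d) b i *~ f i) = f.
Hypothesis V_ext : is_scalar_extension iota.

Lemma coordB x y i : c (x - y) i = c x i - c y i.
Proof.
have -> : x - y = \sum_(i < d) b i *~ [ffun i => c x i - c y i] i.
  rewrite -{1}(bc x) -{1}(bc y) -sumrB; apply: eq_bigr => j _.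
  by rewrite ffunE mulrzBr.
by rewrite cb ffunE.
Qed.

(** The universal property with target R extends each integer coordinate to a linear form on [V];
    the images of the basis of [L] are therefore independent over R, not merely over the
    integers. *)
Lemma coord_linear i : exists g : {linear V -> R^o}, forall x, g (iota x) = (c x i)%:~R.
Proof.
have add : zmod_morphism (fun x : L => (c x i)%:~R : R^o).
  by move=> x y; rewrite coordB rmorphB.
pose f : {additive L -> R^o} := HB.pack (fun x : L => (c x i)%:~R : R^o)
  (GRing.isZmodMorphism.Build L R^o (fun x : L => (c x i)%:~R : R^o) add).
have [g [gf _]] := V_ext f.
by exists g.
Qed.

Lemma iotaE x : iota x = \sum_(i < d) (c x i)%:~R *: iota (b i).
Proof.
rewrite -[in LHS](bc x) raddf_sum; apply: eq_bigr => i _.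
by rewrite raddfMz scaler_int.
Qed.

(* The Gram matrix G of the images of the basis is invertible, and the i-th
   coordinate of x is the product of x with w_i = \sum_k (G^-1)_{ki} b_k. *)
Lemma coord_riesz : exists w : 'I_d -> V, forall x i, (c x i)%:~R = ip (iota x) (w i).
Proof.
pose G : 'M[R]_d := \matrix_(j, k) ip (iota (b j)) (iota (b k)).
have lin (u : 'rV[R]_d) v : ip (\sum_j u 0 j *: iota (b j)) v = \sum_j u 0 j * ip (iota (b j)) v.
  by rewrite linear_sumlz; apply: eq_bigr => j _; rewrite linearZl_LR.
have Gfree : row_free G.
  apply: inj_row_free => u uG.
  pose v := \sum_j u 0 j *: iota (b j).
  have vb k : ip v (iota (b k)) = 0.
    have := congr1 (fun A : 'rV[R]_d => A 0 k) uG; rewrite !mxE => <-.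
    by rewrite lin; apply: eq_bigr => j _; rewrite mxE.
  have v0 : v = 0.
    apply: (@ip_self_eq0 _ _ ip); rewrite {1}/v lin; apply: big1 => j _.
    by rewrite ip_sym vb mulr0.
  apply/rowP => i; rewrite mxE.
  have [g gE] := coord_linear i.
  have : g v = 0 by rewrite v0 linear0.
  rewrite /v linear_sum (bigD1 i)//= big1 ?addr0 => [|j ji]; rewrite linearZ gE.
    have -> : c (b i) i = 1.
      have -> : b i = \sum_(j < d) b j *~ [ffun j => (j == i)%:R : int] j.
        rewrite (bigD1 i)//= ffunE eqxx mulr1z big1 ?addr0// => j ji.
        by rewrite ffunE (negbTE ji) mulr0z.
      by rewrite cb ffunE eqxx.
    by rewrite mulr1z => u0; rewrite -[u 0 i]mulr1; exact: u0.
  have -> : c (b j) i = 0.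
    have -> : b j = \sum_(k < d) b k *~ [ffun k => (k == j)%:R : int] k.
      rewrite (bigD1 j)//= ffunE eqxx mulr1z big1 ?addr0// => k kj.
      by rewrite ffunE (negbTE kj) mulr0z.
    by rewrite cb ffunE eq_sym (negbTE ji).
  by rewrite mulr0z; exact: mulr0.
have Gunit : G \in unitmx by rewrite -row_free_unit.
exists (fun i => \sum_k (invmx G) k i *: iota (b k)) => x i.
pose u : 'rV[R]_d := \row_j (c x j)%:~R.
have -> : iota x = \sum_j u 0 j *: iota (b j).
  by rewrite iotaE; apply: eq_bigr => j _; rewrite mxE.
have -> : (c x i)%:~R = (u *m G *m invmx G) 0 i by rewrite mulmxK// mxE.
rewrite linear_sumr mxE; apply: eq_bigr => k _.
rewrite linearZr_LR/= lin mxE mulrC; congr (_ * _).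
by apply: eq_bigr => j _; rewrite [G j k]mxE.
Qed.

Lemma energyE x : energy iota ip x = ip (iota x) (iota x).
Proof. by rewrite /energy /euclidean_norm sqr_sqrtr// ip_self_ge0. Qed.

(** Cauchy-Schwarz applied to the vectors representing the coordinates; the 1 added to the constant
    makes it strictly positive. *)
Lemma coord_sqr_le_energy : exists2 K : R, 0 < K & forall x,
  \sum_(i < d) (c x i)%:~R ^+ 2 <= K * energy iota ip x.
Proof.
have [w wE] := coord_riesz.
exists (\sum_i ip (w i) (w i) + 1).
  by rewrite ltr_wpDl// sumr_ge0// => i _; exact: ip_self_ge0.
move=> x; rewrite energyE mulrDl mul1r mulr_suml.
apply: (@le_trans _ _ (\sum_i ip (w i) (w i) * ip (iota x) (iota x))).
  by apply: ler_sum => i _; rewrite wE mulrC ip_cauchy_schwarz.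
by rewrite lerDl ip_self_ge0.
Qed.

End lattice_coordinates.

(** The order is 0, -1, 1, -2, 2, ..., so that the index is at most twice the absolute value. *)
Definition int_of_index (j : nat) : int := if odd j then Negz j./2 else Posz j./2.

Lemma int_of_index_bij : bijective int_of_index.
Proof.
exists (fun z : int => match z with Posz k => k.*2 | Negz k => k.*2.+1 end).
  move=> j; rewrite /int_of_index; have := odd_double_half j.
  by case: (odd j).
move=> [k|k]; rewrite /int_of_index/= ?odd_double/= ?doubleK//.
by rewrite uphalf_double.
Qed.

Lemma index_le_sqr_int (j : nat) : (j <= 2 * `|int_of_index j ^+ 2|)%N.
Proof.
have h := odd_double_half j.
apply: (@leq_trans (2 * `|int_of_index j|)%N).
  rewrite /int_of_index; move: h; case: (odd j) => /= {1}<-.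
    by rewrite mul2n doubleS ltnW.
  by rewrite add0n mul2n.
rewrite leq_mul2l/= abszX -mulnn.
by case: (absz _) => // k; rewrite leq_pmulr.
Qed.

(** j <= 2 z_j^2 for the j-th integer z_j, so a geometric series of ratio e^{-b/2} dominates. *)
Lemma theta_series_cvg (R : realType) (b : R) : 0 < b ->
  cvgn (series (fun j => expR (- b * (int_of_index j)%:~R ^+ 2))).
Proof.
move=> b0; apply: (@series_domination _ _ (fun j => expR (- b / 2) ^+ j)).
- by move=> j; exact: expR_ge0.
- move=> j; rewrite -expRM_natl ler_expR.
  have : j%:R <= 2 * (int_of_index j)%:~R ^+ 2 :> R.
    apply: (@le_trans _ _ (2 * `|int_of_index j ^+ 2|)%N%:R).
      by rewrite ler_nat; exact: index_le_sqr_int.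
    by rewrite natrM natr_absz ger0_norm ?sqr_ge0// rmorphXn.
  set z2 := _ ^+ 2; move=> jz; have := ler_wpM2l (ltW b0) jz; lra.
rewrite (_ : (fun j => _) = geometric 1 (expR (- b / 2))); last first.
  by apply/funext => j; rewrite /= mul1r.
apply: is_cvg_geometric_series.
rewrite ger0_norm ?expR_ge0// expR_lt1; lra.
Qed.

(** * Summability of the Boltzmann weights on the lattice *)

Section lattice_enumeration.
Variables (R : realType) (d : nat) (L : zmodType) (H : L -> R).
Variables (c : L -> {ffun 'I_d -> int}) (K : R).
Hypothesis c_inj : injective c.
Hypothesis K0 : 0 < K.
Hypothesis cK : forall x, \sum_(i < d) (c x i)%:~R ^+ 2 <= K * H x.

(* Boltzmann weights are dominated by C^d times a product of d one-dimensional
   theta distributions, C being the theta series. *)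
Lemma energy_summable (e : nat -> L) (beta : R) : injective e -> 0 < beta ->
  cvgn (series (fun j => expR (- beta * H (e j)))).
Proof.
move=> ei b0; have bK0 : 0 < beta / K by rewrite divr_gt0.
have ct := theta_series_cvg bK0.
set th := fun j : nat => _ in ct.
have th0 j : 0 <= th j by exact: expR_ge0.
pose C := limn (series th).
have C0 : 0 < C.
  by apply: (lt_le_trans _ (term_le_lim 0 th0 ct)); exact: expR_gt0.
pose p (z : int) := expR (- (beta / K) * z%:~R ^+ 2) / C.
have p0 z : 0 <= p z by rewrite divr_ge0 ?expR_ge0// ltW.
have p1 : series (fun j => p (int_of_index j)) @ \oo --> (1 : R).
  rewrite -[X in _ --> X](mulVf (lt0r_neq0 C0)).
  rewrite (_ : (fun j => _) = (fun j => C^-1 * th j)); first exact: seriesZ_cvg.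
  by apply/funext => j; rewrite mulrC.
apply: nondecreasing_is_cvgn.
  by apply: nondecreasing_series => j _ _; exact: expR_ge0.
exists (C ^+ d) => _ [n _ <-].
rewrite series_ord.
pose F := [fset c (e (nat_of_ord j)) | j in 'I_n]%fset.
have F1 : \sum_(y <- F) power_mass p y <= 1.
  rewrite -mass_of_fset; [|by move=> y; exact: power_mass_ge0].
  apply: mass_of_le1; first by move=> y; exact: power_mass_ge0.
  exact: (@power_mass_le1 _ _ _ _ d int_of_index_bij p0 p1).
rewrite -[leRHS]mulr1; apply: le_trans (ler_wpM2l (exprn_ge0 d (ltW C0)) F1).
rewrite /F big_imfset/=; last by move=> i j _ _ /c_inj/ei/val_inj.
rewrite big_enum/= mulr_sumr; apply: ler_sum => j _.
rewrite /power_mass /p big_split/= prodr_const card_ord exprVn mulrCA mulfV ?mulr1; last first.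
  by rewrite expf_neq0// gt_eqF.
rewrite -expR_sum ler_expR -mulr_sumr !mulNr lerN2 -mulrA ler_wpM2l ?(ltW b0)//.
by rewrite ler_pdivrMl.
Qed.

End lattice_enumeration.

Lemma free_zmod_enum (L : zmodType) (d : nat) (c : L -> {ffun 'I_d -> int}) :
  (1 <= d)%N -> bijective c -> exists e : nat -> L, bijective e.
Proof.
move=> d1 [b cb bc]; apply: bijective_nat.
  apply/infiniteP.
  pose f (n : nat) : L := b [ffun=> Posz n].
  have fi : {in [set: nat] &, injective f}.
    move=> m n _ _ /(congr1 c); rewrite !bc => /ffunP/(_ (Ordinal d1)).
    by rewrite !ffunE => -[].
  rewrite -(card_le_eql (inj_card_eq fi)).
  exact: subset_card_le.
apply/countable_injP; exists (fun x => choice.pickle (c x)) => x y _ _.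
by move=> /(pcan_inj choice.pickleK)/(can_inj cb).
Qed.

(** If all the cosines were 1 at some t > 0, every energy would be an integer multiple of 2 pi /
    t. *)
Lemma nonlattice_spread (R : realType) (L : choiceType) (H : L -> R) (e : nat -> L) :
  bijective e -> (forall x, 0 <= H x) -> ~ lattice_set (range H) ->
  forall t : R, 0 < t -> exists j, cos (t * H (e j)) != 1.
Proof.
move=> [g ge eg] H0 nl t t0; apply: contrapT => nex; apply: nl.
exists 0, (pi *+ 2 / t); split.
  by rewrite divr_gt0// mulrn_wgt0// pi_gt0.
move=> _ [x _ <-].
have cx : cos (t * H x) = 1.
  apply: contrapT => /eqP cx; apply: nex; exists (g x).
  by rewrite eg.
have [k kE] := cos_eq1_nat (mulr_ge0 (ltW t0) (H0 x)) cx.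
exists (Posz k) => //; rewrite add0r.
apply: (mulfI (lt0r_neq0 t0)); rewrite kE -pmulrn.
by field; rewrite gt_eqF.
Qed.

(** * Microcanonical asymptotics *)

Lemma cvg_shift_addn (R : realType) (f : nat -> R) (k : nat) (l : R) :
  f @ \oo --> l -> (fun n => f (k + n)%N) @ \oo --> l.
Proof.
by move=> fl; under eq_fun do rewrite addnC; move: fl; rewrite -(cvg_shiftn k).
Qed.

Lemma cvg_shift_addnV (R : realType) (f : nat -> R) (k : nat) (l : R) :
  (fun n => f (k + n)%N) @ \oo --> l -> f @ \oo --> l.
Proof.
move=> fl; rewrite -(cvg_shiftn k); move: fl.
by under eq_fun do rewrite addnC.
Qed.

Lemma cvg_sqrt_ratio (R : realType) (k : nat) :
  (fun n => Num.sqrt (k + n)%:R / Num.sqrt n%:R) @ \oo --> (1 : R).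
Proof.
have : (fun n => Num.sqrt (1 + k%:R * n%:R^-1)) @ \oo --> Num.sqrt (1 + k%:R * 0 : R).
  apply: continuous_cvgn; first exact: sqrt_continuous.
  by apply: cvgD; [exact: cvg_cst|apply: cvgM; [exact: cvg_cst|exact: cvg_invn]].
rewrite mulr0 addr0 sqrtr1; apply: cvg_trans; apply: near_eq_cvg; near=> n.
have n0 : 0 < n%:R :> R by rewrite ltr0n; near: n; exact: nbhs_infty_gt.
rewrite -sqrtrV ?(ltW n0)// -sqrtrM ?ler0n//; congr Num.sqrt.
by rewrite natrD; field; rewrite gt_eqF.
Unshelve. all: by end_near. Qed.

Lemma cvg_ln_sqrt_div (R : realType) :
  (fun n => ln (Num.sqrt n%:R) / n%:R) @ \oo --> (0 : R).
Proof.
have : (fun n => Num.sqrt n%:R^-1) @ \oo --> (Num.sqrt 0 : R).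
  by apply: continuous_cvgn; [exact: sqrt_continuous|exact: cvg_invn].
rewrite sqrtr0 => s0.
apply: (@squeeze_cvgr _ _ _ _ (fun=> 0) (fun n => Num.sqrt n%:R^-1)) => //; last exact: cvg_cst.
near=> n.
have n1 : 1 <= n%:R :> R by near: n; exact: near_natr_ge.
have n0 : 0 < n%:R :> R := lt_le_trans ltr01 n1.
have s1 : 1 <= Num.sqrt n%:R :> R by rewrite -[leLHS]sqrtr1 ler_wsqrtr.
apply/andP; split; first by rewrite divr_ge0 ?ln_ge0// ltW.
rewrite ler_pdivrMr// sqrtrV ?(ltW n0)// -[X in _ * X](sqr_sqrtr (ltW n0)).
rewrite expr2 mulKf ?gt_eqF// ?(lt_le_trans ltr01 s1)//.
have := @le_ln1Dx R (Num.sqrt n%:R - 1); rewrite addrCA subrr addr0 => h.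
by apply: le_trans (h _) _; move: s1; lra.
Unshelve. all: by end_near. Qed.

Section microcanonical_asymptotics.
Variables (R : realType) (L : zmodType) (H : L -> R) (e : nat -> L) (j0 : nat).
Let h j := H (e j).
Hypothesis e_bij : bijective e.
Hypothesis H0 : forall x, 0 <= H x.
Hypothesis hj0 : h j0 = 0.
Hypothesis summable_h : forall beta, 0 < beta -> cvgn (series (fun j => expR (- beta * h j))).
Hypothesis h_spread : forall t, 0 < t -> exists j, cos (t * h j) != 1.
Variables (Delta : R) (E : nat -> R) (u : R).
Hypothesis Delta_gt0 : 0 < Delta.
Hypothesis u_gt0 : 0 < u.
Hypothesis E_lim : (fun N => E N / N%:R) @ \oo --> u.

Let h0 j : 0 <= h j. Proof. exact: H0. Qed.
Let nc := spread_nonconst hj0 h_spread.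
Let beta := inv_temp H u.
Let u_ N := E N / N%:R.
Let beta_ N := inv_temp H (u_ N).
Let G N := shell_card H N (E N) Delta.

Let beta0 : 0 < beta.
Proof. exact: (inv_temp_spec e_bij H0 hj0 summable_h nc u_gt0).1. Qed.

Let beta_lim : beta_ @ \oo --> beta.
Proof. exact: (inv_temp_cvg e_bij H0 hj0 summable_h nc u_gt0 E_lim). Qed.

Lemma near_energy_density_gt0 : \forall N \near \oo, 0 < u_ N.
Proof. exact: (cvgr_gt u). Qed.

Let near_beta0 : \forall N \near \oo, 0 < beta_ N.
Proof. exact: (cvgr_gt beta). Qed.

Let near_mean : \forall N \near \oo, N%:R * emean h (beta_ N) = E N.
Proof.
near=> N.
have N0 : 0 < N%:R :> R by rewrite ltr0n; near: N; exact: nbhs_infty_gt.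
have uN : 0 < u_ N by near: N; exact: near_energy_density_gt0.
rewrite (inv_temp_spec e_bij H0 hj0 summable_h nc uN).2 /u_ mulrC divfK//.
by rewrite gt_eqF.
Unshelve. all: by end_near. Qed.

(** The count divided by Z^N e^{beta_N E_N} / sqrt N. Its convergence to a positive constant yields
    positivity, the sharp asymptotics and the logarithmic limit. *)
Let density N := Num.sqrt N%:R *
  ((moment h 0 (beta_ N) ^+ N)^-1 * expR (- (beta_ N * E N)) * (G N)%:R).

Let gauss b := (Num.sqrt (2 * pi * evar h b))^-1 * ((expR (b * Delta) - 1) / b).

Let gauss_gt0 b : 0 < b -> 0 < gauss b.
Proof.
move=> b0; apply: mulr_gt0.
  rewrite invr_gt0 sqrtr_gt0; apply: mulr_gt0; last exact: (evar_gt0 h0 hj0 summable_h nc).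
  by apply: mulr_gt0 => //; exact: pi_gt0.
by apply: divr_gt0 => //; rewrite subr_gt0 expR_gt1 mulr_gt0.
Qed.

Let gauss_lim : (fun N => gauss (beta_ N)) @ \oo --> gauss beta.
Proof.
apply: cvgM.
  apply: cvgV.
    rewrite gt_eqF// sqrtr_gt0; apply: mulr_gt0; last exact: (evar_gt0 h0 hj0 summable_h nc).
    by apply: mulr_gt0 => //; exact: pi_gt0.
  apply: continuous_cvgn; first exact: sqrt_continuous.
  apply: cvgM; first exact: cvg_cst.
  by apply: continuous_cvgn => //; exact: (evar_continuous h0 hj0).
apply: cvgM; last by apply: cvgV => //; rewrite gt_eqF.
apply: cvgB; last exact: cvg_cst.
apply: continuous_cvgn; first exact: continuous_expR.
by apply: cvgM => //; exact: cvg_cst.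
Qed.

Let density_lim : density @ \oo --> gauss beta.
Proof.
apply: (cvg_boxcount h0 hj0 summable_h h_spread (B := 0)) => //.
  by near=> N; rewrite (near near_mean) ?subrr ?normr0.
by move=> N; exact: shell_card_box.
Unshelve. all: by end_near. Qed.

Let near_density0 : \forall N \near \oo, 0 < density N.
Proof. exact: (cvgr_gt (gauss beta) density_lim _ (gauss_gt0 beta0)). Qed.

Lemma near_shell_card_gt0 : \forall N \near \oo, (0 < G N)%N.
Proof.
near=> N; have : 0 < density N by near: N; exact: near_density0.
by rewrite /density; case: (G N) => //; rewrite !mulr0 ltxx.
Unshelve. all: by end_near. Qed.

Let shell_cardE N : (0 < N)%N -> 0 < beta_ N ->
  (G N)%:R = moment h 0 (beta_ N) ^+ N * expR (beta_ N * E N) / Num.sqrt N%:R * density N.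
Proof.
move=> N0 b0.
have Z0 := exprn_gt0 N (moment0_gt0 h0 hj0 summable_h b0).
have s0 : 0 < Num.sqrt N%:R :> R by rewrite sqrtr_gt0 ltr0n.
have x0 := expR_gt0 (beta_ N * E N).
rewrite /density expRN; field.
by rewrite !gt_eqF.
Qed.

Lemma shell_card_asymptotics : exists o1 : nat -> R, o1 @ \oo --> (0 : R) /\
  \forall N \near \oo, (G N)%:R =
    partition_function H (beta_ N) ^+ N * expR (beta_ N * E N)
    / Num.sqrt (2 * pi * N%:R * var_energy H (beta_ N))
    * (\int[lebesgue_measure]_(t in `[0, Delta]) expR (beta_ N * t))
    * (1 + o1 N).
Proof.
(* [gauss] is taken at [beta_ N], as in the claimed formula; its continuity makes the quotient tend
   to 1. *)
exists (fun N => density N / gauss (beta_ N) - 1); split.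
  rewrite -[X in _ --> X](subrr 1); apply: cvgB; last exact: cvg_cst.
  rewrite -[X in _ --> X](divff (lt0r_neq0 (gauss_gt0 beta0))).
  apply: cvgM => //; apply: cvgV => //.
  by rewrite gt_eqF// gauss_gt0.
near=> N.
have N0 : (0 < N)%N by near: N; exact: nbhs_infty_gt.
have b0 : 0 < beta_ N by near: N; exact: near_beta0.
rewrite Rintegral_expRM ?(ltW Delta_gt0)// (partition_functionE e_bij H0 summable_h)//.
rewrite (var_energyE e_bij H0 hj0 summable_h b0).
rewrite shell_cardE// addrCA subrr addr0 /gauss.
have v0 := evar_gt0 h0 hj0 summable_h nc b0.
have -> : 2 * pi * N%:R * evar h (beta_ N) = N%:R * (2 * pi * evar h (beta_ N)).
  by rewrite mulrAC [RHS]mulrC.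
rewrite sqrtrM ?ler0n//.
have s0 : 0 < Num.sqrt N%:R :> R by rewrite sqrtr_gt0 ltr0n.
have t0 : 0 < Num.sqrt (2 * pi * evar h (beta_ N)).
  by rewrite sqrtr_gt0 mulr_gt0// mulr_gt0// pi_gt0.
have i0 : 0 < expR (beta_ N * Delta) - 1 by rewrite subr_gt0 expR_gt1 mulr_gt0.
move: (Num.sqrt N%:R) (Num.sqrt (2 * _ * _)) (expR (beta_ N * Delta) - 1) s0 t0 i0 => s t i s0 t0 i0.
by field; rewrite !gt_eqF.
Unshelve. all: by end_near. Qed.

(** After taking logarithms, [density] has a positive limit and sqrt N is subexponential, so both
    disappear on division by N. *)
Lemma ln_shell_card_cvg :
  (fun N => N%:R^-1 * ln (G N)%:R) @ \oo --> psi H beta + beta * u.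
Proof.
rewrite (psiE e_bij H0 summable_h)//.
have -> : epsi h beta + beta * u = epsi h beta + beta * u + 0 - 0 by rewrite addr0 subr0.
have lnl : (fun N => N%:R^-1 * ln (density N)) @ \oo --> (0 : R).
  rewrite -[X in _ --> X](mul0r (ln (gauss beta))); apply: cvgM; first exact: cvg_invn.
  by apply: continuous_cvgn => //; apply: continuous_ln; exact: gauss_gt0.
have pl : (fun N => epsi h (beta_ N)) @ \oo --> epsi h beta.
  apply: (@continuous_cvgn _ (@ln R) (fun N => moment h 0 (beta_ N))).
    by apply: continuous_ln; exact: (moment0_gt0 h0 hj0).
  by apply: continuous_cvgn => //; exact: (moment_continuous h0).
have : (fun N => epsi h (beta_ N) + beta_ N * u_ N + N%:R^-1 * ln (density N) -
    ln (Num.sqrt N%:R) / N%:R) @ \oo --> epsi h beta + beta * u + 0 - 0.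
  apply: cvgB; last exact: cvg_ln_sqrt_div.
  by apply: cvgD => //; apply: cvgD => //; exact: cvgM.
apply: cvg_trans; apply: near_eq_cvg; near=> N.
have N0 : (0 < N)%N by near: N; exact: nbhs_infty_gt.
have b0 : 0 < beta_ N by near: N; exact: near_beta0.
have d0 : 0 < density N by near: N; exact: near_density0.
have Z0 := moment0_gt0 h0 hj0 summable_h b0.
have s0 : 0 < Num.sqrt N%:R :> R by rewrite sqrtr_gt0 ltr0n.
have x0 := expR_gt0 (beta_ N * E N).
rewrite shell_cardE// lnM ?posrE//; last first.
  by apply: mulr_gt0; [apply: mulr_gt0 => //; exact: exprn_gt0|rewrite invr_gt0].
rewrite lnM ?posrE ?invr_gt0//; last by apply: mulr_gt0 => //; exact: exprn_gt0.
rewrite lnM ?posrE ?exprn_gt0// lnXn// expRK lnV ?posrE// -[_ *+ N]mulr_natl /epsi /u_.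
by rewrite /=; field; rewrite pnatr_eq0 -lt0n.
Unshelve. all: by end_near. Qed.

Lemma image_microcanonical_cvg k (y : {ffun 'I_k -> L}) :
  (fun N => image_mass (@proj_first L k N) (@microcanonical R L H N (E N) Delta) y) @ \oo -->
  power_mass (gibbs H beta) y.
Proof.
pose T := total_energy H y.
pose G' M := shell_card H M (E (k + M)%N - T) Delta.
(* The M remaining coordinates keep the tilt of the full system of k + M, so that both normalised
   counts converge to the same constant [gauss beta]. *)
pose density' M := Num.sqrt M%:R * ((moment h 0 (beta_ (k + M)) ^+ M)^-1 *
  expR (- (beta_ (k + M) * (E (k + M)%N - T))) * (G' M)%:R).
have Z0 := moment0_gt0 h0 hj0 summable_h beta0.
have bl := cvg_shift_addn k beta_lim.
have nb : \forall M \near \oo, 0 < beta_ (k + M) by exact: (cvgr_gt beta bl).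
have dl : density' @ \oo --> gauss beta.
  (* Under this tilt the mean of M coordinates misses the target E - T by -k emean + T, and emean is
     eventually at most its limit plus 1. *)
  apply: (cvg_boxcount h0 hj0 summable_h h_spread (B := k%:R * (emean h beta + 1) + `|T|)) => //.
  - have ml : (fun M => emean h (beta_ (k + M))) @ \oo --> emean h beta.
      by apply: continuous_cvgn; [exact: (emean_continuous h0 hj0)|exact: cvg_shift_addn].
    have nm : \forall M \near \oo, (k + M)%:R * emean h (beta_ (k + M)) = E (k + M)%N.
      have [M0 _ M0P] := near_mean; exists M0 => // M /= M0M.
      by apply: M0P; exact: leq_trans M0M (leq_addl _ _).
    near=> M.
    have m1 : `|emean h beta - emean h (beta_ (k + M))| <= 1.
      by near: M; apply: near_dist_le ml _.
    rewrite -(near nm M)//.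
    have -> : M%:R * emean h (beta_ (k + M)) - ((k + M)%:R * emean h (beta_ (k + M)) - T) =
        - (k%:R * emean h (beta_ (k + M))) + T by rewrite natrD; ring.
    apply: le_trans (ler_normD _ _) _; rewrite lerD2r normrN normrM ger0_norm ?ler0n//.
    rewrite ler_wpM2l ?ler0n//.
    rewrite ger0_norm; first by move: m1; rewrite ler_norml; lra.
    have b0 : 0 < beta_ (k + M) by near: M.
    by apply: divr_ge0; apply: moment_ge0.
  - by move=> M; exact: shell_card_box.
apply: (@cvg_shift_addnV _ _ k).
under eq_fun do rewrite (image_mass_proj_first _ y (finite_shell e_bij H0 summable_h)).
have -> : power_mass (gibbs H beta) y = gauss beta / gauss beta * 1 *
    ((moment h 0 beta ^+ k)^-1 * expR (- (beta * T))).
  rewrite divff ?mul1r; last by rewrite gt_eqF// gauss_gt0.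
  rewrite /power_mass /gibbs big_split/= prodr_const card_ord.
  rewrite (partition_functionE e_bij H0 summable_h)// exprVn -expR_sum -mulr_sumr.
  by rewrite mulNr.
have nG : \forall M \near \oo, (0 < G (k + M))%N.
  have [M1 _ M1P] := near_shell_card_gt0; exists M1 => // M /= M1M.
  by apply: M1P; exact: leq_trans M1M (leq_addl _ _).
have fl : (fun M => (moment h 0 (beta_ (k + M)) ^+ k)^-1 * expR (- (beta_ (k + M) * T))) @ \oo -->
    (moment h 0 beta ^+ k)^-1 * expR (- (beta * T)).
  apply: cvgM.
    apply: cvgV; first by rewrite gt_eqF// exprn_gt0.
    apply: (@continuous_cvgn _ (fun x => x ^+ k)); first exact: exprn_continuous.
    by apply: continuous_cvgn => //; exact: (moment_continuous h0).
  apply: continuous_cvgn; first exact: continuous_expR.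
  by apply: cvgN; apply: cvgM => //; exact: cvg_cst.
have : (fun M => density' M / density (k + M) * (Num.sqrt (k + M)%:R / Num.sqrt M%:R) *
    ((moment h 0 (beta_ (k + M)) ^+ k)^-1 * expR (- (beta_ (k + M) * T)))) @ \oo -->
    gauss beta / gauss beta * 1 * ((moment h 0 beta ^+ k)^-1 * expR (- (beta * T))).
  apply: cvgM fl; apply: cvgM; last exact: cvg_sqrt_ratio.
  apply: cvgM => //; apply: cvgV; first by rewrite gt_eqF// gauss_gt0.
  exact: cvg_shift_addn.
apply: cvg_trans; apply: near_eq_cvg; near=> M.
have M0 : (0 < M)%N by near: M; exact: nbhs_infty_gt.
have b0 : 0 < beta_ (k + M) by near: M.
have Zb := moment0_gt0 h0 hj0 summable_h b0.
have s0 : 0 < Num.sqrt M%:R :> R by rewrite sqrtr_gt0 ltr0n.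
have t0 : 0 < Num.sqrt (k + M)%:R :> R by rewrite sqrtr_gt0 ltr0n ltn_addl.
have G0 : 0 < (G (k + M))%:R :> R by rewrite ltr0n; near: M.
rewrite /density' /density -/(G (k + M)) -/(G' M) mulrBr opprB expRD !expRN exprD.
move: (expR_gt0 (beta_ (k + M) * E (k + M)%N)) (expR_gt0 (beta_ (k + M) * T)) => x0 y0.
have := exprn_gt0 k Zb; have := exprn_gt0 M Zb => z0 w0 /=.
by field; rewrite !gt_eqF.
Unshelve. all: by end_near. Qed.

Lemma tv_dist_microcanonical_cvg k :
  (fun N => tv_dist (image_mass (@proj_first L k N) (@microcanonical R L H N (E N) Delta))
     (@power_mass R L k (gibbs H beta))) @ \oo --> (0 : R).
Proof.
have Z0 := moment0_gt0 h0 hj0 summable_h beta0.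
have p0 x : 0 <= gibbs H beta x.
  rewrite /gibbs (partition_functionE e_bij H0 summable_h)//.
  by apply: mulr_ge0; [rewrite invr_ge0 ltW|exact: expR_ge0].
have p1 : series (fun j => gibbs H beta (e j)) @ \oo --> (1 : R).
  rewrite /gibbs (partition_functionE e_bij H0 summable_h)//.
  rewrite -[X in _ --> X](mulVf (lt0r_neq0 Z0)); apply: seriesZ_cvg.
  rewrite (_ : (fun j => _) = boltz h beta 0); first exact: moment_cvg.
  by apply/funext => j; rewrite /boltz expr0 mul1r.
have fs := finite_shell e_bij H0 summable_h.
apply: cvg_tv_dist.
- by near=> N => y; apply: image_mass_ge0 => x; exact: microcanonical_ge0.
- near=> N; apply: image_mass_le1; first by move=> x; exact: microcanonical_ge0.
  by apply: microcanonical_le1; exact: fs.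
- by move=> y; exact: power_mass_ge0.
- exact: power_mass_le1 e_bij p0 p1.
- by move=> eps; exact: (power_mass_tight k e_bij p1).
- exact: image_microcanonical_cvg.
Unshelve. all: by end_near. Qed.

End microcanonical_asymptotics.

Theorem theorem17 (R : realType) (d : nat) (L : zmodType) (V : lmodType R)
    (iota : {additive L -> V}) (ip : {dot V for @idfun R})
    (H := energy iota ip)
    (d_ge1 : (1 <= d)%N)
    (L_free : free_of_rank L d)
    (V_ext : is_scalar_extension iota)
    (H_nonlattice : ~ lattice_set (range H))
    (Delta : R) (Delta_gt0 : 0 < Delta)
    (E : nat -> R) (u : R) (u_gt0 : 0 < u)
    (E_lim : (fun N : nat => E N / N%:R) @ \oo --> u) :
  let beta := inv_temp H u in
  let G := fun N : nat => shell_card H N (E N) Delta in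
  let u_ := fun N : nat => E N / N%:R in
  let beta_ := fun N : nat => inv_temp H (u_ N) in
  [/\ \forall N \near \oo, (0 < G N)%N,
      forall k : nat, (1 <= k)%N ->
        (fun N : nat =>
           tv_dist (image_mass (@proj_first L k N)
                      (@microcanonical R L H N (E N) Delta))
                   (@power_mass R L k (gibbs H beta))) @ \oo --> (0 : R),
      \forall N \near \oo, 0 < u_ N,
      exists o1 : nat -> R,
        o1 @ \oo --> (0 : R) /\
        \forall N \near \oo,
          (G N)%:R =
            partition_function H (beta_ N) ^+ N * expR (beta_ N * E N)
            / Num.sqrt (2 * pi * N%:R * var_energy H (beta_ N))
            * (\int[lebesgue_measure]_(t in `[0, Delta]) expR (beta_ N * t))
            * (1 + o1 N)
    & (fun N : nat => N%:R^-1 * ln (G N)%:R) @ \oo --> psi H beta + beta * u /\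
      psi H beta + beta * u = entropy H u].
Proof.
move=> beta G u_ beta_.
have [b [c cb bc]] := L_free.
have c_bij : bijective c by exists (fun f : {ffun 'I_d -> int} => \sum_(i < d) b i *~ f i).
have [e e_bij] := free_zmod_enum d_ge1 c_bij.
have H0 x : 0 <= H x by rewrite /H energyE ip_self_ge0.
(* The zero vector is the ground level: it gives Z >= 1 and the reference phase of the
   characteristic function. *)
have [j0 ej0] : exists j0, e j0 = 0 by have [g _ eg] := e_bij; exists (g 0).
have hj0 : H (e j0) = 0 by rewrite ej0 /H energyE raddf0; exact: linear0r.
have [K K0 cK] := coord_sqr_le_energy ip bc cb V_ext.
have summable_h beta' : 0 < beta' -> cvgn (series (fun j => expR (- beta' * H (e j)))).
  exact: (energy_summable (bij_inj c_bij) K0 cK (bij_inj e_bij)).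
have h_spread := nonlattice_spread e_bij H0 H_nonlattice.
(* From here on the lattice is seen only through [H]: nonnegativity, a zero level, summable weights
   and spread. *)
clearbody H.
have nc := @spread_nonconst R (fun j => H (e j)) j0 hj0 h_spread.
split.
- exact: (near_shell_card_gt0 e_bij H0 hj0 summable_h h_spread Delta_gt0 u_gt0 E_lim).
- move=> k _.
  exact: (tv_dist_microcanonical_cvg e_bij H0 hj0 summable_h h_spread Delta_gt0 u_gt0 E_lim).
- exact: near_energy_density_gt0 u_gt0 E_lim.
- exact: (shell_card_asymptotics e_bij H0 hj0 summable_h h_spread Delta_gt0 u_gt0 E_lim).
- split; first exact: (ln_shell_card_cvg e_bij H0 hj0 summable_h h_spread Delta_gt0 u_gt0 E_lim).
  exact: (entropyE e_bij H0 hj0 summable_h nc u_gt0).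
Qed.
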